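(* Let $\Omega\subset\mathbb{R}^n$, $n\ge2$, be a bounded open set, let $\varphi:\Omega\times[0,\infty)\to[0,\infty)$ be a convex $\Phi$-function satisfying (A0), (A1), (aInc)$_p$ and (aDec)$_q$ with $1<p\le q\le n$, and let $A:\Omega\times\mathbb{R}^n\to\mathbb{R}^n$ satisfy the structure conditions (Carathéodory, growth and coercivity with respect to $\varphi$ with constants $c_1,c_2>0$, strict monotonicity). Let $E\subset\Omega$ be a relatively closed subset of $\Omega$ such that $\mathcal{H}_{\varphi(\cdot)}(E)<\infty$ and let $u\in W^{1,\varphi(\cdot)}(\Omega)$ satisfy $$\int_{\Omega\setminus E}A(x,Du)\cdot Dw\,dx=0\qquad\text{for all } w\in W^{1,\varphi(\cdot)}_0(\Omega\setminus E).$$ Then $u$ is a solution to $-\mathrm{div}\,A(x,Du)=0$ on the whole $\Omega$.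
   Context: Convex $\Phi$-function: $\varphi:\Omega\times[0,\infty)\to[0,\infty]$ such that for every $s\ge 0$ the function $x\mapsto\varphi(x,s)$ is measurable; for a.e. $x\in\Omega$ the function $s\mapsto\varphi(x,s)$ is increasing, convex and left-continuous for $s>0$; $\varphi(x,0)=\lim_{s\to0^+}\varphi(x,s)=0$ and $\lim_{s\to\infty}\varphi(x,s)=\infty$ for a.e. $x$; and for some $L\ge1$ and a.e. $x$ the function $s\mapsto\varphi(x,s)/s$ is $L$-almost increasing on $s>0$. A function $f$ is $L$-almost increasing if $f(s)\le Lf(t)$ for all $s\le t$; $L$-almost decreasing is defined analogously. For a ball $B$ put $\varphi_B^+(s)=\sup_{x\in B\cap\Omega}\varphi(x,s)$, $\varphi_B^-(s)=\inf_{x\in B\cap\Omega}\varphi(x,s)$, with inverse $(\varphi_B^-)^{-1}(\tau)=\inf\{s\ge0:\varphi_B^-(s)\ge\tau\}$; $\varphi^{\pm}$ denote the supremum/infimum over $x\in\Omega$. (A0): there is $\beta\in(0,1)$ with $\varphi^+(\beta)\le1\le\varphi^-(1/\beta)$. (A1): there is $\beta\in(0,1)$ such that $\varphi_B^+(\beta s)\le\varphi_B^-(s)$ for every $s\in[1,(\varphi_B^-)^{-1}(1/|B|)]$ and every ball $B$ with $(\varphi_B^-)^{-1}(1/|B|)\ge1$. (aInc)$_p$: there is $L_p\ge1$ such that $s\mapsto\varphi(x,s)/s^p$ is $L_p$-almost increasing in $(0,\infty)$. (aDec)$_q$: there is $L_q\ge1$ such that $s\mapsto\varphi(x,s)/s^q$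 is $L_q$-almost decreasing in $(0,\infty)$. Structure conditions on $A:\Omega\times\mathbb{R}^n\to\mathbb{R}^n$: $x\mapsto A(x,z)$ is measurable and $z\mapsto A(x,z)$ is continuous; for a.e. $x\in\Omega$ and all $z\in\mathbb{R}^n\setminus\{0\}$, $|A(x,z)|\le c_1\varphi(x,|z|)/|z|$ and $c_2\varphi(x,|z|)\le A(x,z)\cdot z$; and $0<(A(x,z_1)-A(x,z_2))\cdot(z_1-z_2)$ for a.e. $x\in\Omega$ and all distinct $z_1,z_2\in\mathbb{R}^n$. Function spaces: for an open set $U\subset\Omega$, $L^{\varphi(\cdot)}(U)$ is the set of measurable $w$ on $U$ with $\int_U\varphi(x,|w|)\,dx<\infty$, with the Luxemburg norm $\inf\{\lambda>0:\int_U\varphi(x,|w|/\lambda)\,dx\le1\}$; $W^{1,\varphi(\cdot)}(U)=\{w\in W^{1,1}(U): w,|Dw|\in L^{\varphi(\cdot)}(U)\}$ with norm $\|w\|_{L^{\varphi(\cdot)}(U)}+\|Dw\|_{L^{\varphi(\cdot)}(U)}$; $W^{1,\varphi(\cdot)}_0(U)$ is the closure of $C_c^\infty(U)$ in $W^{1,\varphi(\cdot)}(U)$. Being a solution to $-\mathrm{div}\,A(x,Du)=0$ on $\Omega$ means $\int_\Omega A(x,Du)\cdot Dw\,dx=0$ for all $w\in W^{1,\varphi(\cdot)}_0(\Omega)$ (equivalently, for all $w\in C_c^\infty(\Omega)$). Intrinsic Hausdorff measure: for an open ball $B\subset\Omega$ of radius $\varrho(B)$ put $h_{\varphi(\cdot)}(B)=\int_B\varphi(x,1/\varrho(B))\,dx$.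 For $E\subset\Omega$ and $\delta\in(0,1]$, $\mathcal{H}_{\varphi(\cdot),\delta}(E)=\inf\sum_jh_{\varphi(\cdot)}(B_j)$, the infimum being over all countable collections $\{B_j\}$ of balls $B_j\subset\Omega$ covering $E$ with $\varrho(B_j)\le\delta$; and $\mathcal{H}_{\varphi(\cdot)}(E)=\lim_{\delta\to0}\mathcal{H}_{\varphi(\cdot),\delta}(E)$. *)

(* Defs.v *)
From HB Require Import structures.
From mathcomp Require Import all_boot all_order all_algebra.
From mathcomp Require Import all_classical all_reals all_analysis.
Set Implicit Arguments.
Unset Strict Implicit.
Unset Printing Implicit Defensive.
Import Order.TTheory GRing.Theory Num.Theory.
Import numFieldNormedType.Exports.
Local Open Scope classical_set_scope.
Local Open Scope ring_scope.

(* R^n is 'rV[R]_n.  The library norm on it is the sup norm, so the Euclidean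
   inner product, norm and balls are defined here; the topology is the same. *)
Definition dotp (R : realType) (n : nat) (x y : 'rV[R]_n) : R :=
  \sum_(i < n) x ord0 i * y ord0 i.

Definition enorm (R : realType) (n : nat) (x : 'rV[R]_n) : R :=
  Num.sqrt (dotp x x).

Definition eball (R : realType) (n : nat) (c : 'rV[R]_n) (r : R) :
    set 'rV[R]_n :=
  [set y | enorm (y - c) < r].

(* Lebesgue measure on R^n: the Caratheodory construction from the volume of
   open boxes.  Countable families are indexed by subsets of nat, so that finite
   and empty families are included. *)
Definition obox (R : realType) (n : nat) (a b : 'rV[R]_n) : set 'rV[R]_n :=
  [set x | forall i, a ord0 i < x ord0 i < b ord0 i].

Definition box_vol (R : realType) (n : nat) (a b : 'rV[R]_n) : \bar R :=
  (\prod_(i < n) (b ord0 i - a ord0 i))%:E.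

Definition box_cover (R : realType) (n : nat) (X : set 'rV[R]_n)
    (J : set nat) (a b : nat -> 'rV[R]_n) : Prop :=
  (forall k, J k -> forall i, a k ord0 i <= b k ord0 i) /\
  X `<=` \bigcup_(k in J) obox (a k) (b k).

Definition lebesgue_outer (R : realType) (n : nat) (X : set 'rV[R]_n) :
    \bar R :=
  ereal_inf [set m | exists J a b,
    box_cover X J a b /\ m = (\esum_(k in J) box_vol (a k) (b k))%E].

Lemma box_vol_ge0 (R : realType) (n : nat) (a b : 'rV[R]_n) :
  (forall i, a ord0 i <= b ord0 i) -> (0 <= box_vol a b)%E.
Proof.
move=> ab; rewrite lee_fin; apply: prodr_ge0 => i _.
by rewrite subr_ge0.
Qed.

Lemma lebesgue_outer_ge0 (R : realType) (n : nat) (X : set 'rV[R]_n) :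
  (0 <= lebesgue_outer X)%E.
Proof.
apply: le_ereal_inf_tmp => _ [J [a [b [[ab _] ->]]]].
by apply: esum_ge0 => k Jk; apply: box_vol_ge0; exact: ab.
Qed.

Lemma lebesgue_outer0 (R : realType) (n : nat) :
  lebesgue_outer (set0 : set 'rV[R]_n) = 0%E.
Proof.
apply/eqP; rewrite eq_le lebesgue_outer_ge0 andbT.
apply: ereal_inf_lbound; exists set0, (fun=> 0), (fun=> 0).
by split; [split|rewrite esum_set0].
Qed.

Lemma le_lebesgue_outer (R : realType) (n : nat) :
  {homo @lebesgue_outer R n : X Y / X `<=` Y >-> (X <= Y)%E}.
Proof.
move=> X Y XY; apply: ereal_inf_le_tmp => _ [J [a [b [[ab Ycov] ->]]]].
by exists J, a, b; split=> //; split=> //; exact: subset_trans Ycov.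
Qed.

Lemma lebesgue_outer_sigma_subadditive (R : realType) (n : nat) :
  sigma_subadditive (@lebesgue_outer R n).
Proof.
move=> A; have [[i ioo]|] := pselect (exists i, lebesgue_outer (A i) = +oo%E).
  rewrite (eseries_pinfty _ _ ioo) ?leey// => j _.
  by rewrite -ltNye (lt_le_trans _ (lebesgue_outer_ge0 _)).
rewrite -forallNE => Aoo.
suff add2e (e : {posnum R}) :
    (lebesgue_outer (\bigcup_n A n) <=
     \sum_(i <oo) lebesgue_outer (A i) + e%:num%:E)%E.
  by apply/lee_addgt0Pr => _/posnumP[].
rewrite (le_trans _ (epsilon_trick _ _ _))//; last first.
  by move=> k; exact: lebesgue_outer_ge0.
pose V := 'rV[R]_n.
pose P k (G : set nat * (nat -> V) * (nat -> V)) :=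
  box_cover (A k) G.1.1 G.1.2 G.2 /\
  (\esum_(j in G.1.1) box_vol (G.1.2 j) (G.2 j) <=
   lebesgue_outer (A k) + (e%:num / (2 ^ k.+1)%:R)%:E)%E.
have [G PG] : {G : nat -> set nat * (nat -> V) * (nat -> V) &
    forall k, P k (G k)}.
  apply: (@choice _ _ P) => k.
  have ek : 0 < e%:num / (2 ^ k.+1)%:R :> R by [].
  have fk : lebesgue_outer (A k) \is a fin_num.
    by rewrite ge0_fin_numE ?lebesgue_outer_ge0// ltey; apply/eqP/Aoo.
  have [_ [J [a [b [Jab ->]]]] lt] := lb_ereal_inf_adherent ek fk.
  by exists (J, a, b); split=> //; exact: ltW.
have volG i j : (G i).1.1 j -> (0 <= box_vol ((G i).1.2 j) ((G i).2 j))%E.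
  by move=> Gij; apply: box_vol_ge0; have [[+ _] _] := PG i; apply.
apply: (@le_trans _ _ (\sum_(i <oo)
    \esum_(j in (G i).1.1) box_vol ((G i).1.2 j) ((G i).2 j))%E); last first.
  apply: lee_nneseries => [i _ _|i _]; last exact: (PG i).2.
  by apply: esum_ge0 => j; exact: volG.
rewrite nneseries_esumT; last first.
  by move=> i; apply: esum_ge0 => j; exact: volG.
rewrite esum_esum; last by move=> i j _; exact: volG.
have /ppcard_eqP[f] := card_nat2.
apply: ereal_inf_lbound.
pose g := (f^-1)%FUN : nat -> nat * nat.
exists [set k | (G (g k).1).1.1 (g k).2],
  (fun k => (G (g k).1).1.2 (g k).2), (fun k => (G (g k).1).2 (g k).2).
split; first split.
- by move=> k /= Gk; have [[+ _] _] := PG (g k).1; apply.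
- move=> x [i _ Aix]; have [[_ /(_ _ Aix)[j Gij xij]] _] := PG i.
  by exists (f (i, j)) => /=; rewrite /g funK ?inE.
- rewrite (@reindex_esum _ _ _
    [set k | (G (g k).1).1.1 (g k).2] _ g) //.
  split=> [k /= Gk|k l _ _|[i j] [_ /= Gij]]; first by split.
    by apply: (can_inj (g := f)) => ?; rewrite invK ?inE.
  by exists (f (i, j)); rewrite /= /g funK ?inE.
Qed.

HB.instance Definition _ (R : realType) (n : nat) :=
  isOuterMeasure.Build R 'rV[R]_n (@lebesgue_outer R n)
    (@lebesgue_outer0 R n) (@lebesgue_outer_ge0 R n)
    (@le_lebesgue_outer R n) (@lebesgue_outer_sigma_subadditive R n).

Notation leb_space R n := (caratheodory_type (@lebesgue_outer R n)).

Definition leb (R : realType) (n : nat) : set (leb_space R n) -> \bar R :=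
  @lebesgue_outer R n.

HB.instance Definition _ (R : realType) (n : nat) :=
  isMeasure.Build _ _ _ (@leb R n)
    (@lebesgue_outer0 R n) (@lebesgue_outer_ge0 R n)
    (@caratheodory_measure_sigma_additive R 'rV[R]_n (@lebesgue_outer R n)).

Arguments leb R n X : clear implicits.

Definition leb_measurable_fun (R : realType) (n : nat) (U : set 'rV[R]_n)
    (f : 'rV[R]_n -> R) : Prop :=
  measurable_fun (U : set (leb_space R n)) (f : leb_space R n -> R).

Definition pderiv (R : realType) (n : nat) (i : 'I_n) (f : 'rV[R]_n -> R) :
    'rV[R]_n -> R :=
  fun x => 'D_(delta_mx ord0 i) (f : 'rV[R]_n -> R^o) x.

Definition grad (R : realType) (n : nat) (f : 'rV[R]_n -> R) (x : 'rV[R]_n) :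
    'rV[R]_n :=
  \row_i pderiv i f x.

Definition iter_pderiv (R : realType) (n : nat) (s : seq 'I_n)
    (f : 'rV[R]_n -> R) : 'rV[R]_n -> R :=
  foldr (@pderiv R n) f s.

Definition smooth (R : realType) (n : nat) (f : 'rV[R]_n -> R) : Prop :=
  forall s : seq 'I_n,
    continuous (iter_pderiv s f) /\
    forall (i : 'I_n) (x : 'rV[R]_n),
      derivable (iter_pderiv s f : 'rV[R]_n -> R^o) x (delta_mx ord0 i).

Definition test_fun (R : realType) (n : nat) (U : set 'rV[R]_n)
    (f : 'rV[R]_n -> R) : Prop :=
  [/\ smooth f, compact (closure [set x | f x != 0]) &
      closure [set x | f x != 0] `<=` U].

Definition almost_increasing (R : realType) (L : R) (f : R -> R) : Prop :=
  forall s t : R, 0 < s -> s <= t -> f s <= L * f t.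

Definition almost_decreasing (R : realType) (L : R) (f : R -> R) : Prop :=
  forall s t : R, 0 < s -> s <= t -> f t <= L * f s.

(* Finite-valued convex Phi-functions on Omega.  Only the values phi x s with
   x in Omega and 0 <= s matter. *)
Record convex_Phi (R : realType) (n : nat) (Omega : set 'rV[R]_n)
    (phi : 'rV[R]_n -> R -> R) : Prop := ConvexPhi {
  Phi_ge0 : forall (x : 'rV[R]_n) (s : R), Omega x -> 0 <= s -> 0 <= phi x s;
  Phi_measurable : forall s : R, 0 <= s ->
    leb_measurable_fun Omega (phi ^~ s);
  Phi_increasing : {ae leb R n, forall x, Omega x ->
    forall s t : R, 0 <= s -> s <= t -> phi x s <= phi x t};
  Phi_convex : {ae leb R n, forall x, Omega x ->
    convex_function (`[0, +oo[ : set R^o) (phi x)};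
  Phi_left_continuous : {ae leb R n, forall x, Omega x ->
    forall s : R, 0 < s -> phi x t @[t --> s^'-] --> phi x s};
  Phi_at0 : {ae leb R n, forall x, Omega x ->
    phi x 0 = 0 /\ phi x s @[s --> 0^'+] --> (0 : R)};
  Phi_at_infty : {ae leb R n, forall x, Omega x ->
    phi x s @[s --> +oo] --> +oo};
  Phi_almost_increasing : exists2 L : R, 1 <= L &
    {ae leb R n, forall x, Omega x ->
      almost_increasing L (fun s => phi x s / s)} }.

Definition Phi_sup (R : realType) (n : nat) (phi : 'rV[R]_n -> R -> R)
    (D : set 'rV[R]_n) (s : R) : \bar R :=
  ereal_sup [set (phi x s)%:E | x in D].

Definition Phi_inf (R : realType) (n : nat) (phi : 'rV[R]_n -> R -> R)
    (D : set 'rV[R]_n) (s : R) : \bar R :=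
  ereal_inf [set (phi x s)%:E | x in D].

Definition Phi_inf_inv (R : realType) (n : nat) (phi : 'rV[R]_n -> R -> R)
    (D : set 'rV[R]_n) (tau : \bar R) : \bar R :=
  ereal_inf [set s%:E | s in [set s : R | 0 <= s /\
                                (tau <= Phi_inf phi D s)%E]].

Definition A0 (R : realType) (n : nat) (Omega : set 'rV[R]_n)
    (phi : 'rV[R]_n -> R -> R) : Prop :=
  exists2 beta : R, 0 < beta < 1 &
    (Phi_sup phi Omega beta <= 1)%E /\ (1 <= Phi_inf phi Omega beta^-1)%E.

Definition A1 (R : realType) (n : nat) (Omega : set 'rV[R]_n)
    (phi : 'rV[R]_n -> R -> R) : Prop :=
  exists2 beta : R, 0 < beta < 1 &
    forall (c : 'rV[R]_n) (r : R), 0 < r ->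
      let B := eball c r in
      let t := Phi_inf_inv phi (B `&` Omega) (leb R n B)^-1%E in
      (1 <= t)%E ->
      forall s : R, 1 <= s -> (s%:E <= t)%E ->
        (Phi_sup phi (B `&` Omega) (beta * s) <=
         Phi_inf phi (B `&` Omega) s)%E.

Definition aInc (R : realType) (n : nat) (Omega : set 'rV[R]_n)
    (phi : 'rV[R]_n -> R -> R) (p : R) : Prop :=
  exists2 L : R, 1 <= L &
    {ae leb R n, forall x, Omega x ->
      almost_increasing L (fun s => phi x s / s `^ p)}.

Definition aDec (R : realType) (n : nat) (Omega : set 'rV[R]_n)
    (phi : 'rV[R]_n -> R -> R) (q : R) : Prop :=
  exists2 L : R, 1 <= L &
    {ae leb R n, forall x, Omega x ->
      almost_decreasing L (fun s => phi x s / s `^ q)}.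

Record structure_conditions (R : realType) (n : nat) (Omega : set 'rV[R]_n)
    (phi : 'rV[R]_n -> R -> R) (c1 c2 : R)
    (A : 'rV[R]_n -> 'rV[R]_n -> 'rV[R]_n) : Prop := StructureConditions {
  A_measurable : forall (z : 'rV[R]_n) (i : 'I_n),
    leb_measurable_fun Omega (fun x => A x z ord0 i);
  A_continuous : {ae leb R n, forall x, Omega x -> continuous (A x)};
  A_growth : {ae leb R n, forall x, Omega x -> forall z : 'rV[R]_n, z != 0 ->
    enorm (A x z) <= c1 * (phi x (enorm z) / enorm z)};
  A_coercive : {ae leb R n, forall x, Omega x -> forall z : 'rV[R]_n, z != 0 ->
    c2 * phi x (enorm z) <= dotp (A x z) z};
  A_monotone : {ae leb R n, forall x, Omega x -> forall z1 z2 : 'rV[R]_n, z1 != z2 ->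
    0 < dotp (A x z1 - A x z2) (z1 - z2)} }.

Definition Lphi (R : realType) (n : nat) (phi : 'rV[R]_n -> R -> R)
    (U : set 'rV[R]_n) (w : 'rV[R]_n -> R) : Prop :=
  leb_measurable_fun U w /\
  (\int[leb R n]_(x in U) (phi x `|w x|)%:E < +oo)%E.

(* +oo when no l is admissible *)
Definition lux_norm (R : realType) (n : nat) (phi : 'rV[R]_n -> R -> R)
    (U : set 'rV[R]_n) (w : 'rV[R]_n -> R) : \bar R :=
  ereal_inf [set l%:E | l in [set l : R | 0 < l /\
    (\int[leb R n]_(x in U) (phi x (`|w x| / l)%R)%:E <= 1)%E]].

(* w is in W^{1,1}(U) with weak gradient Dw.  Sobolev functions are handled as
   pairs (w, Dw), Dw being determined by w almost everywhere. *)
Definition sobolev11 (R : realType) (n : nat) (U : set 'rV[R]_n)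
    (w : 'rV[R]_n -> R) (Dw : 'rV[R]_n -> 'rV[R]_n) : Prop :=
  [/\ (leb R n).-integrable U (EFin \o (w : leb_space R n -> R)),
      forall i : 'I_n, (leb R n).-integrable U
        (fun x : leb_space R n => (Dw x ord0 i)%:E) &
      forall psi, test_fun U psi -> forall i : 'I_n,
        (\int[leb R n]_(x in U) (w x * pderiv i psi x)%:E =
         - \int[leb R n]_(x in U) (Dw x ord0 i * psi x)%:E)%E].

Definition sobolev_phi (R : realType) (n : nat) (phi : 'rV[R]_n -> R -> R)
    (U : set 'rV[R]_n) (w : 'rV[R]_n -> R) (Dw : 'rV[R]_n -> 'rV[R]_n) : Prop :=
  [/\ sobolev11 U w Dw, Lphi phi U w & Lphi phi U (fun x => enorm (Dw x))].

Definition sobolev_phi_norm (R : realType) (n : nat)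
    (phi : 'rV[R]_n -> R -> R) (U : set 'rV[R]_n)
    (w : 'rV[R]_n -> R) (Dw : 'rV[R]_n -> 'rV[R]_n) : \bar R :=
  (lux_norm phi U w + lux_norm phi U (fun x => enorm (Dw x)))%E.

Definition sobolev_phi0 (R : realType) (n : nat) (phi : 'rV[R]_n -> R -> R)
    (U : set 'rV[R]_n) (w : 'rV[R]_n -> R) (Dw : 'rV[R]_n -> 'rV[R]_n) : Prop :=
  sobolev_phi phi U w Dw /\
  forall e : R, 0 < e -> exists2 psi, test_fun U psi &
    (sobolev_phi_norm phi U (fun x => w x - psi x)%R
       (fun x => Dw x - grad psi x)%R < e%:E)%E.

(* The integral is extended-real valued: an integral equal to 0 is never a
   default value for a non-integrable integrand. *)
Definition solves_on (R : realType) (n : nat) (phi : 'rV[R]_n -> R -> R)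
    (A : 'rV[R]_n -> 'rV[R]_n -> 'rV[R]_n) (U : set 'rV[R]_n)
    (Du : 'rV[R]_n -> 'rV[R]_n) : Prop :=
  forall w Dw, sobolev_phi0 phi U w Dw ->
    (\int[leb R n]_(x in U) (dotp (A x (Du x)) (Dw x))%:E = 0)%E.

Definition h_phi (R : realType) (n : nat) (phi : 'rV[R]_n -> R -> R)
    (c : 'rV[R]_n) (r : R) : \bar R :=
  (\int[leb R n]_(x in eball c r) (phi x r^-1)%:E)%E.

(* J may be finite: h_phi of a small ball need not be small. *)
Definition Hausdorff_phi_delta (R : realType) (n : nat) (Omega : set 'rV[R]_n)
    (phi : 'rV[R]_n -> R -> R) (E : set 'rV[R]_n) (delta : R) : \bar R :=
  ereal_inf [set m | exists (J : set nat) (c : nat -> 'rV[R]_n) (r : nat -> R),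
    [/\ forall j, J j -> 0 < r j <= delta /\ eball (c j) (r j) `<=` Omega,
        E `<=` \bigcup_(j in J) eball (c j) (r j) &
        m = (\esum_(j in J) h_phi phi (c j) (r j))%E]].

Definition Hausdorff_phi (R : realType) (n : nat) (Omega : set 'rV[R]_n)
    (phi : 'rV[R]_n -> R -> R) (E : set 'rV[R]_n) : \bar R :=
  lim (Hausdorff_phi_delta Omega phi E delta @[delta --> 0^'+]).

Definition relatively_closed (T : topologicalType) (Omega E : set T) : Prop :=
  exists2 F, closed F & E = Omega `&` F.

(* Main.v *)
Require Import Defs.
From mathcomp Require Import finmap.
From mathcomp Require Import all_boot all_order all_algebra.
From mathcomp Require Import all_classical all_reals all_analysis.
From mathcomp Require Import measurable_realfun.
From mathcomp Require Import ring lra.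
Import Order.TTheory GRing.Theory Num.Theory.
Import numFieldNormedType.Exports.
Local Open Scope classical_set_scope.
Local Open Scope ring_scope.
Set Implicit Arguments.
Unset Strict Implicit.
Unset Printing Implicit Defensive.

(** Why the set E is removable.  Test functions of Omega are dense in the
    Luxemburg norm and the flux A(x,Du) acts continuously on gradients, so it is
    enough to prove that the integral of A(x,Du) . grad psi vanishes for a smooth
    psi with compact support in Omega.  Cover the compact part of E met by the
    support of psi by finitely many balls B_j of radius r_j <= delta whose
    contents h_phi(B_j) have a sum at most M, where M is independent of delta.
    Let eta be a smooth cutoff equal to 1 on the balls B_j and to 0 off the
    balls 2B_j.  Then psi (1 - eta) is a test function of Omega \ E, and what is
    left of the integral is
      int eta A(x,Du) . grad psi + int psi A(x,Du) . grad eta.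
    Both integrals live on the union X of the balls 2B_j.

    Growth and Young's inequality bound |A(x,Du)| |grad eta| by
    eps phi(x,|grad eta|) + K_eps phi(x,|Du|); Young's inequality in this form is
    (aInc)_p with p > 1 (Phi_at_young, growth_young).  The first term has integral
    at most eps times a constant times M: the gradient of eta is at most C/r_j on
    one of the balls 2B_j, and the integral of phi(x,1/r_j) over 2B_j is
    controlled by the content of B_j (h_phi_double).  That doubling property is
    where (A1) and q <= n enter.  The second term tends to 0 with delta, by
    absolute continuity, because phi(x,1/r) is at least a constant times 1/r and
    therefore |X| is at most a constant times delta M (leb_ball_le_h_phi).  Let
    delta tend to 0, then eps.

    Two points need care.  The balls may overlap without any bound, so eta must
    have a gradient bounded by the largest of the gradients of the individual
    bumps, not by their sum, and must be smooth: it is a smooth step applied to a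
    logarithm of a sum of exponentials of bumps (cutoff_balls).  And psi (1 - eta)
    has to be a Sobolev function in the sense of weak derivatives, which is
    integration by parts (test_fun_parts); for Lebesgue measure defined by box
    coverings it follows from translation invariance, since the integral of a
    difference quotient is zero (integral_pderiv_eq0). *)

(** * Boxes, affine maps and measurability of open sets *)

Lemma lebesgue_outer_le_box_vol (R : realType) (n : nat) (a b : 'rV[R]_n)
    (X : set 'rV[R]_n) :
  (forall i, a ord0 i <= b ord0 i) -> X `<=` obox a b ->
  (lebesgue_outer X <= box_vol a b)%E.
Proof.
move=> ab Xab; apply: ereal_inf_lbound; exists [set 0%N], (fun=> a), (fun=> b).
split; first by split=> // x /Xab ?; exists 0%N.
by rewrite esum_set1// box_vol_ge0.
Qed.

(** An affine map with scalar linear part maps box covers to box covers. *)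
Lemma lebesgue_outer_affine (R : realType) (n : nat) (t : R) (c : 'rV[R]_n)
    (X : set 'rV[R]_n) : 0 < t ->
  (lebesgue_outer [set (c + t *: x)%R | x in X] <= (t ^+ n)%:E * lebesgue_outer X)%E.
Proof.
move=> t0; have tn0 : 0 < t ^+ n by rewrite exprn_gt0.
rewrite -lee_pdivrMl//; apply: le_ereal_inf_tmp => _ [J [a [b [[ab Xab] ->]]]].
rewrite lee_pdivrMl//.
apply: (@le_trans _ _ (\esum_(k in J)
    box_vol (c + t *: a k)%R (c + t *: b k)%R)%E).
  apply: ereal_inf_lbound; exists J, (fun k => c + t *: a k),
    (fun k => c + t *: b k); split => //; split.
    by move=> k Jk i; rewrite !mxE lerD2l ler_pM2l// ab.
  move=> _ [x /Xab[k Jk xk] <-]; exists k => // i.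
  by have := xk i; rewrite !mxE !ltrD2l !ltr_pM2l.
apply: ge_ereal_sup => _ [F [finF FJ] <-].
rewrite (eq_fsbigr (fun k => ((t ^+ n)%:E * box_vol (a k) (b k)))%E); last first.
  move=> k _; rewrite /box_vol -EFinM; congr EFin.
  rewrite -[X in t ^+ X]card_ord -prodr_const -big_split/=.
  by apply: eq_bigr => i _; rewrite !mxE; ring.
rewrite fsbig_finite//= big_seq_cond -ge0_sume_distrr; last first.
  move=> k /andP[+ _]; rewrite in_fset_set// inE => Fk.
  by apply: box_vol_ge0; exact/ab/FJ.
rewrite -big_seq_cond lee_wpmul2l ?lee_fin ?(ltW tn0)//.
by apply: ereal_sup_ubound; exists F => //=; rewrite fsbig_finite.
Qed.

Lemma leb_translation (R : realType) (n : nat) (c : 'rV[R]_n)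
    (X : set 'rV[R]_n) :
  lebesgue_outer [set c + x | x in X] = lebesgue_outer X.
Proof.
have le (d : 'rV[R]_n) (Y : set 'rV[R]_n) : (lebesgue_outer [set (d + x)%R | x in Y] <= lebesgue_outer Y)%E.
  have := lebesgue_outer_affine d Y (@ltr01 R).
  rewrite expr1n mul1e; congr (lebesgue_outer _ <= _)%E.
  by apply: eq_imagel => x _; rewrite scale1r.
apply/eqP; rewrite eq_le le/= -[X in (lebesgue_outer X <= _)%E](_ :
  [set (- c + x)%R | x in [set (c + x)%R | x in X]] = X) ?le//.
rewrite image_comp/= -[RHS]image_id; apply: eq_imagel => x _ /=.
by rewrite addrA addNr add0r.
Qed.

(** The part of the hyperplane in a cube lies in arbitrarily thin boxes. *)
Lemma hyperplane_null (R : realType) (n : nat) (i : 'I_n) (c : R) :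
  lebesgue_outer [set x : 'rV[R]_n | x ord0 i = c] = 0%E.
Proof.
set H := [set _ | _].
pose Hk k := H `&` obox (const_mx (- k%:R)) (const_mx k%:R).
have -> : H = \bigcup_k Hk k.
  apply/seteqP; split=> [x Hx|x [k _ []//]].
  exists (Num.truncn (\sum_j `|x ord0 j|)).+1 => //; split=> // j.
  rewrite !mxE -ltr_norml; apply: le_lt_trans (truncnS_gt _).
  by rewrite (bigD1 j)//= lerDl sumr_ge0.
apply/eqP; rewrite eq_le lebesgue_outer_ge0 andbT.
apply: (le_trans (lebesgue_outer_sigma_subadditive Hk)).
rewrite eseries0// => k _ _; apply/eqP; rewrite eq_le lebesgue_outer_ge0 andbT.
apply/lee_addgt0Pr => e e0; rewrite add0e.
pose v := (k%:R *+ 2 : R) ^+ n.-1.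
have v0 : 0 <= v by rewrite exprn_ge0// mulrn_wge0.
pose d := e / (2 * (v + 1)).
have d0 : 0 < d by rewrite divr_gt0// mulr_gt0// ltr_wpDl.
pose a : 'rV[R]_n := \row_j if j == i then c - d else - k%:R.
pose b : 'rV[R]_n := \row_j if j == i then c + d else k%:R.
apply: (@le_trans _ _ (box_vol a b)).
  apply: lebesgue_outer_le_box_vol => [j|x [Hx xk] j]; rewrite !mxE.
    case: ifP => _; first lra.
    by rewrite (@le_trans _ _ 0)// oppr_le0.
  case: eqP => [->|_]; first by rewrite Hx; apply/andP; split; lra.
  by have := xk j; rewrite !mxE.
rewrite lee_fin (bigD1 i)//= !mxE eqxx.
rewrite (eq_bigr (fun=> k%:R *+ 2)); last first.
  by move=> j /negPf ji; rewrite !mxE ji opprK mulr2n.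
rewrite prodr_const cardC1 card_ord -/v.
have -> : c + d - (c - d) = 2 * d by ring.
have v1 : 0 < v + 1 by rewrite ltr_wpDl.
have -> : 2 * d * v = e * (v / (v + 1)) by rewrite /d; field; rewrite gt_eqF.
by rewrite ler_piMr// ?(ltW e0)// ler_pdivrMr// mul1r lerDl.
Qed.

(** A hyperplane cuts each box of a cover into two boxes whose volumes add up
    to its volume.  Only the open sides are covered this way; the hyperplane
    itself is a null set. *)
Lemma halfspace_measurable (R : realType) (n : nat) (i : 'I_n) (c : R) :
  measurable ([set x | x ord0 i < c] : set (leb_space R n)).
Proof.
pose H := [set x : 'rV[R]_n | x ord0 i < c].
suff: forall X, (lebesgue_outer (X `&` H) + lebesgue_outer (X `&` ~` H) <=
    lebesgue_outer X)%E by exact: le_caratheodory_measurable.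
move=> X.
pose K := [set x : 'rV[R]_n | c < x ord0 i].
have XK : (lebesgue_outer (X `&` ~` H) <= lebesgue_outer (X `&` K))%E.
  apply: (@le_trans _ _ (lebesgue_outer ([set x : 'rV[R]_n | x ord0 i = c] `|` (X `&` K)))).
    apply: le_lebesgue_outer => x [Xx /negP]; rewrite -leNgt le_eqVlt.
    by move=> /orP[/eqP|] ?; [left|right].
  apply: (le_trans (outer_measureU2 _ _ _)).
  by rewrite [X in (X + _ <= _)%E]hyperplane_null add0e.
apply: (le_trans (leeD2l _ XK)).
apply: le_ereal_inf_tmp => _ [J [a [b [[ab Xab] ->]]]].
pose m k := Num.max (a k ord0 i) (Num.min c (b k ord0 i)).
pose b' k : 'rV[R]_n := \row_j if j == i then m k else b k ord0 j.
pose a' k : 'rV[R]_n := \row_j if j == i then m k else a k ord0 j.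
have am k : J k -> a k ord0 i <= m k by move=> _; rewrite le_max lexx.
have mb k : J k -> m k <= b k ord0 i.
  by move=> Jk; rewrite ge_max ab//= ge_min lexx orbT.
have ab' k : J k -> forall j, a k ord0 j <= b' k ord0 j.
  by move=> Jk j; rewrite mxE; case: eqP => [->|_]; [exact: am|exact: ab].
have a'b k : J k -> forall j, a' k ord0 j <= b k ord0 j.
  by move=> Jk j; rewrite mxE; case: eqP => [->|_]; [exact: mb|exact: ab].
apply: (@le_trans _ _ (\esum_(k in J) box_vol (a k) (b' k) +
                       \esum_(k in J) box_vol (a' k) (b k))%E); last first.
  rewrite -esumD; [|by move=> k Jk; exact/box_vol_ge0/ab'
                   |by move=> k Jk; exact/box_vol_ge0/a'b].
  apply: le_esum => k Jk; rewrite /box_vol -EFinD lee_fin.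
  rewrite (bigD1 i)//= [X in _ + X](bigD1 i)//= [leRHS](bigD1 i)//= !mxE eqxx.
  rewrite (eq_bigr (fun j => b k ord0 j - a k ord0 j)); last first.
    by move=> j /negPf ji; rewrite !mxE ji.
  rewrite [X in _ + _ * X](eq_bigr (fun j => b k ord0 j - a k ord0 j)); last first.
    by move=> j /negPf ji; rewrite !mxE ji.
  by rewrite -mulrDl le_eqVlt (_ : m k - _ + (_ - m k) = b k ord0 i - a k ord0 i) ?eqxx//; ring.
apply: leeD; apply: ereal_inf_lbound.
- exists J, a, b'; split => //; split => // x [/Xab[k Jk xk] Hx]; exists k => // j.
  have /andP[ax xb] := xk j; rewrite mxE ax/=; case: eqP => [ji|//].
  by rewrite lt_max lt_min -ji; move: Hx xb; rewrite /H/= -ji => -> ->; rewrite orbT.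
- exists J, a', b; split => //; split => // x [/Xab[k Jk xk] Kx]; exists k => // j.
  have /andP[ax xb] := xk j; rewrite mxE xb andbT; case: eqP => [ji|//].
  rewrite gt_max -ji ax/= gt_min; move: Kx; rewrite /K/= -ji => ->//.
Qed.

Lemma halfspace_gt_measurable (R : realType) (n : nat) (i : 'I_n) (c : R) :
  measurable ([set x | c < x ord0 i] : set (leb_space R n)).
Proof.
rewrite [X in measurable X](_ : _ =
  ~` \bigcap_k [set x : 'rV[R]_n | x ord0 i < c + k.+1%:R^-1]); last first.
  apply/seteqP; split=> [x|x].
    move=> cx /(_ (Num.truncn (x ord0 i - c)^-1) I) /=.
    rewrite -ltrBlDl; apply/negP; rewrite -leNgt.
    rewrite invf_ple ?posrE ?subr_gt0//; exact: ltW (truncnS_gt _).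
  apply: contra_notT; rewrite -leNgt => xa k _ /=.
  by rewrite (le_lt_trans xa)// ltrDl invr_gt0.
apply: measurableC; apply: bigcap_measurableType => k _.
exact: halfspace_measurable.
Qed.

Lemma obox_measurable (R : realType) (n : nat) (a b : 'rV[R]_n) :
  measurable (obox a b : set (leb_space R n)).
Proof.
rewrite [X in measurable X](_ : _ = \bigcap_(i in [set: 'I_n])
    ([set x : 'rV[R]_n | x ord0 i < b ord0 i] `&`
     [set x : 'rV[R]_n | a ord0 i < x ord0 i])); last first.
  apply/seteqP; split=> [x xab i _/=|x xab i].
    by have /andP[? ?] := xab i.
  by have [/= -> ->] := xab i I.
apply: fin_bigcap_measurable => // i _; apply: measurableI.
  exact: halfspace_measurable.
exact: halfspace_gt_measurable.
Qed.

(** Every open set is a countable union of boxes with rational vertices. *)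
Lemma open_leb_measurable (R : realType) (n : nat) (U : set 'rV[R]_n) :
  open U -> measurable (U : set (leb_space R n)).
Proof.
move=> oU.
pose q (v : 'rV[rat]_n) : 'rV[R]_n := map_mx ratr v.
pose I := [set v : 'rV[rat]_n * 'rV[rat]_n | obox (q v.1) (q v.2) `<=` U].
rewrite [X in measurable X](_ : _ = \bigcup_(v in I) obox (q v.1) (q v.2)); last first.
  apply/seteqP; split=> [x Ux|x [v Iv]]; last exact: Iv.
  have /nbhs_ballP[e /= e0 xeU] : nbhs x U by exact: open_nbhs_nbhs.
  have lo i : exists r : rat, x ord0 i - e < ratr r < x ord0 i.
    by have [|r] := @rat_in_itvoo R (x ord0 i - e) (x ord0 i);
      [rewrite ltrBlDr ltrDl|rewrite in_itv/=; exists r].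
  have hi i : exists r : rat, x ord0 i < ratr r < x ord0 i + e.
    by have [|r] := @rat_in_itvoo R (x ord0 i) (x ord0 i + e);
      [rewrite ltrDl|rewrite in_itv/=; exists r].
  have [l lP] := choice lo; have [h hP] := choice hi.
  exists (\row_i l i, \row_i h i) => [y /= yb|i]; last first.
    by rewrite !mxE; have /andP[_ ->] := lP i; have /andP[-> _] := hP i.
  apply: xeU; split => // j i; rewrite ord1.
  have := yb i; rewrite !mxE => /andP[? ?].
  have /andP[? ?] := lP i; have /andP[? ?] := hP i.
  by rewrite /ball/= ltr_norml; apply/andP; split; lra.
rewrite bigcup_mkcond; apply: countable_bigcupT_measurable => [|v].
  exact: countableP.
by case: ifP => _; [exact: obox_measurable|exact: measurable0].
Qed.

(** * Euclidean norm and balls *)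

Section euclid.
Variables (R : realType) (n : nat).
Implicit Types (x y z : 'rV[R]_n) (a t : R).

Lemma dotpC x y : dotp x y = dotp y x.
Proof. by apply: eq_bigr => i _; rewrite mulrC. Qed.

Lemma dotpDl x y z : dotp (x + y) z = dotp x z + dotp y z.
Proof. by rewrite -big_split; apply: eq_bigr => i _; rewrite !mxE mulrDl. Qed.

Lemma dotpZl a x y : dotp (a *: x) y = a * dotp x y.
Proof. by rewrite mulr_sumr; apply: eq_bigr => i _; rewrite !mxE mulrA. Qed.

Lemma dotpDr x y z : dotp z (x + y) = dotp z x + dotp z y.
Proof. by rewrite dotpC dotpDl !(dotpC z). Qed.

Lemma dotpZr a x y : dotp y (a *: x) = a * dotp y x.
Proof. by rewrite dotpC dotpZl dotpC. Qed.

Lemma dotpNr x y : dotp y (- x) = - dotp y x.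
Proof. by rewrite -scaleN1r dotpZr mulN1r. Qed.

Lemma dotp0r x : dotp x 0 = 0.
Proof. by rewrite -(scale0r 0) dotpZr mul0r. Qed.

Lemma dotpp_ge0 x : 0 <= dotp x x.
Proof. by apply: sumr_ge0 => i _; rewrite -expr2 sqr_ge0. Qed.

Lemma enorm_ge0 x : 0 <= enorm x.
Proof. exact: sqrtr_ge0. Qed.

Lemma sqr_enorm x : enorm x ^+ 2 = dotp x x.
Proof. by rewrite sqr_sqrtr// dotpp_ge0. Qed.

Lemma enorm0 : enorm (0 : 'rV[R]_n) = 0.
Proof. by rewrite /enorm dotp0r sqrtr0. Qed.

Lemma enormZ a x : enorm (a *: x) = `|a| * enorm x.
Proof.
by rewrite /enorm dotpZl dotpZr mulrA -expr2 sqrtrM ?sqr_ge0// sqrtr_sqr.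
Qed.

Lemma enormN x : enorm (- x) = enorm x.
Proof. by rewrite -scaleN1r enormZ normrN1 mul1r. Qed.

Lemma le_coord_enorm x i : `|x ord0 i| <= enorm x.
Proof.
rewrite -sqrtr_sqr ler_wsqrtr// /dotp (bigD1 i)//= -expr2 lerDl.
by apply: sumr_ge0 => j _; rewrite -expr2 sqr_ge0.
Qed.

Lemma enorm_eq0 x : enorm x = 0 -> x = 0.
Proof.
move=> x0; apply/rowP => i; rewrite mxE; apply/normr0_eq0/eqP.
by rewrite eq_le normr_ge0 andbT -x0 le_coord_enorm.
Qed.

Lemma enorm_gt0 x : x != 0 -> 0 < enorm x.
Proof.
by move=> x0; rewrite lt_neqAle enorm_ge0 andbT eq_sym; apply: contra_neq x0 => /enorm_eq0.
Qed.

(** Cauchy-Schwarz: expand the square of |y| x - |x| y. *)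
Lemma dotp_le_enorm x y : dotp x y <= enorm x * enorm y.
Proof.
have [->|/enorm_gt0 y0] := eqVneq y 0; first by rewrite dotp0r enorm0 mulr0.
have [->|/enorm_gt0 x0] := eqVneq x 0; first by rewrite dotpC dotp0r enorm0 mul0r.
have := dotpp_ge0 (enorm y *: x - enorm x *: y).
rewrite -(scaleN1r (enorm x *: y)) !(dotpDl, dotpDr, dotpZl, dotpZr).
rewrite -!sqr_enorm (dotpC y x).
set X := enorm x; set Y := enorm y => h.
rewrite -(ler_pM2l (mulr_gt0 x0 y0)) -/X -/Y; nra.
Qed.

Lemma norm_dotp_le x y : `|dotp x y| <= enorm x * enorm y.
Proof.
rewrite ler_norml dotp_le_enorm andbT lerNl -dotpNr -(enormN y).
exact: dotp_le_enorm.
Qed.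

Lemma enormD x y : enorm (x + y) <= enorm x + enorm y.
Proof.
rewrite -(@ler_pXn2r _ 2) ?nnegrE ?addr_ge0 ?enorm_ge0//.
rewrite sqr_enorm dotpDl !dotpDr sqrrD (dotpC y x) !sqr_enorm.
by have := dotp_le_enorm x y; lra.
Qed.

Lemma enorm_sum (I : Type) (s : seq I) (f : I -> 'rV[R]_n) :
  enorm (\sum_(i <- s) f i) <= \sum_(i <- s) enorm (f i).
Proof.
elim: s => [|i s IH]; first by rewrite !big_nil enorm0.
by rewrite !big_cons (le_trans (enormD _ _))// lerD2l.
Qed.

Lemma enorm_delta (i : 'I_n) : enorm (delta_mx ord0 i : 'rV[R]_n) = 1.
Proof.
rewrite /enorm /dotp (bigD1 i)//= !mxE !eqxx mulr1 big1 ?addr0 ?sqrtr1//.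
by move=> j /negPf ji; rewrite !mxE ji andbF mulr0.
Qed.

Lemma continuous_coord (i : 'I_n) : continuous (fun x : 'rV[R]_n => x ord0 i).
Proof. by move=> x; exact: coord_continuous. Qed.

Lemma continuous_addr (T : topologicalType) (f g : T -> R) :
  continuous f -> continuous g -> continuous (fun w => f w + g w).
Proof. by move=> cf cg w; apply: cvgD; [exact: cf|exact: cg]. Qed.

Lemma continuous_mulr (T : topologicalType) (f g : T -> R) :
  continuous f -> continuous g -> continuous (fun w => f w * g w).
Proof. by move=> cf cg w; apply: cvgM; [exact: cf|exact: cg]. Qed.

Lemma continuous_sumr (T : topologicalType) (I : Type) (s : seq I)
    (f : I -> T -> R) :
  (forall i, continuous (f i)) -> continuous (fun w => \sum_(i <- s) f i w).
Proof.
move=> cf; elim: s => [|i s IH].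
  by under eq_fun do rewrite big_nil; exact: cst_continuous.
by under eq_fun do rewrite big_cons; exact: continuous_addr.
Qed.

Lemma continuous_enorm : continuous (@enorm R n).
Proof.
move=> x; apply: (@continuous_comp _ _ _ (fun x => dotp x x) Num.sqrt).
  apply: (@continuous_sumr 'rV[R]_n) => i; apply: continuous_mulr;
  exact: continuous_coord.
exact: sqrt_continuous.
Qed.

Lemma open_eball (c : 'rV[R]_n) r : open (eball c r).
Proof.
rewrite (_ : eball c r = (fun x => enorm (x - c)) @^-1` [set y | y < r])//.
apply: open_comp; last exact: open_lt.
move=> x _; apply: (@continuous_comp _ _ _ (fun x => x - c) (@enorm R n)).
  by apply: (@continuousB _ _ _ id (cst c)) => //; exact: cst_continuous.
exact: continuous_enorm.
Qed.

Lemma eball_measurable (c : 'rV[R]_n) r :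
  measurable (eball c r : set (leb_space R n)).
Proof. exact/open_leb_measurable/open_eball. Qed.

Lemma leb_eball_le (c : 'rV[R]_n) r : 0 <= r ->
  (leb R n (eball c r) <= ((2 * r) ^+ n)%:E)%E.
Proof.
move=> r0; apply: (@le_trans _ _ (box_vol (c - const_mx r) (c + const_mx r))).
  apply: lebesgue_outer_le_box_vol => [i|x xr i]; rewrite !mxE; first lra.
  have := le_lt_trans (le_coord_enorm _ i) xr.
  by rewrite !mxE ltr_norml => /andP[? ?]; apply/andP; split; lra.
rewrite /box_vol lee_fin (eq_bigr (fun=> 2 * r)); last first.
  by move=> i _; rewrite !mxE; ring.
by rewrite prodr_const card_ord.
Qed.

(** The dilation inequality gives the doubling property without the value, or
    even the positivity, of the measure of a ball. *)
Lemma leb_eball_double (c : 'rV[R]_n) r :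
  (leb R n (eball c (2 * r)) <= (2 ^+ n)%:E * leb R n (eball c r))%E.
Proof.
apply: le_trans (@lebesgue_outer_affine R n 2 (- c) _ _) => //.
apply: le_lebesgue_outer => x /= xr; exists (2^-1 *: (x + c)); last first.
  by rewrite scalerA mulfV// scale1r addrC addrK.
rewrite /eball/= -(ltr_pM2l (_ : 0 < 2))// -[X in X * _](@ger0_norm _ 2)//.
rewrite -enormZ scalerBr scalerA mulfV// scale1r scaler_nat mulr2n opprD addrA.
by rewrite addrK.
Qed.

Lemma leb_bounded (X : set 'rV[R]_n) : bounded_set X -> (leb R n X < +oo)%E.
Proof.
move=> [M [_ /(_ (`|M| + 1))]] XM; set r := `|M| + 1 in XM.
have r0 : 0 <= r by rewrite addr_ge0.
apply: (@le_lt_trans _ _ (box_vol (- const_mx (r + 1)) (const_mx (r + 1)))); last exact: ltry.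
apply: lebesgue_outer_le_box_vol => [i|x Xx i]; rewrite !mxE; first lra.
have : `|x| <= r by apply: XM => //; rewrite /r (le_lt_trans (ler_norm M))// ltrDl.
rewrite /Num.norm/= mx_normrE => /bigmax_leP[_ /(_ (ord0, i) isT)/=].
by rewrite ler_norml => /andP[? ?]; apply/andP; split; lra.
Qed.

End euclid.

(** * Translation invariance and the integral of a partial derivative *)

Section leb_facts.
Variables (R : realType) (n : nat).
Local Notation V := 'rV[R]_n.
Local Notation mu := (leb R n).

(** A null set splits every set into a null part and the rest. *)
Lemma leb_null_measurable (X : set V) : mu X = 0%E ->
  measurable (X : set (leb_space R n)).
Proof.
move=> X0; suff: forall Y, (lebesgue_outer (Y `&` X) + lebesgue_outer (Y `&` ~` X) <=
    lebesgue_outer Y)%E by exact: le_caratheodory_measurable.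
move=> Y; have -> : lebesgue_outer (Y `&` X) = 0%E.
  apply/eqP; rewrite eq_le lebesgue_outer_ge0 andbT -X0.
  by apply: le_lebesgue_outer; exact: subIsetr.
by rewrite add0e; apply: le_lebesgue_outer; exact: subIsetl.
Qed.

Lemma ae_null_set (P : V -> Prop) : {ae mu, forall x, P x} ->
  exists2 N : set V, measurable (N : set (leb_space R n)) /\ mu N = 0%E &
    forall x, ~ N x -> P x.
Proof.
move=> [N [mN N0 NP]]; exists N => // x; apply: contra_notP => nP.
exact: NP.
Qed.

Lemma leb_measurable_continuous (U : set V) (f : V -> R) :
  measurable (U : set (leb_space R n)) -> continuous f -> leb_measurable_fun U f.
Proof.
move=> mU cf; rewrite /leb_measurable_fun.
apply: (measurability _ (RGenOpens.measurableE R)).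
move=> _ [_ [a [b ->] <-]]; apply: measurableI => //.
apply: open_leb_measurable; apply: open_comp; last exact: interval_open.
by move=> x _; exact: cf.
Qed.

(** Measurability is tested on arbitrary sets by outer measure, and a
    translation can be moved from the measurable set to the test set. *)
Lemma measurable_translation (c : V) :
  measurable_fun setT ((fun x => c + x) : leb_space R n -> leb_space R n).
Proof.
move=> _ Y mY; rewrite setTI.
suff: caratheodory_measurable (@lebesgue_outer R n) ((fun x => c + x) @^-1` Y) by [].
move=> X.
have mY' Z : lebesgue_outer Z =
  (lebesgue_outer (Z `&` Y) + lebesgue_outer (Z `&` ~` Y))%E by exact: mY.
pose P : set V := (fun x => c + x) @^-1` Y.
rewrite -(leb_translation c X) mY' -(leb_translation c (X `&` P)).
rewrite -(leb_translation c (X `&` ~` P)).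
congr (_ + _)%E; congr lebesgue_outer.
  apply/seteqP; split=> [_ [[x Xx <-] Yx]|_ [x [Xx Yx] <-]]; first by exists x.
  by split=> //; exists x.
apply/seteqP; split=> [_ [[x Xx <-] Yx]|_ [x [Xx Yx] <-]]; first by exists x.
by split=> //; exists x.
Qed.

Lemma preimage_translation (c : V) (Y : set V) :
  (fun x => c + x) @^-1` Y = [set - c + x | x in Y].
Proof.
apply/seteqP; split=> [x /= Yx|_ [x Yx <-]] /=.
  by exists (c + x) => //; rewrite addrA addNr add0r.
by rewrite addrA subrr add0r.
Qed.

Lemma integral_translation (c : V) (f : V -> R) :
  mu.-integrable setT (EFin \o (f : leb_space R n -> R)) ->
  mu.-integrable setT (fun x : leb_space R n => (f (c + x))%:E) /\
  (\int[mu]_x (f (c + x))%:E = \int[mu]_x (f x)%:E)%E.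
Proof.
move=> fi.
have mt := measurable_translation c.
have mf : measurable_fun setT (f : leb_space R n -> R).
  by apply/measurable_EFinP; exact: measurable_int fi.
have pm (A : set (leb_space R n)) : pushforward mu (fun x => c + x : leb_space R n) A = mu A.
  by rewrite /pushforward preimage_translation; exact: leb_translation.
have ii : mu.-integrable setT (fun x : leb_space R n => (f (c + x))%:E).
  apply/integrableP; split.
    by apply/measurable_EFinP; exact: measurableT_comp mf mt.
  move/integrableP : (fi) => [_]; apply: le_lt_trans.
  rewrite -[leRHS](@eq_measure_integral _ _ _ _ mu (pushforward mu (fun x => c + x : leb_space R n))).
    rewrite ge0_integral_pushforward//.
    by apply: measurableT_comp; [exact: abse_measurable|exact/measurable_EFinP].
  by move=> A _ _; exact: pm.
split => //.
rewrite -[RHS](@eq_measure_integral _ _ _ _ mu (pushforward mu (fun x => c + x : leb_space R n))).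
  by rewrite integral_pushforward//; exact/measurable_EFinP.
by move=> A _ _; exact: pm.
Qed.

(** Directional derivatives along a line are one-variable derivatives, to which
    the mean value theorem applies. *)
Lemma is_derive_line (f : V -> R) (x v : V) (s : R) :
  derivable (f : V -> R^o) (s *: v + x) v ->
  is_derive s (1 : R) (fun t : R => f (t *: v + x) : R^o) ('D_v (f : V -> R^o) (s *: v + x)).
Proof.
have e : (fun h : R => h^-1 *: ((fun t : R => f (t *: v + x) : R^o) (h *: 1 + s) -
    (fun t : R => f (t *: v + x) : R^o) s)) =
  (fun h : R => h^-1 *: ((f : V -> R^o) (h *: v + (s *: v + x)) - f (s *: v + x))).
  apply/funext => h; congr (_ *: (f _ - _)).
  by rewrite -[h *: 1]/(h * 1) mulr1 scalerDl addrA.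
move=> df; apply: DeriveDef.
  by rewrite /derivable e.
by rewrite /derive e.
Qed.

Lemma integrable_cst_eball (M r : R) : 0 <= M -> 0 <= r ->
  mu.-integrable setT (fun x : leb_space R n => (M * \1_(eball (0 : V) r) x)%:E).
Proof.
move=> M0 r0; set B : set V := eball 0 r.
have mB : measurable (B : set (leb_space R n)) by exact: eball_measurable.
apply/integrableP; split.
  by apply/measurable_EFinP; apply: measurable_funM => //; exact: measurable_indic.
under eq_integral => x _.
  rewrite /= ger0_norm ?mulr_ge0// EFinM; over.
rewrite ge0_integralZl_EFin//; last by apply/measurable_EFinP; exact: measurable_indic.
rewrite integral_indic// setIT lte_mul_pinfty// ?lee_fin//.
exact: le_lt_trans (leb_eball_le _ r0) (ltry _).
Qed.

Lemma integrable_bounded_support (f : V -> R) (M r : R) :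
  continuous f -> (forall x, `|f x| <= M) -> (forall x, r <= enorm x -> f x = 0) ->
  mu.-integrable setT (fun x : leb_space R n => (f x)%:E).
Proof.
move=> cf fM fr; pose r1 := Num.max 0 r.
have M0 : 0 <= M by exact: le_trans (normr_ge0 _) (fM 0).
have r10 : 0 <= r1 by rewrite le_max lexx.
apply: (le_integrable _ _ _ (integrable_cst_eball M0 r10)) => //.
  by apply/measurable_EFinP; exact: leb_measurable_continuous.
move=> x _; rewrite /= lee_fin [leRHS]ger0_norm ?mulr_ge0// indicE.
have [xB|] := boolP (x \in _); first by rewrite mulr1.
rewrite notin_setE /eball/= subr0 => /negP; rewrite -leNgt => rx.
by rewrite fr ?normr0 ?mulr_ge0// (le_trans _ rx)// le_max lexx orbT.
Qed.

(** The integral of a difference quotient vanishes by translation invariance,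
    and difference quotients converge boundedly to the partial derivative. *)
Lemma integral_pderiv_eq0 (i : 'I_n) (f : V -> R) (M r : R) :
  continuous f -> continuous (pderiv i f) ->
  (forall x, derivable (f : V -> R^o) x (delta_mx ord0 i)) ->
  (forall x, `|f x| <= M) -> (forall x, `|pderiv i f x| <= M) ->
  (forall x, r <= enorm x -> f x = 0) ->
  (\int[mu]_x (pderiv i f x)%:E = 0)%E.
Proof.
move=> cf cdf df fM dfM fr.
pose e : V := delta_mx ord0 i.
pose t k : R := k.+1%:R^-1.
have t0 k : 0 < t k by rewrite invr_gt0.
have t1 k : t k <= 1 by rewrite invf_le1// ler1n.
pose g k x := (t k)^-1 * (f (t k *: e + x) - f x).
pose r1 := Num.max 0 r + 1.
have r10 : 0 <= r1 by rewrite addr_ge0// le_max lexx.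
pose B : set V := eball 0 r1.
have mB : measurable (B : set (leb_space R n)) by exact: eball_measurable.
have M0 : 0 <= M by exact: le_trans (normr_ge0 _) (fM 0).
have mcont h : continuous h -> measurable_fun setT (h : leb_space R n -> R).
  by move=> ch; exact: leb_measurable_continuous.
have fi := integrable_bounded_support cf fM fr.
have cg k : continuous (g k).
  apply: continuous_mulr; first exact: cst_continuous.
  apply: (@continuous_addr R V (fun x => f (t k *: e + x)) (fun x => - f x)) => x.
    apply: (@continuous_comp _ _ _ (fun x => t k *: e + x) f); last exact: cf.
    by apply: (@continuousD _ _ _ (cst _) id) => //; exact: cst_continuous.
  by apply: (@continuousN _ _ _ f); exact: cf.
have gM k x : `|g k x| <= (M * \1_B x).
  have [xB|xB] := boolP (x \in B); last first.
    have xr1 : r1 <= enorm x.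
      move: xB; rewrite notin_setE /B/eball/= subr0 => /negP.
      by rewrite -leNgt.
    have xr : r <= enorm x.
      by rewrite (le_trans _ xr1)// /r1 ler_wpDr// le_max lexx orbT.
    rewrite /g !fr ?subrr ?mulr0 ?normr0 ?mulr_ge0//.
    have : enorm x <= enorm (t k *: e + x) + t k.
      rewrite -[X in enorm X <= _](addKr (t k *: e)) (le_trans (enormD _ _))//.
      by rewrite addrC lerD2l enormN enormZ enorm_delta mulr1 gtr0_norm.
    have : r <= Num.max 0 r by rewrite le_max lexx orbT.
    by have := t1 k; rewrite /r1 in xr1; lra.
  rewrite indicE xB mulr1.
  pose h s : R := f (s *: e + x).
  have dh s : is_derive s (1 : R) h (pderiv i f (s *: e + x)).
    by apply: is_derive_line; exact: df.
  have [s _] : exists2 s, s \in `]0, (t k)[%R &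
      h (t k) - h 0 = pderiv i f (s *: e + x) * (t k - 0).
    apply: (@MVT _ h (fun s => pderiv i f (s *: e + x))) => //.
    by apply: derivable_within_continuous => s _; have := dh s.
  rewrite /h scale0r add0r subr0 /g => ->.
  by rewrite mulrC mulfK ?gt_eqF.
have gcvg x : g k x @[k --> \oo] --> pderiv i f x.
  have tcvg : (forall k, t k != 0) /\ t k @[k --> \oo] --> (0 : R).
    by split=> [k|]; [rewrite gt_eqF|exact: cvg_harmonic].
  have := df x; rewrite /derivable => /cvgr_dnbhsP /(_ t tcvg).
  exact.
have int0 k : (\int[mu]_x (g k x)%:E = 0)%E.
  have [it et] := integral_translation (t k *: e) fi.
  under eq_integral do rewrite /g EFinM EFinB.
  rewrite integralZl//; last by apply: integrableB.
  by rewrite integralB// et subee ?mule0//; apply: integrable_fin_num.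
have mg k : measurable_fun setT (fun x : leb_space R n => (g k x)%:E).
  by apply/measurable_EFinP; exact: mcont.
have md : measurable_fun setT (fun x : leb_space R n => (pderiv i f x)%:E).
  by apply/measurable_EFinP; exact: mcont.
have cv : {ae mu, forall x : leb_space R n, setT x ->
    (g k x)%:E @[k --> \oo] --> (pderiv i f x)%:E}.
  by apply/aeW => x _; apply: cvg_EFin; [exact: nearW|exact: gcvg].
have dom : {ae mu, forall (x : leb_space R n) k, setT x ->
    (`|(g k x)%:E| <= (M * \1_B x)%:E)%E}.
  by apply/aeW => x k _; rewrite lee_fin.
have [_ _] := dominated_convergence measurableT mg md cv (integrable_cst_eball M0 r10) dom.
under eq_fun do rewrite int0.
by move=> /(cvg_lim (@ereal_hausdorff R)) <-; rewrite lim_cst.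
Qed.

End leb_facts.

(** * Smooth functions of one and several variables *)

Section smooth_calculus.
Variable R : realType.

(** Differentiability to order k in the directions e_i, on a set D.  Derivatives
    are asked to exist rather than computed, so that closure under products and
    composition on D needs no equality of functions off D. *)
Fixpoint Ck (V : normedModType R) (I : Type) (e : I -> V) (D : set V) (k : nat)
    (f : V -> R) : Prop :=
  (forall x, D x -> {for x, continuous f}) /\
  if k is k'.+1 then
    forall i, exists2 f' : V -> R,
      forall x, D x -> is_derive x (e i) (f : V -> R^o) (f' x) & Ck e D k' f'
  else True.

Section on_domain.
Variables (V : normedModType R) (I : Type) (e : I -> V) (D : set V).
Implicit Types f g : V -> R.

Lemma Ck_continuous k f x : Ck e D k f -> D x -> {for x, continuous f}.
Proof. by case: k => [|k] [+ _]; exact. Qed.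

Lemma CkS k f : Ck e D k.+1 f -> Ck e D k f.
Proof.
elim: k f => [|k IH] f [cf df]; split => // i.
by have [f' fd /IH] := df i; exists f'.
Qed.

Lemma Ck_cst k a : Ck e D k (cst a).
Proof.
elim: k a => [|k IH] a; first by split => // x _; exact: cst_continuous.
split => [x _|i]; first exact: cst_continuous.
by exists (cst 0) => // x _; exact: is_derive_cst.
Qed.

Lemma CkD k f g : Ck e D k f -> Ck e D k g -> Ck e D k (fun x => f x + g x).
Proof.
elim: k f g => [|k IH] f g [cf df] [cg dg].
  by split => // x Dx; apply: (@continuousD _ _ _ f g); [exact: cf|exact: cg].
split => [x Dx|i].
  by apply: (@continuousD _ _ _ f g); [exact: cf|exact: cg].
have [f' fd cf'] := df i; have [g' gd cg'] := dg i.
exists (fun x => f' x + g' x); last exact: IH.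
move=> x Dx; have fx := fd x Dx; have gx := gd x Dx.
exact: (@is_deriveD _ _ _ (f : V -> R^o) (g : V -> R^o)).
Qed.

Lemma CkM k f g : Ck e D k f -> Ck e D k g -> Ck e D k (fun x => f x * g x).
Proof.
elim: k f g => [|k IH] f g Cf Cg.
  by split => // x Dx; apply: (@continuousM _ _ f g);
    [exact: Ck_continuous Cf _|exact: Ck_continuous Cg _].
split => [x Dx|i].
  by apply: (@continuousM _ _ f g);
    [exact: Ck_continuous Cf _|exact: Ck_continuous Cg _].
have [f' fd cf'] := Cf.2 i; have [g' gd cg'] := Cg.2 i.
exists (fun x => f x * g' x + g x * f' x).
  move=> x Dx; have fx := fd x Dx; have gx := gd x Dx.
  exact: (@is_deriveM _ _ (f : V -> R^o) (g : V -> R^o)).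
by apply: CkD; apply: IH => //; exact: CkS.
Qed.

Lemma CkN k f : Ck e D k f -> Ck e D k (fun x => - f x).
Proof.
move=> Cf; rewrite (_ : (fun x => - f x) = (fun x => cst (-1) x * f x)); last first.
  by apply/funext => x; rewrite mulN1r.
by apply: CkM => //; exact: Ck_cst.
Qed.

Lemma Ck_sum k (J : Type) (s : seq J) (f : J -> V -> R) :
  (forall j, Ck e D k (f j)) -> Ck e D k (fun x => \sum_(j <- s) f j x).
Proof.
move=> Cf; elim: s => [|j s IH].
  by under eq_fun do rewrite big_nil; exact: Ck_cst.
by under eq_fun do rewrite big_cons; exact: CkD.
Qed.

End on_domain.

Lemma derivable_lineE (V : normedModType R) (f : V -> R) (x v : V) :
  (fun h : R => h^-1 *: ((fun t : R => f (t *: v + x) : R^o) (h *: 1 + 0) -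
    (fun t : R => f (t *: v + x) : R^o) 0)) =
  (fun h : R => h^-1 *: ((f : V -> R^o) (h *: v + x) - f x)).
Proof.
apply/funext => h; congr (_ *: (f _ - f _)).
  by rewrite -[h *: 1]/(h * 1) mulr1 addr0.
by rewrite scale0r add0r.
Qed.

(** The reduction to one variable in both directions; it transports the chain
    rule to functions on a normed space. *)
Lemma is_derive_lineP (V : normedModType R) (f : V -> R) (x v : V) (d : R) :
  is_derive x v (f : V -> R^o) d <->
  is_derive (0 : R) (1 : R) (fun t : R => f (t *: v + x) : R^o) d.
Proof.
have e := derivable_lineE f x v.
by split => -[df fd]; apply: DeriveDef;
  move: df fd; rewrite /derivable /derive e.
Qed.

Lemma is_derive_chain (V : normedModType R) (f : V -> R) (g : R -> R)
    (x v : V) (a b : R) :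
  is_derive (f x) (1 : R) (g : R -> R^o) a -> is_derive x v (f : V -> R^o) b ->
  is_derive x v (g \o f : V -> R^o) (a * b).
Proof.
move=> ga /is_derive_lineP fb; apply/is_derive_lineP.
apply: (@is_derive1_comp _ g (fun t : R => f (t *: v + x))) => //.
by rewrite scale0r add0r.
Qed.

Lemma Ck_comp (V : normedModType R) (I : Type) (e : I -> V) (D : set V)
    (k : nat) (g : R -> R) (E : set R) (f : V -> R) :
  Ck (fun _ : unit => 1 : R) E k g -> Ck e D k f -> (forall x, D x -> E (f x)) ->
  Ck e D k (g \o f).
Proof.
move=> + + DE; elim: k g f DE => [|k IH] g f DE Cg Cf.
  split => // x Dx; apply: (@continuous_comp _ _ _ f g).
    exact: Ck_continuous Cf Dx.
  exact: Ck_continuous Cg (DE _ Dx).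
split => [x Dx|i].
  apply: (@continuous_comp _ _ _ f g); first exact: Ck_continuous Cf Dx.
  exact: Ck_continuous Cg (DE _ Dx).
have [g' gd Cg'] := Cg.2 tt; have [f' fd Cf'] := Cf.2 i.
exists (fun x => (g' \o f) x * f' x) => [x Dx|].
  by apply: is_derive_chain; [exact/gd/DE|exact: fd].
by apply: CkM => //; apply: IH => //; exact: CkS.
Qed.

Notation Ck1 := (Ck (fun _ : unit => 1 : R)).

Lemma derive1_continuous (g : R -> R) x a :
  is_derive x (1 : R) (g : R -> R^o) a -> {for x, continuous g}.
Proof.
by move=> gx; apply: differentiable_continuous; apply/derivable1_diffP.
Qed.

Lemma Ck1_of_derive k (D : set R) (g g' : R -> R) :
  (forall x, D x -> is_derive x (1 : R) (g : R -> R^o) (g' x)) ->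
  Ck1 D k g' -> Ck1 D k.+1 g.
Proof.
move=> gd Cg'; split; last by move=> _; exists g'.
by move=> x Dx; exact: derive1_continuous (gd x Dx).
Qed.

Lemma Ck1_id k : Ck1 setT k id.
Proof.
elim: k => [|k _]; first by split => // x _; exact: cvg_id.
by apply: (@Ck1_of_derive _ _ _ (cst 1)); exact: Ck_cst.
Qed.

Lemma Ck1_expR k : Ck1 setT k (@expR R).
Proof.
elim: k => [|k IH]; first by split => // x _; exact: continuous_expR.
by apply: (@Ck1_of_derive _ _ _ expR) => // x _; exact: is_derive_expR.
Qed.

Lemma is_derive1_inv (x : R) : x != 0 ->
  is_derive x (1 : R) (GRing.inv : R -> R^o) (- (x^-1 * x^-1)).
Proof.
move=> x0; have := @is_deriveV _ id x 1 1 x0 (is_derive_id _ _).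
by rewrite /GRing.scale/= mulr1 expr2 invfM.
Qed.

Lemma Ck1_inv k : Ck1 [set x | 0 < x] k GRing.inv.
Proof.
have d (x : R) : 0 < x -> is_derive x (1 : R) (GRing.inv : R -> R^o) (- (x^-1 * x^-1)).
  by move=> x0; apply: is_derive1_inv; rewrite gt_eqF.
elim: k => [|k IH]; first by split => // x x0; exact: derive1_continuous (d _ x0).
by apply: Ck1_of_derive d _; apply: CkN; exact: CkM.
Qed.

Lemma Ck1_ln k : Ck1 [set x | 0 < x] k (@ln R).
Proof.
case: k => [|k]; last by apply: Ck1_of_derive (Ck1_inv k) => x; exact: is_derive1_ln.
by split => // x x0; exact: continuous_ln.
Qed.

(** The classical flat function exp(-1/x), together with its multiples by
    powers of 1/x: this family is stable under differentiation up to linear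
    combinations. *)
Definition flat (j : nat) (x : R) : R :=
  if 0 < x then x^-1 ^+ j * expR (- x^-1) else 0.

Lemma flat_le0 j x : x <= 0 -> flat j x = 0.
Proof. by rewrite /flat leNgt => /negPf ->. Qed.

Lemma flat_gt0 j x : 0 < x -> 0 < flat j x.
Proof. by move=> x0; rewrite /flat x0 mulr_gt0 ?expR_gt0// exprn_gt0// invr_gt0. Qed.

Lemma flat_ge0 j x : 0 <= flat j x.
Proof. by have [/flat_le0->//|/flat_gt0/ltW] := leP x 0. Qed.

(** From the exponential series: y^(j+1) is at most (j+1)! exp(y), at y = 1/x. *)
Lemma flat_le j x : flat j x <= j.+1`!%:R * `|x|.
Proof.
have [x0|x0] := leP x 0; first by rewrite flat_le0// mulr_ge0.
rewrite /flat x0 gtr0_norm// expRN ler_pdivrMr ?expR_gt0//.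
have := expR_ge1Dxn j (ltW (_ : 0 < x^-1)); rewrite invr_gt0 => /(_ x0) h.
have : x^-1 ^+ j.+1 / j.+1`!%:R <= expR x^-1 by apply: le_trans h; rewrite lerDr.
rewrite ler_pdivrMr ?ltr0n ?fact_gt0// exprS mulrC ler_pdivrMr// => h'.
by apply: (le_trans h'); rewrite le_eqVlt; apply/orP; left; apply/eqP; ring.
Qed.

(** At 0 the difference quotient of one member of the family is the next member,
    which tends to 0. *)
Lemma is_derive_flat j x :
  is_derive x (1 : R) (flat j : R -> R^o) (flat j.+2 x - j%:R * flat j.+1 x).
Proof.
have [x0|x0|->] := ltgtP x 0.
- rewrite !flat_le0 ?ltW// mulr0 subrr.
  apply: (@near_eq_is_derive _ _ _ (cst 0)).
  near=> y; rewrite flat_le0//; apply/ltW; near: y; exact: lt_nbhsl.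
- have d1 : is_derive x (1 : R) (GRing.inv : R -> R^o) (- (x^-1 * x^-1)).
    by apply: is_derive1_inv; rewrite gt_eqF.
  have d2 : is_derive x (1 : R) ((fun y => y^-1 ^+ j) : R -> R^o)
      (j%:R * x^-1 ^+ j.-1 * - (x^-1 * x^-1)).
    apply: (@is_derive_chain R GRing.inv (fun y => y ^+ j)) => //.
    apply: DeriveDef; first exact: exprn_derivable.
    by rewrite exp_derive /GRing.scale/= mulr1.
  have d3 : is_derive x (1 : R) ((fun y => expR (- y^-1)) : R -> R^o)
      (expR (- x^-1) * (x^-1 * x^-1)).
    have d : is_derive x (1 : R) ((fun y => - y^-1) : R -> R^o) (x^-1 * x^-1).
      by rewrite -[x^-1 * _]opprK; exact: is_deriveN d1.
    by apply: (@is_derive_chain R (fun y => - y^-1) expR) => //; exact: is_derive_expR.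
  have d4 : is_derive x (1 : R) ((fun y => y^-1 ^+ j * expR (- y^-1)) : R -> R^o)
      (flat j.+2 x - j%:R * flat j.+1 x).
    apply: (@is_derive_eq _ _ _ _ _ _ _ _ (is_deriveM d2 d3)).
    rewrite /flat x0 /GRing.scale/=.
    by case: (j) => [|k]; rewrite -?pred_Sn !exprS ?expr0; ring.
  apply: near_eq_is_derive d4.
  near=> y; rewrite /flat ifT//; near: y; exact: lt_nbhsr.
- rewrite (flat_le0 j.+2)// (flat_le0 j.+1)// mulr0 subrr.
  have lim0 : h^-1 *: ((flat j : R -> R^o) (h *: (1 : R) + 0) - flat j 0) @[h --> (0 : R)^'] -->
      (0 : R^o).
    apply/cvgr0Pnorm_le => e e0; near=> h.
    have h0 : h != 0 by near: h; exact: nbhs_dnbhs_neq.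
    have -> : h^-1 *: ((flat j : R -> R^o) (h *: (1 : R) + 0) - flat j 0) = flat j.+1 h.
      rewrite (flat_le0 j (lexx 0)) subr0 addr0 -[h *: 1]/(h * 1) mulr1 -[_ *: _]/(_ * _).
      rewrite /flat; case: ifP => _; last by rewrite mulr0.
      by rewrite exprS mulrA.
    rewrite ger0_norm ?flat_ge0// (le_trans (flat_le _ _))//.
    rewrite mulrC -ler_pdivlMr ?ltr0n ?fact_gt0//.
    near: h; apply: dnbhs0_le; rewrite divr_gt0// ltr0n fact_gt0//.
  apply: DeriveDef.
    by rewrite /derivable; apply/cvg_ex; exists 0; exact: lim0.
  by rewrite /derive; apply: cvg_lim.
Unshelve. all: by end_near. Qed.

Lemma Ck1_flat k j : Ck1 setT k (flat j).
Proof.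
elim: k j => [|k IH] j.
  by split => // x _; exact: derive1_continuous (is_derive_flat j x).
apply: Ck1_of_derive => [x _|]; first exact: is_derive_flat.
apply: CkD; first exact: IH.
by apply: CkN; apply: CkM; [exact: Ck_cst|exact: IH].
Qed.

(** The numerator vanishes to the left of 1/4, the second term of the denominator
    to the right of 3/4. *)
Definition step (x : R) : R :=
  flat 0 (x - 4^-1) / (flat 0 (x - 4^-1) + flat 0 (3 / 4 - x)).

(** At every point one of the two arguments is positive. *)
Lemma step_den_gt0 x : 0 < flat 0 (x - 4^-1) + flat 0 (3 / 4 - x).
Proof.
have [x1|x1] := leP x 4^-1.
  by rewrite ltr_wpDl ?flat_ge0// flat_gt0//; lra.
by rewrite ltr_wpDr ?flat_ge0// flat_gt0//; lra.
Qed.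

Lemma step0 x : x <= 4^-1 -> step x = 0.
Proof. by move=> x1; rewrite /step flat_le0 ?mul0r//; lra. Qed.

Lemma step1 x : 3 / 4 <= x -> step x = 1.
Proof.
move=> x1; rewrite /step (flat_le0 0 (_ : 3 / 4 - x <= 0)) ?addr0; last lra.
by rewrite divff// gt_eqF// flat_gt0//; lra.
Qed.

Lemma step_ge0 x : 0 <= step x.
Proof. by rewrite divr_ge0 ?flat_ge0// ltW// step_den_gt0. Qed.

Lemma step_le1 x : step x <= 1.
Proof. by rewrite ler_pdivrMr ?step_den_gt0// mul1r lerDl flat_ge0. Qed.

Lemma Ck1_step k : Ck1 setT k step.
Proof.
have C1 : Ck1 setT k (fun x => flat 0 (x - 4^-1)).
  apply: (@Ck_comp R^o unit (fun=> 1) setT k (flat 0) setT (fun x : R => x - 4^-1)) => //.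
    exact: Ck1_flat.
  by apply: CkD; [exact: Ck1_id|exact: Ck_cst].
have C2 : Ck1 setT k (fun x => flat 0 (3 / 4 - x)).
  apply: (@Ck_comp R^o unit (fun=> 1) setT k (flat 0) setT (fun x : R => 3 / 4 - x)) => //.
    exact: Ck1_flat.
  by apply: CkD; [exact: Ck_cst|apply: CkN; exact: Ck1_id].
apply: CkM => //.
apply: (@Ck_comp R^o unit (fun=> 1) setT k GRing.inv [set x : R | 0 < x]
  (fun x : R => flat 0 (x - 4^-1) + flat 0 (3 / 4 - x))).
- exact: Ck1_inv.
- exact: CkD.
- by move=> x _ /=; exact: step_den_gt0.
Qed.

(** The step is constant off [0, 1], and its derivative is continuous. *)
Lemma step_derive_bounded : exists2 C : R, 1 <= C &
  exists step' : R -> R,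
    [/\ forall x, is_derive x (1 : R) (step : R -> R^o) (step' x),
        forall x, `|step' x| <= C & forall x, x < 4^-1 -> step' x = 0].
Proof.
have [s' sd Cs] := (Ck1_step 1).2 tt.
have sd' x : is_derive x (1 : R) (step : R -> R^o) (s' x) by exact: sd.
have cs : continuous (fun x => `|s' x|).
  move=> x; apply: (@continuous_comp _ _ _ s' Num.norm).
    exact: Cs.1 x I.
  exact: norm_continuous.
have [] := @EVT_max R (fun x => `|s' x|) 0 1 ler01.
  exact: continuous_subspaceT.
move=> c _ cmax; exists (`|s' c| + 1); first by rewrite lerDr.
have s'cst a x : (\near x, (cst a : R -> R^o) x = step x) -> s' x = 0.
  move=> ha; have := @near_eq_is_derive _ _ _ _ _ x 1 0 ha (is_derive_cst _ _ _).
  by move=> [_ e]; have [_ <-] := sd' x.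
have s'0 x : x < 4^-1 -> s' x = 0.
  move=> x0; apply: (s'cst 0); near=> y; rewrite step0//.
  by apply/ltW; near: y; exact: lt_nbhsl.
exists s'; split => // x; have [/andP[x0 x1]|] := boolP (0 <= x <= 1).
  by rewrite (le_trans (cmax x _)) ?lerDl// in_itv/= x0.
rewrite negb_and -!ltNge => /orP[x0|x1].
  by rewrite s'0 ?normr0 ?addr_ge0//; lra.
rewrite (s'cst 1) ?normr0 ?addr_ge0//; near=> y; rewrite step1//.
by apply/ltW; near: y; apply: lt_nbhsr; lra.
Unshelve. all: by end_near. Qed.

End smooth_calculus.

(** * Cutoff functions for finite families of balls *)

Section smooth_rV.
Variables (R : realType) (n : nat).
Local Notation V := 'rV[R]_n.
Local Notation CkV := (@Ck R V 'I_n (fun i => delta_mx ord0 i) setT).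

Lemma iter_pderiv_rcons (s : seq 'I_n) i (f : V -> R) :
  iter_pderiv (rcons s i) f = iter_pderiv s (pderiv i f).
Proof. by rewrite /iter_pderiv foldr_rcons. Qed.

Lemma smooth_pderiv i (f : V -> R) : smooth f -> smooth (pderiv i f).
Proof. by move=> sf s; rewrite -iter_pderiv_rcons; exact: sf. Qed.

Lemma smooth_Ck k (f : V -> R) : smooth f -> CkV k f.
Proof.
elim: k f => [|k IH] f sf; first by split => // x _; have [cf _] := sf [::]; exact: cf.
split => [x _|i]; first by have [cf _] := sf [::]; exact: cf.
exists (pderiv i f); last exact/IH/smooth_pderiv.
by move=> x _; have [_ /(_ i x) df] := sf [::]; exact: derivableP.
Qed.

(** The existential derivatives are the partial derivatives, so the recursion of
    Ck unfolds to the iterated partial derivatives, innermost first. *)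
Lemma Ck_smooth (f : V -> R) : (forall k, CkV k f) -> smooth f.
Proof.
move=> Cf s; elim/last_ind: s f Cf => [|s i IH] f Cf.
  split=> [x|i x]; first by have [cf _] := Cf 0%N; exact: cf.
  by have [f' fd _] := (Cf 1%N).2 i; have [] := fd x I.
rewrite iter_pderiv_rcons; apply: IH => k.
have [f' fd Cf'] := (Cf k.+1).2 i; rewrite (_ : pderiv i f = f')//.
by apply/funext => x; have [_] := fd x I.
Qed.

Lemma Ck_coord k i : CkV k (fun x : V => x ord0 i).
Proof.
case: k => [|k]; first by split => // x _; exact: coord_continuous.
split=> [x _|j]; first exact: coord_continuous.
exists (cst ((delta_mx ord0 j : V) ord0 i)); last exact: Ck_cst.
move=> x _; apply/is_derive_lineP.
rewrite (_ : (fun t : R => (t *: delta_mx ord0 j + x) ord0 i) =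
  (fun t : R => t * (delta_mx ord0 j : V) ord0 i + x ord0 i)); last first.
  by apply/funext => t; rewrite !mxE.
set a := (delta_mx _ _ : V) _ _; set b := x _ _.
have h1 := @is_deriveM _ _ id (cst a) (0 : R) 1 1 0 (is_derive_id _ _) (is_derive_cst _ _ _).
have h2 := @is_deriveD _ _ _ _ (cst b : R -> R^o) (0 : R) 1 _ 0 h1 (is_derive_cst _ _ _).
by apply: (@is_derive_eq _ _ _ _ _ _ _ _ h2); rewrite !addr0 scaler0 add0r /GRing.scale/= mulr1.
Qed.

(** Larger than 1 on the ball of radius r and negative off the ball of radius 2r,
    so that both constant parts of the step are reached. *)
Definition bump_arg (c : V) (r : R) (x : V) : R :=
  2 - r ^- 2 * dotp (x - c) (x - c).

Definition bump (c : V) (r : R) : V -> R := @step R \o bump_arg c r.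

Lemma Ck_bump_arg k c r : CkV k (bump_arg c r).
Proof.
apply: CkD; first exact: Ck_cst.
apply: CkN; apply: CkM; first exact: Ck_cst.
apply: Ck_sum => i.
rewrite (_ : (fun x => _) = (fun x : V => (x ord0 i - c ord0 i) * (x ord0 i - c ord0 i))).
  by apply: CkM; (apply: CkD; [exact: Ck_coord|exact: Ck_cst]).
by apply/funext => x; rewrite !mxE.
Qed.

Lemma Ck_bump k c r : CkV k (bump c r).
Proof.
by apply: (@Ck_comp _ _ _ _ _ _ _ setT) => //; [exact: Ck1_step|exact: Ck_bump_arg].
Qed.

Lemma bump1 c r x : 0 < r -> eball c r x -> bump c r x = 1.
Proof.
move=> r0 xr; rewrite /bump/= step1//.
have : r ^- 2 * dotp (x - c) (x - c) <= 1.
  rewrite mulrC ler_pdivrMr ?exprn_gt0// mul1r -sqr_enorm.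
  by rewrite ler_pXn2r ?nnegrE ?enorm_ge0// ltW.
by rewrite /bump_arg; lra.
Qed.

Lemma bump_arg_lt0 c r x : 0 < r -> ~ eball c (2 * r) x -> bump_arg c r x < 0.
Proof.
move=> r0 /negP; rewrite -leNgt => xr.
have : 4 <= r ^- 2 * dotp (x - c) (x - c).
  rewrite mulrC ler_pdivlMr ?exprn_gt0// -sqr_enorm.
  have -> : 4 * r ^+ 2 = (2 * r) ^+ 2 by ring.
  by rewrite ler_pXn2r ?nnegrE ?enorm_ge0// mulr_ge0// ltW.
by rewrite /bump_arg; lra.
Qed.

Lemma bump0 c r x : 0 < r -> ~ eball c (2 * r) x -> bump c r x = 0.
Proof. by move=> r0 /(bump_arg_lt0 r0) b0; rewrite /bump/= step0//; lra. Qed.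

Lemma is_derive_bump_arg c r x i :
  is_derive x (delta_mx ord0 i) (bump_arg c r : V -> R^o)
    (- (r ^- 2 * (2 * (x - c) ord0 i))).
Proof.
apply/is_derive_lineP.
pose p := dotp (x - c) (x - c); pose b := (x - c) ord0 i.
have -> : (fun t : R => bump_arg c r (t *: delta_mx ord0 i + x) : R^o) =
    (fun t => (2 - r ^- 2 * p) + t * (- (r ^- 2 * (2 * b)) - r ^- 2 * t)).
  apply/funext => t; rewrite /bump_arg -[_ + x - c]addrA /p /b.
  move: (x - c) => y; rewrite dotpDl !dotpDr !dotpZl !dotpZr.
  have dl z : dotp (delta_mx ord0 i) z = z ord0 i.
    rewrite /dotp (bigD1 i)//= !mxE !eqxx mul1r big1 ?addr0// => j /negPf ji.
    by rewrite !mxE ji andbF mul0r.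
  by rewrite (dotpC y (delta_mx _ _)) !dl mxE !eqxx/=; ring.
have d0 : is_derive (0 : R) (1 : R) (fun t : R => - (r ^- 2 * (2 * b)) - r ^- 2 * t : R^o) (- r ^- 2).
  have h := @is_deriveZ _ _ R^o id (r ^- 2) (0 : R) 1 1 (is_derive_id _ _).
  have := @is_deriveB _ _ R^o (cst (- (r ^- 2 * (2 * b)))) _ (0 : R) 1 0 _ (is_derive_cst _ _ _) h.
  by rewrite sub0r /GRing.scale/= mulr1.
have h1 := @is_deriveM _ _ id _ (0 : R) 1 1 _ (is_derive_id _ _) d0.
have h2 := @is_deriveD _ _ R^o (cst (2 - r ^- 2 * p)) _ (0 : R) 1 0 _ (is_derive_cst _ _ _) h1.
apply: (@is_derive_eq _ _ _ _ _ _ _ _ h2).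
by rewrite /GRing.scale/= /b; ring.
Qed.

Lemma gradE (f : V -> R) (x : V) (d : V) :
  (forall i, is_derive x (delta_mx ord0 i) (f : V -> R^o) (d ord0 i)) ->
  grad f x = d.
Proof.
by move=> fd; apply/rowP => i; rewrite mxE; have [_] := fd i.
Qed.

Lemma Ck_grad (f : V -> R) x i : CkV 1 f ->
  is_derive x (delta_mx ord0 i) (f : V -> R^o) (grad f x ord0 i).
Proof.
move=> Cf; have [f' fd _] := Cf.2 i; have [df e] := fd x I.
by apply: DeriveDef => //; rewrite mxE.
Qed.

(** The factor x - c in the gradient is at most 2r where the derivative of the
    step is not zero, which turns 1/r^2 into 1/r. *)
Lemma bump_grad : exists2 C : R, 1 <= C &
  forall c r x, 0 < r -> enorm (grad (bump c r) x) <= C / r /\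
    (~ eball c (2 * r) x -> grad (bump c r) x = 0).
Proof.
have [C C1 [s' [sd sC s0]]] := step_derive_bounded R.
exists (4 * C) => [|c r x r0]; first lra.
have gE : grad (bump c r) x = (s' (bump_arg c r x) * - (r ^- 2 * 2)) *: (x - c).
  apply: gradE => i; rewrite mxE -mulrA; apply: is_derive_chain => //.
  by rewrite mulNr -mulrA; exact: is_derive_bump_arg.
have out : ~ eball c (2 * r) x -> grad (bump c r) x = 0.
  by move=> /(bump_arg_lt0 r0) b0; rewrite gE s0 ?mul0r ?scale0r//; lra.
split => //; have [xr|/out ->] := pselect (eball c (2 * r) x); last first.
  by rewrite enorm0 divr_ge0// ?ltW//; lra.
rewrite gE enormZ normrM normrN (ger0_norm (_ : 0 <= r ^- 2 * 2)); last first.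
  by rewrite mulr_ge0// invr_ge0 exprn_ge0// ltW.
have -> : 4 * C / r = C * (r ^- 2 * 2) * (2 * r) by field; rewrite gt_eqF.
apply: ler_pM; rewrite ?mulr_ge0 ?invr_ge0 ?exprn_ge0 ?enorm_ge0 ?(ltW r0) ?(ltW xr)//.
by rewrite ler_wpM2r// mulr_ge0 ?invr_ge0 ?exprn_ge0// ltW.
Qed.

Lemma seq_argmax (I : eqType) (s : seq I) (G : I -> R) :
  s != [::] -> exists2 j, j \in s & forall k, k \in s -> G k <= G j.
Proof.
elim: s => [//|i s IH] _; have [->|/IH[j js jmax]] := eqVneq s [::].
  by exists i; rewrite ?inE// => k; rewrite inE => /eqP ->.
have [ij|ji] := leP (G i) (G j).
  by exists j; rewrite ?inE ?js ?orbT// => k; rewrite inE => /predU1P[->|/jmax].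
exists i; rewrite ?inE ?eqxx// => k; rewrite inE => /predU1P[->//|/jmax kj].
exact: le_trans kj (ltW ji).
Qed.

(** A smooth maximum of finitely many bumps.  The gradient of
    ln (sum of exponentials) is a subconvex combination of the gradients of the
    summands, so it is not larger than the largest of them, whatever the overlap
    of the balls. *)
Lemma cutoff_balls : exists2 C : R, 1 <= C &
  forall (s : seq nat) (c : nat -> V) (r : nat -> R),
    (forall j, j \in s -> 0 < r j) ->
  exists eta : V -> R,
    [/\ smooth eta, forall x, 0 <= eta x <= 1,
        forall j x, j \in s -> eball (c j) (r j) x -> eta x = 1,
        forall x, (forall j, j \in s -> ~ eball (c j) (2 * r j) x) -> eta x = 0 &
        forall x, grad eta x = 0 \/ exists2 j, j \in s &
          eball (c j) (2 * r j) x /\ enorm (grad eta x) <= C / r j].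
Proof.
have [C1 C11 bC] := bump_grad; have [C2 C21 [s' [sd sC s0]]] := step_derive_bounded R.
exists (C2 * C1) => [|s c r r0]; first by rewrite -[leLHS]mulr1 ler_pM.
pose b j := bump (c j) (r j).
(* N is so large that the sum of (size s).+1 terms equal to 1 stays below
   exp(N/4). *)
pose N : R := 4 * (size s).+1%:R.
have N0 : 0 < N by rewrite mulr_gt0.
pose F x := 1 + \sum_(j <- s) expR (N * b j x).
have F1 x : 1 <= F x by rewrite lerDl; apply: sumr_ge0 => j _; exact: expR_ge0.
have F0 x : 0 < F x by exact: lt_le_trans (F1 x).
pose l x := N^-1 * ln (F x).
pose eta := @step R \o l.
have CF k : CkV k F.
  apply: CkD; first exact: Ck_cst.
  apply: Ck_sum => j; apply: (@Ck_comp _ _ _ _ _ _ _ setT) => //; first exact: Ck1_expR.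
  by apply: CkM; [exact: Ck_cst|exact: Ck_bump].
have Cl k : CkV k l.
  apply: CkM; first exact: Ck_cst.
  apply: (@Ck_comp _ _ _ _ _ _ (@ln R) [set y : R | 0 < y] F) => // [|x _ /=].
    exact: Ck1_ln.
  exact: F0.
have Ce k : CkV k eta.
  by apply: (@Ck_comp _ _ _ _ _ _ _ setT) => //; exact: Ck1_step.
exists eta; split.
- exact: Ck_smooth.
- by move=> x; rewrite step_ge0 step_le1.
- move=> j x js xj; rewrite /eta/= step1// /l [leRHS]mulrC ler_pdivlMr//.
  have FN : expR N <= F x.
    rewrite /F (big_rem j)//= /b bump1 ?r0// mulr1 addrCA lerDl addr_ge0//.
    by apply: sumr_ge0 => k _; exact: expR_ge0.
  have : N <= ln (F x) by rewrite -[leLHS]expRK ler_ln ?posrE ?expR_gt0.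
  by apply: le_trans; rewrite ler_piMl ?(ltW N0)//; lra.
- move=> x xs; rewrite /eta/= step0// /l mulrC ler_pdivrMr//.
  have -> : F x = (size s).+1%:R.
    rewrite /F big_seq (eq_bigr (fun=> 1)); last first.
      by move=> j js; rewrite /b bump0 ?mulr0 ?expR0//; [exact: r0|exact: xs].
    rewrite -big_seq big_const_seq count_predT iter_addr_0.
    by rewrite -[in RHS]natr1 addrC.
  rewrite /N mulrA mulVf// mul1r.
  apply: le_trans (_ : (size s)%:R <= _); last by rewrite ler_nat.
  by rewrite -natr1 addrC le_ln1Dx// (lt_le_trans (ltrN10 R)).
move=> x.
pose w j := expR (N * b j x) / F x.
have gE : grad eta x = s' (l x) *: \sum_(j <- s) w j *: grad (b j) x.
  apply: gradE => i; rewrite mxE.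
  apply: (@is_derive_chain _ _ l (@step R)).
  have dF : is_derive x (delta_mx ord0 i) (F : V -> R^o)
      (\sum_(j <- s) expR (N * b j x) * (N * grad (b j) x ord0 i)).
    rewrite -[X in is_derive _ _ _ X]add0r; apply: (@is_deriveD _ _ R^o (cst 1)).
    elim: (s) => [|j s1 IH].
      by under eq_fun do rewrite big_nil; rewrite big_nil; exact: is_derive_cst.
    under eq_fun do rewrite big_cons; rewrite big_cons.
    apply: (@is_deriveD _ _ R^o (fun y => expR (N * b j y))) => //.
    apply: (@is_derive_chain _ _ (fun y => N * b j y)).
    by apply: (@is_deriveZ _ _ R^o); apply: Ck_grad; exact: Ck_bump.
  have dl : is_derive x (delta_mx ord0 i) (l : V -> R^o)
      (N^-1 * ((F x)^-1 * \sum_(j <- s) expR (N * b j x) * (N * grad (b j) x ord0 i))).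
    apply: (@is_deriveZ _ _ R^o (fun y => ln (F y))).
    by apply: (@is_derive_chain _ _ F) => //; exact: is_derive1_ln.
  apply: (@is_derive_eq _ _ _ _ _ _ _ _ dl).
  rewrite summxE !mulr_sumr; apply: eq_bigr => j _; rewrite [RHS]mxE /w.
  by field; rewrite !gt_eqF.
have [s_nil|snil] := eqVneq s [::]; first by left; rewrite gE s_nil big_nil scaler0.
have [j js jmax] := seq_argmax (fun j => enorm (grad (b j) x)) snil.
have [xj|xj] := pselect (eball (c j) (2 * r j) x); last first.
  left; rewrite gE big_seq big1 ?scaler0// => k ks.
  suff -> : grad (b k) x = 0 by rewrite scaler0.
  apply: enorm_eq0; apply/eqP; rewrite eq_le enorm_ge0 andbT.
  rewrite (le_trans (jmax k ks))// /b.
  by have [_ ->//] := bC (c j) (r j) x (r0 j js); rewrite enorm0.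
right; exists j => //; split => //.
rewrite gE enormZ -mulrA; apply: ler_pM => //; first exact: enorm_ge0.
have [+ _] := bC (c j) (r j) x (r0 j js); apply: le_trans.
apply: le_trans (enorm_sum _ _) _.
apply: (@le_trans _ _ (\sum_(k <- s) w k * enorm (grad (b j) x))).
  rewrite big_seq [leRHS]big_seq; apply: ler_sum => k ks.
  have w0 : 0 <= w k by rewrite divr_ge0 ?expR_ge0// ltW.
  rewrite enormZ (ger0_norm w0); apply: ler_wpM2l; first exact: w0.
  exact: (jmax k ks).
rewrite -mulr_suml -[leRHS]mul1r ler_wpM2r ?enorm_ge0//.
by rewrite /w -mulr_suml ler_pdivrMr// mul1r /F lerDr.
Qed.

End smooth_rV.

(** * Test functions and integration by parts *)

Section test_functions.
Variables (R : realType) (n : nat).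
Local Notation V := 'rV[R]_n.
Local Notation mu := (leb R n).
Local Notation CkV := (@Ck R V 'I_n (fun i => delta_mx ord0 i) setT).
Implicit Types (f g : V -> R) (U : set V).

Lemma smoothM f g : smooth f -> smooth g -> smooth (fun x => f x * g x).
Proof. by move=> sf sg; apply: Ck_smooth => k; apply: CkM; exact: smooth_Ck. Qed.

Lemma smooth1B f : smooth f -> smooth (fun x => 1 - f x).
Proof.
move=> sf; apply: Ck_smooth => k; apply: CkD; first exact: Ck_cst.
by apply: CkN; exact: smooth_Ck.
Qed.

Lemma smooth_continuous f : smooth f -> continuous f.
Proof. by move=> sf; have [] := sf [::]. Qed.

Lemma smooth_is_derive f x i : smooth f ->
  is_derive x (delta_mx ord0 i) (f : V -> R^o) (grad f x ord0 i).
Proof. by move=> sf; apply: Ck_grad; exact: smooth_Ck. Qed.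

Lemma grad_mul f g x : smooth f -> smooth g ->
  grad (fun y => f y * g y) x = f x *: grad g x + g x *: grad f x.
Proof.
move=> sf sg; apply: gradE => i; rewrite mxE [X in X + _]mxE [X in _ + X]mxE.
have df := smooth_is_derive x i sf; have dg := smooth_is_derive x i sg.
exact: (@is_deriveM _ _ (f : V -> R^o) (g : V -> R^o)).
Qed.

Lemma grad_1B f x : smooth f -> grad (fun y => 1 - f y) x = - grad f x.
Proof.
move=> sf; apply: gradE => i; rewrite mxE -[X in is_derive _ _ _ X]sub0r.
have df := smooth_is_derive x i sf.
exact: (@is_deriveB _ _ R^o (cst 1) (f : V -> R^o)).
Qed.

Lemma continuous_enorm_grad f : smooth f -> continuous (fun x => enorm (grad f x)).
Proof.
move=> sf x.
have e y : dotp (grad f y) (grad f y) = \sum_(i < n) pderiv i f y * pderiv i f y.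
  by apply: eq_bigr => i _; rewrite !mxE.
rewrite (_ : (fun _ => _) = Num.sqrt \o
    (fun y => \sum_(i < n) pderiv i f y * pderiv i f y)); last first.
  by apply/funext => y; rewrite /= -e.
apply: continuous_comp; last exact: sqrt_continuous.
apply: (@continuous_sumr _ V) => i.
by apply: continuous_mulr; apply: smooth_continuous; exact: smooth_pderiv.
Qed.

(** The complement of the closed support is open. *)
Lemma near_not_support f x : ~ closure [set y | f y != 0] x ->
  \forall y \near x, f y = 0.
Proof.
move=> nx; have : open (~` closure [set y | f y != 0]).
  by apply: closed_openC; exact: closed_closure.
rewrite openE => /(_ x nx); apply: filterS => y ny.
apply: contrapT => /eqP fy; apply: ny; exact: subset_closure.
Qed.

Lemma support0 f x : ~ closure [set y | f y != 0] x -> f x = 0.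
Proof. by move=> /near_not_support/nbhs_singleton. Qed.

Lemma pderiv_support0 f i x : ~ closure [set y | f y != 0] x -> pderiv i f x = 0.
Proof.
move=> /near_not_support h; rewrite /pderiv.
rewrite (@near_eq_derive _ _ R^o f (cst 0)) ?derive_cst//.
Qed.

Lemma grad_support0 f x : ~ closure [set y | f y != 0] x -> grad f x = 0.
Proof. by move=> h; apply/rowP => i; rewrite !mxE pderiv_support0. Qed.

Lemma compact_bounded_above (K : set V) f : compact K -> continuous f ->
  exists2 M, 0 <= M & forall x, K x -> f x <= M.
Proof.
move=> cK cf; have [->|/set0P K0] := eqVneq K set0.
  by exists 0 => // x [].
have [|c cKc cmax] := @EVT_max_rV R n f K K0 cK; first exact: continuous_subspaceT.
exists `|f c| => // x Kx; apply: le_trans (ler_norm _).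
by apply: cmax; rewrite inE.
Qed.

Lemma test_fun_bounded U f : test_fun U f -> exists M r,
  [/\ 0 <= M, forall x, `|f x| <= M, forall x, enorm (grad f x) <= M &
      forall x, r <= enorm x -> ~ closure [set y | f y != 0] x].
Proof.
move=> [sf cK KU]; set K := closure _ in cK KU *.
have cabs : continuous (fun x => `|f x|).
  by move=> x; apply: (@continuous_comp _ _ _ f Num.norm);
    [exact: smooth_continuous|exact: norm_continuous].
have [M1 M10 fM1] := compact_bounded_above cK cabs.
have [M2 M20 gM2] := compact_bounded_above cK (continuous_enorm_grad sf).
have [M3 M30 KM3] := compact_bounded_above cK (@continuous_enorm R n).
exists (M1 + M2), (M3 + 1); split => [|x|x|x rx /KM3].
- exact: addr_ge0.
- have [Kx|/support0 ->] := pselect (K x); last by rewrite normr0 addr_ge0.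
  by rewrite (le_trans (fM1 x Kx))// lerDl.
- have [Kx|/grad_support0 ->] := pselect (K x); last by rewrite enorm0 addr_ge0.
  by rewrite (le_trans (gM2 x Kx))// lerDr.
- by lra.
Qed.

Lemma integral_support U (h : V -> R) : (forall x, ~ U x -> h x = 0) ->
  (\int[mu]_(x in U) (h x)%:E = \int[mu]_x (h x)%:E)%E.
Proof.
move=> h0; rewrite integral_mkcond; apply: eq_integral => x _.
by rewrite patchE; case: ifPn => //; rewrite notin_setE => /h0 ->.
Qed.

(** Integration by parts: the partial derivative of the product f g has integral
    zero. *)
Lemma test_fun_parts U f g i : test_fun U f -> test_fun U g ->
  (\int[mu]_(x in U) (f x * pderiv i g x)%:E =
   - \int[mu]_(x in U) (grad f x ord0 i * g x)%:E)%E.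
Proof.
move=> tf tg; have [sf _ fU] := tf; have [sg _ gU] := tg.
have [Mf [rf [Mf0 fM gfM fr]]] := test_fun_bounded tf.
have [Mg [rg [Mg0 gM ggM gr]]] := test_fun_bounded tg.
rewrite (integral_support (U := U) (h := fun x => f x * pderiv i g x)); last first.
  by move=> x nUx; rewrite (support0 (_ : ~ closure [set y | f y != 0] x)) ?mul0r// => /fU.
rewrite (integral_support (U := U) (h := fun x => grad f x ord0 i * g x)); last first.
  by move=> x nUx; rewrite (support0 (_ : ~ closure [set y | g y != 0] x)) ?mulr0// => /gU.
have sfg := smoothM sf sg.
have pdE x : pderiv i (fun y => f y * g y) x =
    f x * pderiv i g x + grad f x ord0 i * g x.
  have /rowP/(_ i) := grad_mul x sf sg; rewrite !mxE => ->.
  by rewrite (mulrC (g x)).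
have leM h x : enorm (grad h x) <= Mf + Mg -> `|pderiv i h x| <= Mf + Mg.
  by apply: le_trans; rewrite (le_trans _ (le_coord_enorm _ i))// mxE.
have i1 : mu.-integrable setT (fun x : leb_space R n => (f x * pderiv i g x)%:E).
  apply: (@integrable_bounded_support _ _ _ (Mf * (Mf + Mg)) rf).
  - apply: continuous_mulr; first exact: smooth_continuous.
    exact/smooth_continuous/smooth_pderiv.
  - move=> x; rewrite normrM ler_pM// leM// (le_trans (ggM x))// lerDr//.
  - by move=> x /fr/support0 ->; rewrite mul0r.
have i2 : mu.-integrable setT (fun x : leb_space R n => (grad f x ord0 i * g x)%:E).
  apply: (@integrable_bounded_support _ _ _ ((Mf + Mg) * Mg) rg).
  - apply: continuous_mulr; last exact: smooth_continuous.
    under eq_fun do rewrite mxE; exact/smooth_continuous/smooth_pderiv.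
  - move=> x; rewrite mxE normrM ler_pM// leM// (le_trans (gfM x))// lerDl//.
  - by move=> x /gr/support0 ->; rewrite mulr0.
have : (\int[mu]_x (pderiv i (fun y => f y * g y) x)%:E = 0)%E.
  apply: (@integral_pderiv_eq0 _ _ _ _ ((Mf + Mg) * (Mf + Mg) + (Mf + Mg) * (Mf + Mg)) rf).
  - exact: smooth_continuous.
  - exact/smooth_continuous/smooth_pderiv.
  - by move=> x; have [_] := sfg [::]; exact.
  - move=> x; rewrite normrM -[leLHS]addr0; apply: lerD; last by rewrite mulr_ge0// addr_ge0.
    by apply: ler_pM => //; [rewrite (le_trans (fM x))// lerDl|rewrite (le_trans (gM x))// lerDr].
  - move=> x; rewrite pdE; apply: (le_trans (ler_normD _ _)); apply: lerD; rewrite normrM.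
      apply: ler_pM => //; first by rewrite (le_trans (fM x))// lerDl.
      by rewrite leM// (le_trans (ggM x))// lerDr.
    apply: ler_pM => //; last by rewrite (le_trans (gM x))// lerDr.
    by rewrite mxE leM// (le_trans (gfM x))// lerDl.
  - by move=> x /fr/support0 ->; rewrite mul0r.
under eq_integral do rewrite pdE EFinD.
rewrite integralD//.
have f1 := integrable_fin_num measurableT i1.
have f2 := integrable_fin_num measurableT i2.
rewrite -(fineK f1) -(fineK f2) -EFinD => -[/eqP].
by rewrite addr_eq0 => /eqP ->; rewrite EFinN.
Qed.

End test_functions.

(** * Pointwise inequalities for Phi-functions *)

Section pointwise.
Variable R : realType.

Record Phi_at (p q L : R) (f : R -> R) : Prop := PhiAt {
  Phi_at_ge0 : forall s, 0 <= s -> 0 <= f s;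
  Phi_at_le : forall s t, 0 <= s -> s <= t -> f s <= f t;
  Phi_at_0 : f 0 = 0;
  Phi_at_cvg0 : f s @[s --> 0^'+] --> (0 : R);
  Phi_at_left : forall s, 0 < s -> f t @[t --> s^'-] --> f s;
  Phi_at_slope : almost_increasing L (fun s => f s / s);
  Phi_at_inc : almost_increasing L (fun s => f s / s `^ p);
  Phi_at_dec : almost_decreasing L (fun s => f s / s `^ q) }.

Section one_function.
Variables (p q L : R) (f : R -> R).
Hypotheses (L1 : 1 <= L) (q0 : 0 <= q) (Pf : Phi_at p q L f).

Lemma Phi_at_scale (a s : R) : 1 <= a -> 0 <= s -> f (a * s) <= L * a `^ q * f s.
Proof.
move=> a1; rewrite le_eqVlt => /predU1P[<-|s0].
  by rewrite mulr0 (Phi_at_0 Pf) mulr0.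
have a0 : 0 < a by exact: lt_le_trans a1.
have := Phi_at_dec Pf s0 (_ : s <= a * s); rewrite ler_peMl ?(ltW s0)// => /(_ isT).
rewrite ler_pdivrMr ?powR_gt0 ?mulr_gt0//.
rewrite powRM ?(ltW a0) ?(ltW s0)// => /le_trans; apply.
rewrite le_eqVlt; apply/orP; left; apply/eqP.
by field; rewrite gt_eqF// powR_gt0.
Qed.

(** Young's inequality without the conjugate function.  If s <= K t, the left side
    is at most K f(t); otherwise t is much smaller than s, and since f(t)/t^p is
    almost increasing, f(t)/t is at most a factor (t/s)^(p-1) of f(s)/s. *)
Lemma Phi_at_young (K t s : R) : 1 < p -> 1 <= K -> 0 < t -> 0 <= s ->
  f t / t * s <= L * K `^ (1 - p) * f s + K * f t.
Proof.
move=> p1 K1 t0 s0; have K0 : 0 < K by exact: lt_le_trans K1.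
have ft0 := Phi_at_ge0 Pf (ltW t0); have fs0 := Phi_at_ge0 Pf s0.
have LK0 : 0 <= L * K `^ (1 - p) by rewrite mulr_ge0 ?powR_ge0// (le_trans _ L1).
have [sK|Ks] := leP s (K * t).
  apply: (@le_trans _ _ (K * f t)); last by rewrite lerDr mulr_ge0.
  by rewrite mulrAC ler_pdivrMr// mulrAC mulrC ler_pM.
have {s0} s0 : 0 < s by rewrite (le_lt_trans _ Ks)// mulr_ge0// ltW.
have ts : t <= s by rewrite (le_trans _ (ltW Ks))// ler_peMl// ltW.
apply: (@le_trans _ _ (L * K `^ (1 - p) * f s)); last by rewrite lerDl mulr_ge0// ltW.
have := Phi_at_inc Pf t0 ts; rewrite ler_pdivrMr ?powR_gt0// => h.
have sKt : s / t > K by rewrite ltr_pdivlMr.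
apply: (@le_trans _ _ (L * (f s / s `^ p) * t `^ p / t * s)).
  by rewrite ler_pM2r// ler_pM2r ?invr_gt0.
rewrite (_ : L * (f s / s `^ p) * t `^ p / t * s = L * f s * (s / t) `^ (1 - p)).
  rewrite mulrAC ler_wpM2r// ler_wpM2l ?(le_trans _ L1)//.
  rewrite -opprB !powRN lef_pV2 ?posrE ?powR_gt0// ?(lt_trans K0)//.
  by apply: ge0_ler_powR; rewrite ?nnegrE ?subr_ge0 ?(ltW p1)// ?(ltW K0)// ltW// (lt_trans K0).
have st0 : s / t != 0 by rewrite gt_eqF// divr_gt0.
rewrite powRD ?st0 ?implybT// powRr1 ?ltW ?divr_gt0// powRN powRM ?invr_ge0 ?ltW//.
rewrite [t^-1 `^ p](_ : _ = (t `^ p)^-1); last first.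
  by rewrite -powR_inv1 ?ltW// -powRrM mulN1r powRN.
by field; rewrite !gt_eqF ?powR_gt0.
Qed.

Lemma Phi_at_le_large (b G : R) : 0 < b -> f b <= 1 -> 0 <= G ->
  f G <= L * (1 + G / b) `^ q.
Proof.
move=> b0 fb G0; have Gb : 0 <= G / b by rewrite divr_ge0// ltW.
have a1 : 1 <= 1 + G / b by rewrite lerDl.
apply: (@le_trans _ _ (f ((1 + G / b) * b))).
  apply: (Phi_at_le Pf) => //.
  by rewrite mulrDl mul1r mulfVK ?gt_eqF// lerDr ltW.
apply: (le_trans (Phi_at_scale a1 (ltW b0))).
by rewrite ler_piMr// mulr_ge0 ?powR_ge0// (le_trans _ L1).
Qed.

Lemma Phi_at_ge_large (b s : R) : 0 < b -> 1 <= f b^-1 -> b^-1 <= s ->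
  b / L * s <= f s.
Proof.
move=> b0 fb bs; have bV0 : 0 < b^-1 by rewrite invr_gt0.
have s0 : 0 < s by exact: lt_le_trans bs.
have L0 : 0 < L by exact: lt_le_trans L1.
have := Phi_at_slope Pf bV0 bs; rewrite invrK => h.
have {}h : b <= L * (f s / s) by apply: le_trans h; rewrite ler_peMl// ltW.
rewrite mulrAC ler_pdivrMr// [f s * L]mulrC.
by rewrite -ler_pdivlMr// -mulrA.
Qed.

End one_function.

(** The exponent 1 - p is negative, so the factor of f(s) in Young's inequality is
    as small as desired for large K. *)
Lemma young_const (p L e : R) : 1 < p -> 1 <= L -> 0 < e ->
  exists2 K : R, 1 <= K & L * K `^ (1 - p) <= e.
Proof.
move=> p1 L1 e0; have L0 : 0 < L by exact: lt_le_trans L1.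
have Le : 0 <= L / e by rewrite divr_ge0 ?ltW.
have p0 : 0 < p - 1 by rewrite subr_gt0.
exists (1 + (L / e) `^ (p - 1)^-1); first by rewrite lerDl powR_ge0.
set K := 1 + _; have K0 : 0 < K by rewrite ltr_wpDr ?powR_ge0.
rewrite -opprB powRN -ler_pdivlMr ?invr_gt0 ?powR_gt0// invrK.
rewrite mulrC -ler_pdivrMr//.
apply: (@le_trans _ _ (((L / e) `^ (p - 1)^-1) `^ (p - 1))).
  by rewrite -powRrM mulVf ?gt_eqF// powRr1.
by apply: ge0_ler_powR; rewrite ?nnegrE ?powR_ge0 ?(ltW p0) ?(ltW K0)// lerDr.
Qed.

End pointwise.

Section growth.
Variables (R : realType) (n : nat).
Local Notation V := 'rV[R]_n.

(** At the point 0, where the growth condition says nothing, the estimate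
    follows by continuity. *)
Lemma growth_young (p q L c1 e K : R) (f : R -> R) (a : V -> V) (z : V) (s : R) :
  (0 < n)%N -> 1 < p -> 1 <= L -> 0 <= q -> 0 <= c1 -> Phi_at p q L f ->
  continuous a ->
  (forall z, z != 0 -> enorm (a z) <= c1 * (f (enorm z) / enorm z)) ->
  1 <= K -> L * K `^ (1 - p) <= e -> 0 <= s ->
  enorm (a z) * s <= c1 * (e * f s + K * f (enorm z)).
Proof.
move=> n0 p1 L1 q0 c10 Pf ca ga K1 Ke s0.
have fs0 := Phi_at_ge0 Pf s0.
have main y : y != 0 -> enorm (a y) * s <= c1 * (e * f s + K * f (enorm y)).
  move=> y0; have ey := enorm_gt0 y0.
  apply: (@le_trans _ _ (c1 * (f (enorm y) / enorm y) * s)).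
    by rewrite ler_wpM2r// ga.
  rewrite -mulrA ler_wpM2l// (le_trans (Phi_at_young L1 Pf p1 K1 ey s0))//.
  by rewrite lerD2r ler_wpM2r.
have [->|] := eqVneq z 0; last exact: main.
rewrite enorm0 (Phi_at_0 Pf) mulr0 addr0.
pose i : 'I_n := Ordinal n0; pose v : V := delta_mx ord0 i.
have v1 : enorm v = 1 by exact: enorm_delta.
have cv : t *: v @[t --> (0 : R)^'+] --> (0 : V).
  have cv0 : t *: v @[t --> (0 : R)] --> (0 : R) *: v by exact: scalel_continuous.
  by rewrite scale0r in cv0; exact: cvg_at_right_filter cv0.
have c1l : enorm (a (t *: v)) * s @[t --> (0 : R)^'+] --> enorm (a 0) * s.
  apply: cvgM; last exact: cvg_cst.
  have ce : {for (0 : V), continuous (fun y => enorm (a y))}.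
    by apply: (@continuous_comp _ _ _ a (@enorm R n)); [exact: ca|exact: continuous_enorm].
  exact: (continuous_cvg _ ce cv).
have c2l : c1 * (e * f s + K * f t) @[t --> (0 : R)^'+] --> c1 * (e * f s + K * 0).
  apply: cvgM; first exact: cvg_cst.
  apply: cvgD; first exact: cvg_cst.
  by apply: cvgM; [exact: cvg_cst|exact: Phi_at_cvg0 Pf].
rewrite mulr0 addr0 in c2l.
apply: (ler_cvg_to c1l c2l); near=> t.
have t0 : 0 < t by near: t; exact: nbhs_right_gt.
have := main (t *: v); rewrite enormZ v1 mulr1 gtr0_norm//; apply.
by apply/eqP => tv; have := congr1 (@enorm R n) tv; rewrite enormZ v1 mulr1 enorm0 gtr0_norm//; lra.
Unshelve. all: by end_near. Qed.

End growth.

(** * Good points, measurability and doubling *)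

Section setting.
Variables (R : realType) (n : nat).
Local Notation V := 'rV[R]_n.
Local Notation mu := (leb R n).

(** Restricting to a subset G of full measure turns every almost-everywhere
    hypothesis into a pointwise one. *)
Record good_points (Omega : set V) (phi : V -> R -> R) (p q L c1 : R)
    (A : V -> V -> V) (G : set V) : Prop := GoodPoints {
  good_measurable : measurable (G : set (leb_space R n));
  good_sub : G `<=` Omega;
  good_null : mu (Omega `\` G) = 0%E;
  good_Phi : forall x, G x -> Phi_at p q L (phi x);
  good_continuous : forall x, G x -> continuous (A x);
  good_growth : forall x, G x -> forall z, z != 0 ->
    enorm (A x z) <= c1 * (phi x (enorm z) / enorm z) }.

Lemma almost_increasing_le (L L' : R) (f : R -> R) : L <= L' ->
  (forall s, 0 < s -> 0 <= f s) -> almost_increasing L f -> almost_increasing L' f.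
Proof.
move=> LL' f0 Lf s t s0 st; apply: le_trans (Lf s t s0 st) _.
by rewrite ler_wpM2r// f0// (lt_le_trans s0).
Qed.

Lemma almost_decreasing_le (L L' : R) (f : R -> R) : L <= L' ->
  (forall s, 0 < s -> 0 <= f s) -> almost_decreasing L f -> almost_decreasing L' f.
Proof.
move=> LL' f0 Lf s t s0 st; apply: le_trans (Lf s t s0 st) _.
by rewrite ler_wpM2r// f0.
Qed.

Lemma ae_and (P Q : V -> Prop) : {ae mu, forall x, P x} -> {ae mu, forall x, Q x} ->
  {ae mu, forall x, P x /\ Q x}.
Proof.
move=> hP hQ; apply: (negligibleS _ (negligibleU hP hQ)) => x /= /not_andP.
by move=> [h|h]; [left|right].
Qed.

Lemma ae_imp (P Q : V -> Prop) : (forall x, P x -> Q x) ->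
  {ae mu, forall x, P x} -> {ae mu, forall x, Q x}.
Proof. by move=> PQ; apply: negligibleS => x /=; apply: contra_not => /PQ. Qed.

(** All conditions that hold almost everywhere are collected in one set of full
    measure, with one constant L for the three monotonicity conditions. *)
Lemma exists_good_points (Omega : set V) (phi : V -> R -> R) (p q c1 c2 : R)
    (A : V -> V -> V) :
  open Omega -> convex_Phi Omega phi -> aInc Omega phi p -> aDec Omega phi q ->
  structure_conditions Omega phi c1 c2 A ->
  exists2 L, 1 <= L & exists G, good_points Omega phi p q L c1 A G.
Proof.
move=> oO hphi [Lp Lp1 hp] [Lq Lq1 hq] hA.
have [L0 L01 h0] := Phi_almost_increasing hphi.
pose L := L0 + Lp + Lq; exists L; first by rewrite /L; lra.
have f0 (x : V) (s : R) : Omega x -> 0 <= s -> 0 <= phi x s.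
  by move=> Ox s0; exact: (Phi_ge0 hphi Ox s0).
have [N [mN N0] NP'] := ae_null_set (ae_and (Phi_increasing hphi)
  (ae_and (Phi_left_continuous hphi) (ae_and (Phi_at0 hphi) (ae_and h0
  (ae_and hp (ae_and hq (ae_and (A_continuous hA) (A_growth hA)))))))).
have NP x : ~ N x -> Omega x -> [/\ Phi_at p q L (phi x), continuous (A x) &
    forall z, z != 0 -> enorm (A x z) <= c1 * (phi x (enorm z) / enorm z)].
  move=> /NP' [P1 [P2 [P3 [P4 [P5 [P6 [P7 P8]]]]]]] Ox; have [P3a P3b] := P3 Ox.
  split; [split => //|exact: P7|exact: P8].
  - by move=> s; exact: f0.
  - exact: P1.
  - exact: P2.
  - apply: almost_increasing_le (P4 Ox) => [|s s0]; first by rewrite /L; lra.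
    by rewrite divr_ge0 ?f0// ltW.
  - apply: almost_increasing_le (P5 Ox) => [|s s0]; first by rewrite /L; lra.
    by rewrite divr_ge0 ?f0 ?powR_ge0// ltW.
  - apply: almost_decreasing_le (P6 Ox) => [|s s0]; first by rewrite /L; lra.
    by rewrite divr_ge0 ?f0 ?powR_ge0// ltW.
have mO : measurable (Omega : set (leb_space R n)) by exact: open_leb_measurable.
exists (Omega `\` N); split.
- exact: measurableD.
- exact: subDsetl.
- apply/eqP; rewrite eq_le measure_ge0 andbT -N0.
  by apply: le_lebesgue_outer => x [Ox h]; apply: contrapT => nN; exact: h.
- by move=> x [Ox /NP/(_ Ox)[]].
- by move=> x [Ox /NP/(_ Ox)[]].
- by move=> x [Ox /NP/(_ Ox)[]].
Qed.

Section with_good_points.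
Variables (Omega : set V) (phi : V -> R -> R) (p q L c1 : R) (A : V -> V -> V)
  (G : set V).
Hypotheses (mO : measurable (Omega : set (leb_space R n)))
  (hphi : convex_Phi Omega phi) (gp : good_points Omega phi p q L c1 A G).

Lemma ae_good : {ae mu, forall x, Omega x -> G x}.
Proof.
exists (Omega `\` G); split.
- by apply: measurableD => //; exact: good_measurable gp.
- exact: good_null gp.
- by move=> x /= /not_implyP.
Qed.

(** Null sets are measurable, so measurability may be checked on good points
    only. *)
Lemma measurable_mod_good (S T : set V) : S `<=` Omega ->
  measurable (T : set (leb_space R n)) -> (forall x, G x -> S x <-> T x) ->
  measurable (S : set (leb_space R n)).
Proof.
move=> SO mT ST.
rewrite [X in measurable X](_ : _ = (T `&` G) `|` (S `\` G)); last first.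
  apply/seteqP; split=> x.
    by move=> Sx; have [Gx|nGx] := pselect (G x); [left; split => //; exact/ST|right].
  by move=> [[Tx Gx]|[]//]; apply/ST.
apply: measurableU; first by apply: measurableI => //; exact: good_measurable gp.
apply: leb_null_measurable; apply/eqP; rewrite eq_le measure_ge0 andbT.
by rewrite -(good_null gp); apply: le_lebesgue_outer; exact: setSD.
Qed.

(** phi(x,.) is increasing and left-continuous, so phi(x,f(x)) > a holds if and only
    if phi(x,r) > a for some rational r < f(x). *)
Lemma measurable_Phi_comp (D : set V) (f : V -> R) : D `<=` Omega ->
  measurable (D : set (leb_space R n)) -> leb_measurable_fun D f ->
  (forall x, 0 <= f x) ->
  measurable_fun (D : set (leb_space R n)) (fun x : leb_space R n => phi x (f x)).
Proof.
move=> DO mD mf f0; apply: (measurability _ (RGenOInfty.measurableE R)).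
move=> _ [_ [a ->] <-].
have [a0|a0] := ltP a 0.
  rewrite setIidl//= => x Dx /=; rewrite in_itv/= andbT (lt_le_trans a0)//.
  exact: (Phi_ge0 hphi (DO _ Dx)).
pose T := \bigcup_(r in [set r : rat | 0 <= r])
  ((D `&` [set x | a < phi x (ratr r)]) `&` (D `&` [set x | ratr r < f x])).
apply: (@measurable_mod_good _ T); first by move=> x [/DO].
  rewrite /T bigcup_mkcond; apply: countable_bigcupT_measurable => [|r].
    exact: countableP.
  case: ifPn => [|_]; last exact: measurable0.
  rewrite inE/= => r0; apply: measurableI.
    have r0' : 0 <= ratr r :> R by rewrite ler0q.
    have m : measurable_fun (D : set (leb_space R n)) (fun x : leb_space R n => phi x (ratr r)).
      exact: measurable_funS mO DO (Phi_measurable hphi r0').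
    have := m mD `]a, +oo[%classic (measurable_itv _).
    by congr (measurable (_ `&` _)); apply/funext => x; rewrite /= in_itv/= andbT.
  have := mf mD `](ratr r), +oo[%classic (measurable_itv _).
  by congr (measurable (_ `&` _)); apply/funext => x; rewrite /= in_itv/= andbT.
move=> x Gx; have Px := good_Phi gp Gx; split.
  move=> [Dx] /=; rewrite in_itv/= andbT => ax.
  have fx0 : 0 < f x.
    rewrite lt_neqAle f0 andbT; apply: contraTneq ax => <-.
    by rewrite (Phi_at_0 Px) -leNgt.
  have /cvgrPdist_lt/(_ (phi x (f x) - a)) := Phi_at_left Px fx0.
  rewrite subr_gt0 => /(_ ax) near1.
  have [t [[t0 tf] tP]] : exists t, (0 < t /\ t < f x) /\ a < phi x t.
    near ((f x)^'-) => t; exists t; split; first split.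
    - by near: t; exact: nbhs_left_gt.
    - by near: t; exact: nbhs_left_lt.
    - have : `|phi x (f x) - phi x t| < phi x (f x) - a by near: t.
      by move=> /(le_lt_trans (ler_norm _)); lra.
  have [r] := rat_in_itvoo tf; rewrite in_itv/= => /andP[tr rf].
  exists r; first by rewrite /= -(@ler0q R) (le_trans (ltW t0))// ltW.
  split; split => //=.
  by rewrite (lt_le_trans tP)//; apply: (Phi_at_le Px); exact: ltW.
move=> [r /= r0 [[Dx ar] [_ rf]]]; split => //=; rewrite in_itv/= andbT.
rewrite (lt_le_trans ar)//; apply: (Phi_at_le Px); last exact: ltW.
by rewrite ler0q.
Unshelve. all: by end_near. Qed.

(** A(x,.) is continuous, so A(x,Du(x)) > a holds if and only if, for some l and
    m, every rational vector within 1/m of Du(x) gives a value above a + 1/l.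
    These are countably many conditions on A(.,v) for fixed v. *)
Lemma measurable_caratheodory_comp (Du : V -> V) (i : 'I_n) :
  (forall z j, leb_measurable_fun Omega (fun x => A x z ord0 j)) ->
  (forall j, leb_measurable_fun Omega (fun x => Du x ord0 j)) ->
  leb_measurable_fun Omega (fun x => A x (Du x) ord0 i).
Proof.
move=> mA mDu; apply: (measurability _ (RGenOInfty.measurableE R)).
move=> _ [_ [a ->] <-].
pose qv (v : 'rV[rat]_n) : V := map_mx ratr v.
pose near_q (m : nat) (v : 'rV[rat]_n) :=
  Omega `&` \bigcap_(j in [set: 'I_n])
    (Omega `&` [set x | `|Du x ord0 j - qv v ord0 j| < m.+1%:R^-1]).
pose big_q (l : nat) (v : 'rV[rat]_n) :=
  Omega `&` [set x | a + l.+1%:R^-1 < A x (qv v) ord0 i].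
pose T := \bigcup_l \bigcup_m (Omega `&`
  ~` \bigcup_(v in [set: 'rV[rat]_n]) (near_q m v `\` big_q l v)).
apply: (@measurable_mod_good _ T); first by move=> x [].
  apply: bigcupT_measurable => l; apply: bigcupT_measurable => m.
  apply: measurableI => //; apply: measurableC.
  apply: countable_bigcupT_measurable => [|v]; first exact: countableP.
  apply: measurableD.
    apply: measurableI => //; apply: fin_bigcap_measurable => // j _.
    have mj : measurable_fun (Omega : set (leb_space R n))
        (fun x : leb_space R n => `|Du x ord0 j - qv v ord0 j|).
      apply: measurableT_comp; first exact: normr_measurable.
      by apply: measurable_funB; [exact: mDu|exact: measurable_cst].
    have := mj mO `]-oo, m.+1%:R^-1[%classic (measurable_itv _).
    by congr (measurable (_ `&` _)); apply/funext => x; rewrite /= in_itv/=.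
  have := mA (qv v) i mO `](a + l.+1%:R^-1), +oo[%classic (measurable_itv _).
  by congr (measurable (_ `&` _)); apply/funext => x; rewrite /= in_itv/= andbT.
move=> x Gx; have Ox := good_sub gp Gx.
have cA : {for Du x, continuous (fun z => A x z ord0 i)}.
  apply: (@continuous_comp _ _ _ (A x) (fun z : V => z ord0 i)).
    exact: (good_continuous gp Gx).
  exact: coord_continuous.
have /cvgrPdist_lt cA' := cA.
split.
  move=> [_] /=; rewrite in_itv/= andbT => ax.
  pose d := (A x (Du x) ord0 i - a) / 2.
  have d0 : 0 < d by rewrite divr_gt0// subr_gt0.
  have [l ld] : exists l, l.+1%:R^-1 <= d.
    exists (Num.truncn d^-1); rewrite invf_ple ?posrE//; exact: ltW (truncnS_gt _).
  have /nbhs_ballP[e /= e0 be] := cA' d d0.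
  have [m me] : exists m, m.+1%:R^-1 <= e.
    exists (Num.truncn e^-1); rewrite invf_ple ?posrE//; exact: ltW (truncnS_gt _).
  exists l => //; exists m => //; split => // -[v _ [[_ nv] nb]].
  apply: nb; split => //=.
  have : ball (Du x) e (qv v).
    split => // j k; rewrite ord1; apply: lt_le_trans me.
    by have [] := nv k I.
  move=> /be /= /(le_lt_trans (ler_norm _)); rewrite /d; move: ld;
   rewrite /d; move: (l.+1%:R^-1) (A x (Du x) ord0 i) (A x (qv v) ord0 i) => w y z. lra.
move=> [l _ [m _ [_ nb]]]; split => //=; rewrite in_itv/= andbT.
pose d : R := l.+1%:R^-1; have d0 : 0 < d by rewrite invr_gt0.
have /nbhs_ballP[e /= e0 be] := cA' d d0.
pose e' := Num.min e m.+1%:R^-1.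
have e'0 : 0 < e' by rewrite lt_min e0 invr_gt0/=.
have ap j : exists r : rat, Du x ord0 j < ratr r < Du x ord0 j + e'.
  by have [|r] := @rat_in_itvoo R (Du x ord0 j) (Du x ord0 j + e');
    [rewrite ltrDl|rewrite in_itv/=; exists r].
have [v vP] := choice ap.
have vd j : `|Du x ord0 j - qv (\row_k v k) ord0 j| < e'.
  by rewrite !mxE; have /andP[? ?] := vP j; rewrite ltr_norml; apply/andP; split; lra.
have : big_q l (\row_k v k) x.
  apply: contrapT => nbx; apply: nb; exists (\row_k v k) => //; split => //.
  split => // j _; split => //=; apply: lt_le_trans (vd j) _.
  by rewrite ge_min lexx orbT.
move=> [_ /=].
have : ball (Du x) e (qv (\row_k v k)).
  split => // j k; rewrite ord1; apply: lt_le_trans (vd k) _.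
  by rewrite ge_min lexx.
move=> /be /=; rewrite distrC => /(le_lt_trans (ler_norm _)); rewrite /d.
move: (l.+1%:R^-1) (A x (Du x) ord0 i) (A x _ ord0 i) => w y z; lra.
Qed.

(** Since q is at most the dimension, the value of phi at a small multiple of
    1/r is below 1/|B|, so that (A1) compares the values of phi on a ball of
    radius of order r at arguments of order 1/r. *)
Lemma h_phi_double : (0 < n)%N -> 0 <= q -> q <= n%:R -> 1 <= L ->
  A0 Omega phi -> A1 Omega phi ->
  exists C k : R, [/\ 0 <= C, 0 < k & forall c r, 0 < r -> r <= k ->
    eball c r `<=` Omega ->
    (\int[mu]_(x in eball c (2 * r) `&` Omega) (phi x r^-1)%:E <=
     C%:E * h_phi phi c r)%E].
Proof.
move=> n0 q0 qn L1 [b /andP[b0 b1] [phib _]] [b' /andP[b'0 b'1] hA1].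
have L0 : 0 < L by exact: lt_le_trans L1.
pose k := b / (8 * L).
have k0 : 0 < k by rewrite divr_gt0// mulr_gt0.
have k1 : k <= 1 by rewrite ler_pdivrMr ?mulr_gt0//; lra.
pose C1 := L * (b' * k)^-1 `^ q.
have C10 : 0 <= C1 by rewrite mulr_ge0 ?powR_ge0// ltW.
exists (C1 * 2 ^+ n), k; split => //; first by rewrite mulr_ge0// exprn_ge0.
move=> c r r0 rk BO; have rV0 : 0 < r^-1 by rewrite invr_gt0.
pose D : set V := eball c (2 * r) `&` Omega.
have mD : measurable (D : set (leb_space R n)).
  by apply: measurableI => //; exact: eball_measurable.
have DO : D `<=` Omega by exact: subIsetr.
have mB : measurable (eball c r : set (leb_space R n)) by exact: eball_measurable.
have BD : eball c r `<=` D.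
  by move=> x xr; split; [rewrite /eball/= (lt_le_trans xr)//; lra|exact: BO].
have mphi (U : set V) (s : R) : 0 <= s -> U `<=` Omega ->
    measurable_fun (U : set (leb_space R n)) (fun x : leb_space R n => (phi x s)%:E).
  move=> s0 UO; apply/measurable_EFinP.
  exact: measurable_funS mO UO (Phi_measurable hphi s0).
rewrite -/D.
have rhs0 : (0 <= (C1 * 2 ^+ n)%:E * h_phi phi c r)%E.
  apply: mule_ge0; first by rewrite lee_fin mulr_ge0// exprn_ge0.
  by apply: integral_ge0 => x /BO Ox; rewrite lee_fin (Phi_ge0 hphi Ox)// ltW.
have aeD (P : V -> Prop) : (forall x, D x -> G x -> P x) ->
    {ae mu, forall x : leb_space R n, D x -> P x}.
  move=> h; apply: ae_imp ae_good => x Gx Dx; apply: h => //; exact/Gx/DO.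
(* if no point of D is good, then D is a null set *)
have [[y [Dy Gy]]|noG] := pselect (exists y, D y /\ G y); last first.
  apply: le_trans rhs0.
  apply: (@le_trans _ _ (\int[mu]_(x in D) (cst 0%E) x)%E); last by rewrite integral0.
  apply: (ae_ge0_le_integral mD).
  - by move=> x /DO Ox; rewrite lee_fin (Phi_ge0 hphi Ox)// ltW.
  - by apply: mphi => //; exact: ltW.
  - by move=> x _; exact: lexx.
  - exact: measurable_cst.
  - by apply: aeD => x Dx Gx; exfalso; apply: noG; exists x.
have kr1 : 1 <= k / r by rewrite ler_pdivlMr// mul1r.
have Py := good_Phi gp Gy.
have phiyb : phi y b <= 1.
  by rewrite -lee_fin (le_trans _ phib)//; apply: ereal_sup_ubound; exists y => //; exact: DO.
(* (4 r)^n bounds the measure of the ball of radius 2 r, and k is chosen so that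
   L (k / b)^n < 4^-n *)
have small : phi y (k / r) < ((4 * r) ^+ n)^-1.
  have e : k / r = (k / r / b) * b by rewrite mulfVK// gt_eqF.
  have krb : 1 <= k / r / b.
    by rewrite ler_pdivlMr// mul1r (le_trans (ltW b1)).
  rewrite e; apply: le_lt_trans (Phi_at_scale Py krb (ltW b0)) _.
  apply: (@le_lt_trans _ _ (L * (k / r / b) ^+ n)).
    rewrite -[leRHS]mulr1; apply: ler_pM => //.
    - by rewrite mulr_ge0 ?powR_ge0// ltW.
    - by apply: (Phi_at_ge0 Py); exact: ltW.
    - rewrite ler_pM2l// -powR_mulrn; last by rewrite (le_trans _ krb).
      exact: ler_powR.
  have -> : k / r / b = (2 * L)^-1 * (4 * r)^-1.
    by rewrite /k; field; rewrite !gt_eqF.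
  rewrite exprMn !exprVn mulrA -[ltRHS]mul1r ltr_pM2r; last first.
    by rewrite invr_gt0 exprn_gt0// mulr_gt0.
  rewrite ltr_pdivrMr ?exprn_gt0 ?mulr_gt0// mul1r.
  apply: (@lt_le_trans _ _ (2 * L)); first by rewrite ltr_pMl//; lra.
  by rewrite -[leLHS]expr1; apply: ler_weXn2l => //; lra.
pose S := eball c (2 * r).
have tauP : (((4 * r) ^+ n)^-1%:E <= (mu S)^-1)%E.
  have : (mu S <= ((4 * r) ^+ n)%:E)%E.
    have := @leb_eball_le R n c (2 * r) (ltW (mulr_gt0 (ltr0n _ 2) r0)).
    by rewrite mulrA -natrM.
  have : (0 <= mu S)%E by exact: measure_ge0.
  case: (mu S) => [m| |]//=; rewrite !lee_fin inver => m0 mr; case: eqP => [_|/eqP m00].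
    by rewrite leey.
  rewrite lee_fin lef_pV2 ?posrE ?exprn_gt0 ?mulr_gt0//.
  by rewrite lt_neqAle eq_sym m00.
have inv_ge : ((k / r)%:E <= Phi_inf_inv phi (S `&` Omega) (mu S)^-1)%E.
  apply: le_ereal_inf_tmp => _ [s [s0 sP] <-]; rewrite lee_fin leNgt.
  apply/negP => skr.
  have : ((mu S)^-1 <= (phi y (k / r))%:E)%E.
    apply: (le_trans sP); apply: (@le_trans _ _ (phi y s)%:E).
      by apply: ereal_inf_lbound; exists y.
    by rewrite lee_fin; apply: (Phi_at_le Py) => //; exact: ltW.
  by move=> /(le_trans tauP); rewrite lee_fin leNgt small.
have := hA1 c (2 * r) (mulr_gt0 (ltr0n _ 2) r0).
move=> /(_ (le_trans _ inv_ge)); rewrite lee_fin => /(_ kr1 (k / r) kr1 inv_ge).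
rewrite -/S -/D => supinf.
pose m := fine (Phi_inf phi D (k / r)).
have kr0 : 0 <= k / r by rewrite (le_trans _ kr1).
have infE : Phi_inf phi D (k / r) = m%:E.
  rewrite /m fineK// ge0_fin_numE.
    apply: (@le_lt_trans _ _ (phi y (k / r))%:E); last exact: ltry.
    by apply: ereal_inf_lbound; exists y.
  by apply: le_ereal_inf_tmp => _ [x /DO Ox <-]; rewrite lee_fin (Phi_ge0 hphi Ox).
have m0 : 0 <= m.
  rewrite -lee_fin -infE.
  by apply: le_ereal_inf_tmp => _ [x /DO Ox <-]; rewrite lee_fin (Phi_ge0 hphi Ox).
have up x : D x -> G x -> phi x r^-1 <= C1 * m.
  move=> Dx Gx; have Px := good_Phi gp Gx.
  have -> : r^-1 = (b' * k)^-1 * (b' * (k / r)) by field; rewrite !gt_eqF.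
  have bk1 : 1 <= (b' * k)^-1.
    have bk0 : 0 < b' * k by rewrite mulr_gt0.
    by rewrite invf_ge1//; apply: mulr_ile1 => //; exact: ltW.
  apply: (le_trans (Phi_at_scale Px bk1 _)); first by rewrite mulr_ge0// ltW.
  rewrite ler_wpM2l// -lee_fin -infE; apply: le_trans supinf.
  by apply: ereal_sup_ubound; exists x.
have lo x : D x -> G x -> m <= phi x r^-1.
  move=> Dx Gx; apply: (@le_trans _ _ (phi x (k / r))).
    by rewrite -lee_fin -infE; apply: ereal_inf_lbound; exists x.
  by apply: (Phi_at_le (good_Phi gp Gx)) => //; rewrite ler_piMl// ltW.
apply: (@le_trans _ _ (\int[mu]_(x in D) (cst (C1 * m)%:E x))%E).
  apply: (ae_ge0_le_integral mD).
  - by move=> x /DO Ox; rewrite lee_fin (Phi_ge0 hphi Ox)// ltW.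
  - by apply: mphi => //; exact: ltW.
  - by move=> x _; rewrite lee_fin mulr_ge0.
  - exact: measurable_cst.
  - by apply: aeD => x Dx Gx; rewrite lee_fin up.
rewrite (integral_cst _ mD).
apply: (@le_trans _ _ ((C1 * m)%:E * ((2 ^+ n)%:E * mu (eball c r)))%E).
  apply: lee_wpmul2l; first by rewrite lee_fin mulr_ge0.
  apply: le_trans (leb_eball_double c r).
  by apply: le_lebesgue_outer; exact: subIsetl.
rewrite muleA -EFinM mulrAC EFinM -muleA; apply: lee_wpmul2l.
  by rewrite lee_fin mulr_ge0// exprn_ge0.
rewrite -(integral_cst _ mB).
apply: (ae_ge0_le_integral mB).
- by move=> x _; rewrite lee_fin.
- exact: measurable_cst.
- by move=> x /BO Ox; rewrite lee_fin (Phi_ge0 hphi Ox)// ltW.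
- by apply: mphi => //; exact: ltW.
- by apply: ae_imp ae_good => x Gx Bx; rewrite lee_fin lo//; [exact: BD|exact/Gx/BO].
Qed.

End with_good_points.
End setting.

(** * Coverings and small balls *)

Section hausdorff.
Variables (R : realType) (n : nat).
Local Notation V := 'rV[R]_n.
Local Notation mu := (leb R n).

Lemma Hausdorff_phi_delta_le (Omega : set V) (phi : V -> R -> R) (E : set V) (d d' : R) :
  d' <= d ->
  (Hausdorff_phi_delta Omega phi E d <= Hausdorff_phi_delta Omega phi E d')%E.
Proof.
move=> dd'; apply: ereal_inf_le_tmp => _ [J [c [r [Jr Ec ->]]]].
exists J, c, r; split => // j /Jr [/andP[r0 rd] O]; split => //.
by rewrite r0 (le_trans rd).
Qed.

(** The contents increase as delta decreases, so the limit is a supremum. *)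
Lemma Hausdorff_phi_delta_le_lim (Omega : set V) (phi : V -> R -> R) (E : set V) (d : R) :
  0 < d -> (Hausdorff_phi_delta Omega phi E d <= Hausdorff_phi Omega phi E)%E.
Proof.
move=> d0; have d0' : (BRight (0 : R) < BRight d)%O by rewrite bnd_simp.
have h := @nonincreasing_at_right_cvge R (Hausdorff_phi_delta Omega phi E) 0 _ d0'
  (fun x y _ _ => @Hausdorff_phi_delta_le Omega phi E y x).
rewrite /Hausdorff_phi (cvg_lim (@ereal_hausdorff R) h).
apply: ereal_sup_ubound; exists d => //.
by rewrite /= in_itv/= d0 lexx.
Qed.

(** One bound M serves all radii d, because the contents are below their limit;
    compactness makes the cover finite, as the construction of a smooth maximum
    requires.  Radii of indices outside the list are set to 1,
    which keeps the functions phi(x,1/r_j) measurable for every index. *)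
Lemma Hausdorff_finite_cover (Omega : set V) (phi : V -> R -> R) (E : set V) :
  (forall x s, Omega x -> 0 <= s -> 0 <= phi x s) ->
  (Hausdorff_phi Omega phi E < +oo)%E ->
  exists2 M : R, 0 <= M & forall (d : R) (K : set V), 0 < d -> compact K -> K `<=` E ->
    exists (s : seq nat) (c : nat -> V) (r : nat -> R),
    [/\ forall j, 0 < r j,
        forall j, j \in s -> r j <= d /\ eball (c j) (r j) `<=` Omega,
        forall x, K x -> exists2 j, j \in s & eball (c j) (r j) x &
        (\sum_(j <- s) h_phi phi (c j) (r j) <= M%:E)%E].
Proof.
move=> phi0 HE; set H := Hausdorff_phi Omega phi E in HE.
have h0 (c : V) (r : R) : 0 < r -> eball c r `<=` Omega -> (0 <= h_phi phi c r)%E.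
  move=> r0 BO; apply: integral_ge0 => x /BO Ox.
  by rewrite lee_fin phi0// invr_ge0 ltW.
have Hd0 d : (0 <= Hausdorff_phi_delta Omega phi E d)%E.
  apply: le_ereal_inf_tmp => _ [J [c [r [Jr _ ->]]]].
  by apply: esum_ge0 => j /Jr [/andP[r0 _] O]; exact: h0.
have H0 : (0 <= H)%E by exact: le_trans (Hausdorff_phi_delta_le_lim _ _ _ (@ltr01 R)).
have Hfin : H \is a fin_num by rewrite ge0_fin_numE.
exists (fine H + 1); first by rewrite addr_ge0// fine_ge0.
move=> d K d0 cK KE.
have : (Hausdorff_phi_delta Omega phi E d < (fine H + 1)%:E)%E.
  apply: le_lt_trans (Hausdorff_phi_delta_le_lim _ _ _ d0) _.
  by rewrite EFinD fineK// lteDl// lte_fin.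
move=> /ereal_inf_lt [_ [J [c [r [Jr Ec ->]]]] lt].
move: cK; rewrite compact_cover => /(_ _ J (fun j => eball (c j) (r j))).
move=> [j _|x /KE/Ec//|s sJ Ks]; first exact: open_eball.
have sr j : j \in s -> [/\ 0 < r j, r j <= d & eball (c j) (r j) `<=` Omega].
  by move=> js; have /Jr[/andP[? ?] ?] : J j by have := sJ j js; rewrite in_setE.
pose r' j := if j \in s then r j else 1.
have r'E j : j \in s -> r' j = r j by rewrite /r' => ->.
exists s, c, r'; split.
- by move=> j; rewrite /r'; case: ifPn => // /sr[].
- by move=> j js; rewrite r'E//; have [] := sr j js.
- by move=> x /Ks [j /= js xj]; exists j => //; rewrite r'E.
apply: le_trans (ltW lt).
rewrite big_seq (eq_bigr (fun j => h_phi phi (c j) (r j))); last first.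
  by move=> j js; rewrite r'E.
rewrite -big_seq; apply: ereal_sup_ubound; exists [set` s].
  split; first exact: finite_fset.
  by move=> j /= js; have := sJ j js; rewrite in_setE.
by rewrite fsbig_finite//= set_fsetK.
Qed.

End hausdorff.

Section estimates.
Variables (R : realType) (n : nat).
Local Notation V := 'rV[R]_n.
Local Notation mu := (leb R n).
Variables (Omega : set V) (phi : V -> R -> R) (p q L c1 : R) (A : V -> V -> V)
  (G : set V).
Hypotheses (mO : measurable (Omega : set (leb_space R n)))
  (bO : (mu Omega < +oo)%E)
  (L1 : 1 <= L) (q0 : 0 <= q)
  (hphi : convex_Phi Omega phi) (gp : good_points Omega phi p q L c1 A G).

Lemma measurable_Phi_cst (U : set V) (s : R) : 0 <= s -> U `<=` Omega ->
  measurable_fun (U : set (leb_space R n)) (fun x : leb_space R n => (phi x s)%:E).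
Proof.
move=> s0 UO; apply/measurable_EFinP.
exact: measurable_funS mO UO (Phi_measurable hphi s0).
Qed.

Lemma ae_on (D : set V) (P : V -> Prop) : D `<=` Omega ->
  (forall x, D x -> G x -> P x) -> {ae mu, forall x : leb_space R n, D x -> P x}.
Proof. by move=> DO h; apply: ae_imp (ae_good mO gp) => x Gx Dx; apply: h => //; exact/Gx/DO. Qed.

(** phi(x,s)/s is almost increasing, and (A0) bounds phi(x,1/b) from below by 1. *)
Lemma leb_ball_le_h_phi (b : R) : 0 < b -> (1 <= Phi_inf phi Omega b^-1)%E ->
  forall c r, 0 < r -> r <= b -> eball c r `<=` Omega ->
  (mu (eball c r) <= (L * r / b)%:E * h_phi phi c r)%E.
Proof.
move=> b0 hb c r r0 rb BO; have L0 : 0 < L by exact: lt_le_trans L1.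
have rV0 : 0 <= r^-1 by rewrite invr_ge0 ltW.
have mB : measurable (eball c r : set (leb_space R n)) by exact: eball_measurable.
have k0 : 0 <= b / L * r^-1 by rewrite mulr_ge0// divr_ge0// ltW.
have : (\int[mu]_(x in eball c r) (cst (b / L * r^-1)%:E x) <= h_phi phi c r)%E.
  apply: (ae_ge0_le_integral mB).
  - by move=> x _; rewrite lee_fin.
  - exact: measurable_cst.
  - by move=> x /BO Ox; rewrite lee_fin (Phi_ge0 hphi Ox).
  - exact: measurable_Phi_cst.
  - apply: ae_on => // x /BO Ox Gx; rewrite lee_fin.
    have Ox' : 1 <= phi x b^-1.
      by rewrite -lee_fin (le_trans hb)//; apply: ereal_inf_lbound; exists x.
    have rb' : b^-1 <= r^-1 by rewrite lef_pV2 ?posrE.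
    exact: (Phi_at_ge_large L1 (good_Phi gp Gx)).
rewrite integral_cst// => h.
have -> : mu (eball c r) = ((L * r / b)%:E * ((b / L * r^-1)%:E * mu (eball c r)))%E.
  rewrite muleA -EFinM (_ : L * r / b * (b / L / r) = 1) ?mul1e//.
  by field; rewrite !gt_eqF.
apply: lee_wpmul2l => //.
by rewrite lee_fin divr_ge0 ?mulr_ge0// ltW.
Qed.

(** (A0) and (aDec)_q bound phi(x,.) on bounded intervals, uniformly in x. *)
Lemma integral_Phi_bounded_lty (b M : R) (D : set V) (f : V -> R) : 0 < b ->
  (Phi_sup phi Omega b <= 1)%E -> D `<=` Omega ->
  measurable (D : set (leb_space R n)) -> leb_measurable_fun D f ->
  (forall x, 0 <= f x <= M) ->
  (\int[mu]_(x in D) (phi x (f x))%:E < +oo)%E.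
Proof.
move=> b0 hb DO mD mf fM.
have f0 x : 0 <= f x by have /andP[] := fM x.
have M0 : 0 <= M by have /andP[h1 h2] := fM 0; exact: le_trans h2.
pose C := L * (1 + M / b) `^ q.
have C0 : 0 <= C by rewrite mulr_ge0 ?powR_ge0// (le_trans _ L1).
apply: (@le_lt_trans _ _ (\int[mu]_(x in D) (cst C%:E x))%E).
  apply: (ae_ge0_le_integral mD).
  - by move=> x /DO Ox; rewrite lee_fin (Phi_ge0 hphi Ox).
  - by apply/measurable_EFinP; exact: (measurable_Phi_comp mO hphi gp).
  - by move=> x _; rewrite lee_fin.
  - exact: measurable_cst.
  - apply: ae_on => // x /DO Ox Gx; rewrite lee_fin.
    have Px := good_Phi gp Gx; have /andP[_ fxM] := fM x.
    apply: (le_trans (Phi_at_le Px (f0 x) fxM)).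
    apply: (Phi_at_le_large L1 Px) => //.
    by rewrite -lee_fin (le_trans _ hb)//; apply: ereal_sup_ubound; exists x.
rewrite integral_cst// lte_mul_pinfty// ?lee_fin//.
by apply: le_lt_trans bO; exact: le_lebesgue_outer.
Qed.

End estimates.

(** * The flux of a solution *)

Section weak_solutions.
Variables (R : realType) (n : nat).
Local Notation V := 'rV[R]_n.
Local Notation mu := (leb R n).
Variables (Omega : set V) (phi : V -> R -> R) (p q L c1 b : R) (A : V -> V -> V)
  (G : set V) (Du : V -> V).
Hypotheses (mO : measurable (Omega : set (leb_space R n)))
  (bO : (mu Omega < +oo)%E)
  (n0 : (0 < n)%N) (p1 : 1 < p) (L1 : 1 <= L) (q0 : 0 <= q) (c10 : 0 < c1)
  (hphi : convex_Phi Omega phi) (gp : good_points Omega phi p q L c1 A G)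
  (b0 : 0 < b) (phib : (Phi_sup phi Omega b <= 1)%E).

Lemma lux_norm_eq0 (U : set V) (f : V -> R) (e : R) : U `<=` Omega ->
  measurable (U : set (leb_space R n)) -> 0 < e ->
  (forall x, f x = 0) -> (lux_norm phi U f <= e%:E)%E.
Proof.
move=> UO mU e0 f0; apply: ereal_inf_lbound; exists e => //; split => //.
apply: (@le_trans _ _ (\int[mu]_(x in U) (cst 0%E) x)%E); last first.
  by rewrite integral0.
apply: ae_ge0_le_integral => //.
- by move=> x /UO Ox; rewrite f0 normr0 mul0r lee_fin (Phi_ge0 hphi Ox).
- under eq_fun do rewrite f0 normr0 mul0r; exact: (measurable_Phi_cst mO hphi).
- apply: (ae_on mO gp) => // x _ Gx.
  by rewrite f0 normr0 mul0r (Phi_at_0 (good_Phi gp Gx)).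
Qed.

(** A test function is its own approximation, so only membership in the Sobolev
    space is at stake. *)
Lemma test_fun_sobolev_phi0 (U : set V) (w : V -> R) : U `<=` Omega ->
  measurable (U : set (leb_space R n)) -> test_fun U w ->
  sobolev_phi0 phi U w (grad w).
Proof.
move=> UO mU tw; have [sw _ _] := tw.
have [M [r [M0 wM gM wr]]] := test_fun_bounded tw.
split; last first.
  move=> e e0; exists w => //.
  have e3 : 0 < e / 3 by rewrite divr_gt0.
  apply: (@le_lt_trans _ _ ((e / 3)%:E + (e / 3)%:E)%E).
    apply: leeD; apply: lux_norm_eq0 => // x; first by rewrite subrr.
    by rewrite subrr enorm0.
  by rewrite -EFinD lte_fin; lra.
have mc (f : V -> R) : continuous f -> leb_measurable_fun U f.
  by move=> cf; exact: leb_measurable_continuous.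
split.
- split.
  + apply: (integrableS measurableT) => //.
    apply: (@integrable_bounded_support _ _ w M r) => //; first exact: smooth_continuous.
    by move=> x /wr/support0.
  + move=> i; apply: (integrableS measurableT) => //.
    apply: (@integrable_bounded_support _ _ (fun x => grad w x ord0 i) M r).
    * under eq_fun do rewrite mxE; exact/smooth_continuous/smooth_pderiv.
    * by move=> x; exact: le_trans (le_coord_enorm _ _) (gM x).
    * by move=> x /wr/grad_support0 ->; rewrite mxE.
  + by move=> psi tpsi i; exact: test_fun_parts tw tpsi.
- split; first exact/mc/smooth_continuous.
  apply: (integral_Phi_bounded_lty mO bO L1 hphi gp (M := M) b0 phib) => //.
    apply: mc => x; apply: (@continuous_comp _ _ _ w Num.norm).
      exact: smooth_continuous.
    exact: norm_continuous.
  by move=> x; rewrite normr_ge0 wM.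
- split; first by apply: mc; exact: continuous_enorm_grad.
  apply: (integral_Phi_bounded_lty mO bO L1 hphi gp (M := M) b0 phib
    (f := fun x => `|enorm (grad w x)|)) => //.
    apply: mc => x; apply: (@continuous_comp _ _ _ (fun x => enorm (grad w x)) Num.norm).
      exact: continuous_enorm_grad.
    exact: norm_continuous.
  by move=> x; rewrite normr_ge0 ger0_norm ?enorm_ge0// gM.
Qed.

Local Notation F x := (A x (Du x)).
Local Notation g x := (phi x (enorm (Du x))).
Hypotheses (mA : forall z j, leb_measurable_fun Omega (fun x => A x z ord0 j))
  (mDu : forall j, leb_measurable_fun Omega (fun x => Du x ord0 j))
  (LDu : Lphi phi Omega (fun x => enorm (Du x))).

Lemma measurable_energy : measurable_fun (Omega : set (leb_space R n))
  (fun x : leb_space R n => (g x)%:E).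
Proof.
apply/measurable_EFinP; apply: (measurable_Phi_comp mO hphi gp) => //.
  by have [] := LDu.
by move=> x; exact: enorm_ge0.
Qed.

Lemma integral_energy_lty : (\int[mu]_(x in Omega) (g x)%:E < +oo)%E.
Proof.
have [_] := LDu; congr (_ < _)%E; apply: eq_integral => x _.
by rewrite ger0_norm// enorm_ge0.
Qed.

Lemma energy_ge0 x : Omega x -> 0 <= g x.
Proof. by move=> Ox; rewrite (Phi_ge0 hphi Ox)// enorm_ge0. Qed.

Lemma measurable_dotp_flux (D : set V) (z : V -> V) : D `<=` Omega ->
  measurable (D : set (leb_space R n)) ->
  (forall j, leb_measurable_fun D (fun x => z x ord0 j)) ->
  leb_measurable_fun D (fun x => dotp (F x) (z x)).
Proof.
move=> DO mD mz; apply: measurable_sum => j.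
apply: measurable_funM; last exact: mz.
apply: (measurable_funS mO DO).
exact: (measurable_caratheodory_comp mO gp j mA mDu).
Qed.

Lemma flux_young (e K : R) x s : G x -> 1 <= K -> L * K `^ (1 - p) <= e -> 0 <= s ->
  enorm (F x) * s <= c1 * (e * phi x s + K * g x).
Proof.
move=> Gx K1 Ke s0.
exact: (growth_young _ n0 p1 L1 q0 (ltW c10) (good_Phi gp Gx)
  (good_continuous gp Gx) (good_growth gp Gx) K1 Ke s0).
Qed.

Lemma small_energy (e : R) : 0 < e -> exists2 d : R, 0 < d &
  forall X : set V, X `<=` Omega -> measurable (X : set (leb_space R n)) ->
  (mu X < d%:E)%E -> (\int[mu]_(x in X) (g x)%:E < e%:E)%E.
Proof.
move=> e0; pose f : leb_space R n -> R := (fun x : V => g x) \_ Omega.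
have fi : mu.-integrable setT (EFin \o f).
  rewrite (_ : EFin \o f = (fun x : leb_space R n => (g x)%:E) \_ Omega); last first.
    by apply/funext => x; rewrite /f /= !patchE; case: ifP.
  apply/(integrable_mkcond _ mO).1/integrableP; split; first exact: measurable_energy.
  apply: le_lt_trans integral_energy_lty; apply: ge0_le_integral.
  - exact: mO.
  - by move=> x _; exact: abse_ge0.
  - by apply: measurableT_comp; [exact: abse_measurable|exact: measurable_energy].
  - exact: measurable_energy.
  - by move=> x Ox; rewrite /= lee_fin ger0_norm ?energy_ge0.
have [d [d0 dP]] := integral_normr_continuous fi e0; exists d => // X XO mX Xd.
have := dP X mX Xd; rewrite -lte_fin /Rintegral fineK; last first.
  apply: integrable_fin_num => //; apply: (integrableS measurableT) => //.
  exact: integrable_abse fi.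
congr (_ < _)%E; apply: eq_integral => x; rewrite in_setE => /XO Ox.
by rewrite /f patchE mem_set//= ger0_norm// energy_ge0.
Qed.

Lemma Phi_one_le x : G x -> phi x 1 <= L * (1 + 1 / b) `^ q.
Proof.
move=> Gx; apply: (Phi_at_le_large L1 (good_Phi gp Gx)) => //.
rewrite -lee_fin (le_trans _ phib)//; apply: ereal_sup_ubound; exists x => //.
exact: (good_sub gp).
Qed.

Lemma integrable_of_flux_le (D : set V) (z : V -> V) (h : V -> R) :
  D `<=` Omega -> measurable (D : set (leb_space R n)) ->
  (forall j, leb_measurable_fun D (fun x => z x ord0 j)) ->
  (forall x, D x -> 0 <= h x) ->
  measurable_fun (D : set (leb_space R n)) (fun x : leb_space R n => (h x)%:E) ->
  (forall x, D x -> G x -> `|dotp (F x) (z x)| <= h x) ->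
  (\int[mu]_(x in D) `|(dotp (F x) (z x))%:E| <= \int[mu]_(x in D) (h x)%:E)%E.
Proof.
move=> DO mD mz h0 mh zh; apply: ae_ge0_le_integral.
- exact: mD.
- by move=> x _; exact: abse_ge0.
- apply: measurableT_comp; first exact: abse_measurable.
  by apply/measurable_EFinP; exact: measurable_dotp_flux.
- by move=> x Dx; rewrite lee_fin h0.
- exact: mh.
- by apply: (ae_on mO gp DO) => x Dx Gx; rewrite lee_fin zh.
Qed.

Lemma integral_bound_lty (a1 a2 : R) : 0 <= a1 -> 0 <= a2 ->
  (\int[mu]_(x in Omega) (a1 + a2 * g x)%:E < +oo)%E.
Proof.
move=> a10 a20; under eq_integral do rewrite EFinD EFinM.
have mg : measurable_fun (Omega : set (leb_space R n)) (fun x : leb_space R n => a2%:E * (g x)%:E)%E.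
  by apply: measurable_funeM; exact: measurable_energy.
rewrite (ge0_integralD _ mO (f1 := fun=> a1%:E) _ (measurable_cst _) _ mg); last 2 first.
- by move=> x _; rewrite lee_fin.
- by move=> x Ox; rewrite -EFinM lee_fin mulr_ge0// energy_ge0.
rewrite (integral_cst _ mO) (ge0_integralZl_EFin _ mO _ measurable_energy a20); last first.
  by move=> x Ox; rewrite lee_fin energy_ge0.
apply: lte_add_pinfty; apply: lte_mul_pinfty; rewrite ?lee_fin//.
exact: integral_energy_lty.
Qed.

Lemma integrable_flux (z : V -> V) (P : R) :
  (forall j, leb_measurable_fun Omega (fun x => z x ord0 j)) ->
  (forall x, enorm (z x) <= P) ->
  mu.-integrable Omega (fun x : leb_space R n => (dotp (F x) (z x))%:E).
Proof.
move=> mz zP; have [K K1 Ke] := young_const p1 L1 (@ltr01 R).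
have P0 : 0 <= P by exact: le_trans (enorm_ge0 _) (zP 0).
pose C := L * (1 + 1 / b) `^ q.
have C0 : 0 <= C by rewrite mulr_ge0 ?powR_ge0// (le_trans _ L1).
have K0 : 0 <= K by exact: le_trans K1.
apply/integrableP; split.
  by apply/measurable_EFinP; exact: measurable_dotp_flux.
pose h x := (P * c1 * C) + (P * c1 * K) * g x.
have Pc0 : 0 <= P * c1 by rewrite mulr_ge0// ltW.
apply: (@le_lt_trans _ _ (\int[mu]_(x in Omega) (h x)%:E)%E); last first.
  by apply: integral_bound_lty; rewrite mulr_ge0.
apply: integrable_of_flux_le => //.
- move=> x Ox; have gx := energy_ge0 Ox.
  by apply: addr_ge0; first exact: mulr_ge0; apply: mulr_ge0 => //; exact: mulr_ge0.
- apply/measurable_EFinP; apply: measurable_funD; first exact: measurable_cst.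
  apply: measurable_funM; first exact: measurable_cst.
  by apply/measurable_EFinP; exact: measurable_energy.
move=> x Ox Gx; apply: (le_trans (norm_dotp_le _ _)).
have Fx : enorm (F x) <= c1 * (C + K * g x).
  have := flux_young Gx K1 Ke ler01; rewrite mulr1 mul1r => /le_trans; apply.
  by rewrite ler_wpM2l ?(ltW c10)// lerD2r Phi_one_le.
rewrite /h (_ : _ + _ = c1 * (C + K * g x) * P); last by ring.
by apply: ler_pM => //; exact: enorm_ge0.
Qed.

Lemma abse_le_eq0 (I : \bar R) :
  (forall e, 0 < e -> (`|I| <= e%:E)%E) -> I = 0%E.
Proof.
move=> h; apply/eqP; rewrite -abse_eq0 eq_le abse_ge0 andbT.
by apply/lee_addgt0Pr => e e0; rewrite add0e; exact: h.
Qed.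

Lemma leb_balls_le (s : seq nat) (c : nat -> V) (r : nat -> R) :
  (lebesgue_outer [set x | exists2 j, j \in s & eball (c j) (2 * r j) x] <=
   (2 ^+ n)%:E * \sum_(j <- s) mu (eball (c j) (r j)))%E.
Proof.
elim: s => [|i s IH].
  rewrite big_nil mule0 (_ : [set x | _] = set0) ?lebesgue_outer0//.
  by apply/seteqP; split=> // x [].
rewrite big_cons ge0_muleDr ?sume_ge0//.
apply: (@le_trans _ _ (lebesgue_outer (eball (c i) (2 * r i) `|`
    [set x | exists2 j, j \in s & eball (c j) (2 * r j) x]))).
  apply: le_lebesgue_outer => x [j]; rewrite inE => /predU1P[->|js] xj; first by left.
  by right; exists j.
apply: (le_trans (outer_measureU2 _ _ _)); apply: leeD => //.
exact: leb_eball_double.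
Qed.

(** Off X both eta and its gradient vanish.  On X the value phi(x,|grad eta|) is
    charged to a single ball, on which the gradient of eta is at most C2 / r_j. *)
Lemma flux_cutoff_bound (psi eta : V -> R) (P C2 e K1 K : R) (s : seq nat)
    (c : nat -> V) (r : nat -> R) (x : V) :
  let X := [set y | exists2 j, j \in s & eball (c j) (2 * r j) y] in
  let C1 := L * (1 + 1 / b) `^ q in
  G x -> 0 <= P -> 1 <= C2 -> 0 <= e -> 1 <= K1 -> L * K1 `^ (1 - p) <= 1 ->
  1 <= K -> L * K `^ (1 - p) <= e -> (forall j, 0 < r j) ->
  `|psi x| <= P -> enorm (grad psi x) <= P -> 0 <= eta x <= 1 ->
  (~ X x -> eta x = 0) ->
  (grad eta x = 0 \/ exists2 j, j \in s &
     eball (c j) (2 * r j) x /\ enorm (grad eta x) <= C2 / r j) ->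
  ((`|eta x * dotp (F x) (grad psi x) + psi x * dotp (F x) (grad eta x)|)%:E <=
   ((fun=> (P * c1 * C1)%:E) \_ X) x +
   (((fun y => ((P * c1 * (K1 + K)) * g y)%:E) \_ X) x +
   \sum_(j <- s) ((fun y => ((P * c1 * e * (L * C2 `^ q)) * phi y (r j)^-1)%:E) \_
      (eball (c j) (2 * r j))) x))%E.
Proof.
move=> X C1 Gx P0 C21 e0 K11 K1e K_1 Ke r0 psiP gpsiP /andP[eta0 eta1] etaX geta.
have Ox := good_sub gp Gx; have Px := good_Phi gp Gx.
have C10 : 0 <= C1 by rewrite mulr_ge0 ?powR_ge0// (le_trans _ L1).
have C20 : 0 <= C2 by exact: le_trans C21.
have a20 : 0 <= P * c1 * e * (L * C2 `^ q).
  rewrite mulr_ge0 ?(mulr_ge0 (mulr_ge0 _ (ltW c10)))// mulr_ge0 ?powR_ge0//.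
  exact: le_trans L1.
have Pc0 : 0 <= P * c1 by rewrite mulr_ge0// ltW.
have f30 j : (0 <= ((fun y => ((P * c1 * e * (L * C2 `^ q)) * phi y (r j)^-1)%:E) \_
      (eball (c j) (2 * r j))) x)%E.
  rewrite patchE; case: ifP => // _.
  by rewrite lee_fin mulr_ge0// (Phi_ge0 hphi Ox)// invr_ge0 ltW.
have [Xx|nXx] := pselect (X x); last first.
  have g0 : grad eta x = 0.
    by case: geta => // -[j js [xj _]]; exfalso; apply: nXx; exists j.
  rewrite (etaX nXx) g0 dotp0r mul0r mulr0 addr0 normr0.
  by rewrite !patchE memNset// !add0e sume_ge0.
rewrite !patchE mem_set//.
have Fx : enorm (F x) <= c1 * (C1 + K1 * g x).
  have := flux_young Gx K11 K1e ler01; rewrite mulr1 mul1r => /le_trans; apply.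
  by rewrite ler_wpM2l ?(ltW c10)// lerD2r Phi_one_le.
have Fg := flux_young Gx K_1 Ke (enorm_ge0 (grad eta x)).
have phig : ((P * c1 * e * phi x (enorm (grad eta x)))%:E <=
    \sum_(j <- s) ((fun y => ((P * c1 * e * (L * C2 `^ q)) * phi y (r j)^-1)%:E) \_
      (eball (c j) (2 * r j))) x)%E.
  case: geta => [->|[j js [xj gj]]].
    by rewrite enorm0 (Phi_at_0 Px) mulr0 sume_ge0.
  rewrite (big_rem j)//= patchE mem_set//.
  apply: le_trans (leeDl _ _); last exact: sume_ge0.
  rewrite lee_fin -[leRHS]mulrA; apply: ler_wpM2l; first by rewrite !mulr_ge0// ltW.
  apply: (le_trans (Phi_at_le Px (enorm_ge0 _) gj)).
  by apply: (Phi_at_scale Px) => //; rewrite invr_ge0 ltW.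
apply: le_trans (leeD2l _ (leeD2l _ phig)).
rewrite -!EFinD lee_fin.
apply: (@le_trans _ _ (P * enorm (F x) + P * (enorm (F x) * enorm (grad eta x)))).
  apply: (le_trans (ler_normD _ _)); apply: lerD; rewrite normrM.
    rewrite ger0_norm// -[leRHS]mul1r; apply: ler_pM => //.
    apply: (le_trans (norm_dotp_le _ _)); rewrite mulrC.
    by apply: ler_wpM2r => //; exact: enorm_ge0.
  by apply: ler_pM => //; exact: norm_dotp_le.
apply: (@le_trans _ _ (P * (c1 * (C1 + K1 * g x)) +
    P * (c1 * (e * phi x (enorm (grad eta x)) + K * g x)))).
  by apply: lerD; apply: ler_wpM2l.
by rewrite le_eqVlt; apply/orP; left; apply/eqP; ring.
Qed.

(** Each ball contributes its own term, which makes the bound insensitive to the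
    overlap of the balls: only the sum of their contents enters. *)
Lemma integral_flux_cutoff_bound (a0 a1 a2 C M : R) (s : seq nat)
    (c : nat -> V) (r : nat -> R) :
  let X := [set y | exists2 j, j \in s & eball (c j) (2 * r j) y] in
  0 <= a0 -> 0 <= a1 -> 0 <= a2 -> 0 <= C -> (forall j, 0 < r j) ->
  (forall j, j \in s -> eball (c j) (r j) `<=` Omega) ->
  (forall j, j \in s ->
     (\int[mu]_(x in eball (c j) (2 * r j) `&` Omega) (phi x (r j)^-1)%:E <=
      C%:E * h_phi phi (c j) (r j))%E) ->
  (\sum_(j <- s) h_phi phi (c j) (r j) <= M%:E)%E ->
  measurable_fun (Omega : set (leb_space R n)) (fun x : leb_space R n =>
    ((fun=> a0%:E) \_ X) x + (((fun y => (a1 * g y)%:E) \_ X) x +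
    \sum_(j <- s) ((fun y => (a2 * phi y (r j)^-1)%:E) \_
      (eball (c j) (2 * r j))) x))%E /\
  (\int[mu]_(x in Omega) (((fun=> a0%:E) \_ X) x +
    (((fun y => (a1 * g y)%:E) \_ X) x +
    \sum_(j <- s) ((fun y => (a2 * phi y (r j)^-1)%:E) \_
      (eball (c j) (2 * r j))) x)) <=
   a0%:E * mu (Omega `&` X) + (a1%:E * \int[mu]_(x in Omega `&` X) (g x)%:E +
   (a2 * C * M)%:E))%E.
Proof.
move=> X a00 a10 a20 C0 r0 BO dbl hM.
have mX : measurable (X : set (leb_space R n)).
  rewrite [Y in measurable Y](_ : _ =
      \bigcup_(j in [set j | j \in s]) eball (c j) (2 * r j)).
    by apply: bigcup_measurable => j _; exact: eball_measurable.
  by apply/seteqP; split=> x [j ? ?]; exists j.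
have mOX : measurable (Omega `&` X : set (leb_space R n)) by exact: measurableI.
have OXO : Omega `&` X `<=` Omega by exact: subIsetl.
have rV j : 0 <= (r j)^-1 by rewrite invr_ge0 ltW.
have m1 : measurable_fun (Omega : set (leb_space R n)) ((fun=> a0%:E) \_ X).
  by apply/(measurable_restrict _ mX mO).1; exact: measurable_cst.
have mg (Y : set V) : measurable_fun (Omega `&` Y : set (leb_space R n))
    (fun x : leb_space R n => (g x)%:E).
  exact: (measurable_funS mO (@subIsetl _ Omega Y) measurable_energy).
have m2 : measurable_fun (Omega : set (leb_space R n)) ((fun y => (a1 * g y)%:E) \_ X).
  apply/(measurable_restrict _ mX mO).1.
  under eq_fun do rewrite EFinM.
  by apply: measurable_funeM; exact: mg.
have m3 j : measurable_fun (Omega : set (leb_space R n))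
    ((fun y => (a2 * phi y (r j)^-1)%:E) \_ (eball (c j) (2 * r j))).
  apply/(measurable_restrict _ (eball_measurable _ _) mO).1.
  under eq_fun do rewrite EFinM; apply: measurable_funeM.
  by apply: (measurable_Phi_cst mO hphi); [exact: rV|exact: subIsetl].
have p1' x : Omega x -> (0 <= ((fun=> a0%:E) \_ X) x)%E.
  by move=> Ox; rewrite patchE; case: ifP => // _; rewrite lee_fin.
have p2 x : Omega x -> (0 <= ((fun y => (a1 * g y)%:E) \_ X) x)%E.
  move=> Ox; rewrite patchE; case: ifP => // _.
  by rewrite lee_fin mulr_ge0// energy_ge0.
have p3 j x : Omega x -> (0 <= ((fun y => (a2 * phi y (r j)^-1)%:E) \_
    (eball (c j) (2 * r j))) x)%E.
  move=> Ox; rewrite patchE; case: ifP => // _.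
  by rewrite lee_fin mulr_ge0// (Phi_ge0 hphi Ox).
have m3s : measurable_fun (Omega : set (leb_space R n)) (fun x : leb_space R n =>
    \sum_(j <- s) ((fun y => (a2 * phi y (r j)^-1)%:E) \_
      (eball (c j) (2 * r j))) x)%E.
  exact: emeasurable_sum.
have p3s x : Omega x -> (0 <= \sum_(j <- s) ((fun y => (a2 * phi y (r j)^-1)%:E) \_
      (eball (c j) (2 * r j))) x)%E.
  by move=> Ox; apply: sume_ge0 => j _; exact: p3.
have m23 := emeasurable_funD m2 m3s.
split; first exact: emeasurable_funD m1 m23.
rewrite (ge0_integralD _ mO p1' m1 (fun x Ox => adde_ge0 (p2 x Ox) (p3s x Ox)) m23).
rewrite (ge0_integralD _ mO p2 m2 p3s m3s) (ge0_integral_sum _ mO m3 p3).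
rewrite -integral_mkcondr (integral_cst _ mOX); apply: leeD2l.
rewrite -integral_mkcondr; under eq_integral do rewrite EFinM.
rewrite (ge0_integralZl_EFin _ mOX _ (mg X) a10); last first.
  by move=> x [Ox _]; rewrite lee_fin energy_ge0.
apply: leeD2l.
apply: (@le_trans _ _ (\sum_(j <- s) ((a2 * C)%:E * h_phi phi (c j) (r j)))%E).
  rewrite big_seq [leRHS]big_seq; apply: lee_sum => j js.
  rewrite -integral_mkcondr setIC; under eq_integral do rewrite EFinM.
  have mBO : measurable (eball (c j) (2 * r j) `&` Omega : set (leb_space R n)).
    by apply: measurableI; [exact: eball_measurable|exact: mO].
  have mphi := measurable_Phi_cst mO hphi (rV j) (@subIsetr _ (eball (c j) (2 * r j)) Omega).
  rewrite (ge0_integralZl_EFin _ mBO _ mphi a20); last first.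
    by move=> x [_ Ox]; rewrite lee_fin (Phi_ge0 hphi Ox).
  by rewrite EFinM -muleA; apply: lee_wpmul2l; [rewrite lee_fin|exact: dbl].
have h0 j : j \in s -> (0 <= h_phi phi (c j) (r j))%E.
  move=> js; apply: integral_ge0 => x /(BO j js) Ox.
  by rewrite lee_fin (Phi_ge0 hphi Ox).
rewrite big_seq -ge0_sume_distrr; last exact: h0.
rewrite -big_seq [leRHS]EFinM; apply: lee_wpmul2l; last exact: hM.
by rewrite lee_fin mulr_ge0.
Qed.

(** w = psi (1 - eta) is admissible off E, so the integral for psi is the integral
    of the defect psi eta, which is as small as desired. *)
Lemma test_fun_solution (E : set V) (C k : R) (psi : V -> R) :
  relatively_closed Omega E -> (Hausdorff_phi Omega phi E < +oo)%E ->
  (1 <= Phi_inf phi Omega b^-1)%E -> 0 <= C -> 0 < k ->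
  (forall c r, 0 < r -> r <= k -> eball c r `<=` Omega ->
    (\int[mu]_(x in eball c (2 * r) `&` Omega) (phi x r^-1)%:E <=
     C%:E * h_phi phi c r)%E) ->
  solves_on phi A (Omega `\` E) Du -> test_fun Omega psi ->
  (\int[mu]_(x in Omega) (dotp (F x) (grad psi x))%:E = 0)%E.
Proof.
move=> [Fc cF EF] hHE hb C0 k0 dbl hsol tpsi; have [spsi cK KO] := tpsi.
set K := closure _ in cK KO.
have [P [rP [P0 psiP gP _]]] := test_fun_bounded tpsi.
have [M M0 cover] := Hausdorff_finite_cover (fun x s Ox => Phi_ge0 hphi Ox) hHE.
have [C2 C21 cutoff] := cutoff_balls R n.
have mE : measurable (E : set (leb_space R n)).
  rewrite EF; apply: measurableI; first exact: mO.
  rewrite -[X in measurable X]setCK; apply: measurableC.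
  by apply: open_leb_measurable; exact: closed_openC.
have mOE : measurable (Omega `\` E : set (leb_space R n)) by exact: measurableD.
have Pc0 : 0 <= P * c1 by rewrite mulr_ge0// ltW.
have L0 : 0 <= L by exact: le_trans L1.
pose C1 := L * (1 + 1 / b) `^ q.
have C10 : 0 <= C1 by rewrite mulr_ge0 ?powR_ge0.
apply: abse_le_eq0 => e e0; pose e3 := e / 3.
have e30 : 0 < e3 by rewrite divr_gt0.
(* the constants are chosen in this order: eps absorbs the content M of the
   covering, then K2 depends on eps, then the radii are small in terms of K2 *)
pose T := P * c1 * (L * C2 `^ q) * C * M.
have T0 : 0 <= T by rewrite /T; do 2 apply: mulr_ge0 => //; rewrite mulr_ge0// mulr_ge0 ?powR_ge0.
pose eps := e3 / (T + 1).
have eps0 : 0 < eps by rewrite divr_gt0// ltr_wpDl.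
have [K1 K11 K1e] := young_const p1 L1 (@ltr01 R).
have [K2 K21 K2e] := young_const p1 L1 eps0.
pose a0 := P * c1 * C1; pose a1 := P * c1 * (K1 + K2).
pose a2 := P * c1 * eps * (L * C2 `^ q).
have a00 : 0 <= a0 by rewrite mulr_ge0.
have a10 : 0 <= a1 by rewrite mulr_ge0// addr_ge0// (le_trans _ K11, le_trans _ K21).
have a20 : 0 <= a2 by rewrite mulr_ge0 ?(mulr_ge0 Pc0 (ltW eps0))// mulr_ge0 ?powR_ge0.
have [d1 d10 small] := small_energy (divr_gt0 e30 (ltr_wpDl a10 (@ltr01 R))).
pose d := Num.min d1 (e3 / (a0 + 1)).
have d0 : 0 < d by rewrite lt_min d10 divr_gt0// ltr_wpDl.
have M10 : 0 < M + 1 by rewrite ltr_wpDl.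
have L00 : 0 < L by exact: lt_le_trans L1.
pose dl := Num.min (Num.min k b) (d * b / (2 ^+ n * L * (M + 1))).
have dl0 : 0 < dl.
  by rewrite !lt_min k0 b0 divr_gt0 ?mulr_gt0 ?exprn_gt0.
have cKF : compact (K `&` Fc) by exact: compact_closedI.
have KFE : K `&` Fc `<=` E by rewrite EF => x [/KO Ox Fx].
have [s [c [r [r0 rs Kcov hM]]]] := cover dl (K `&` Fc) dl0 cKF KFE.
have rk j : j \in s -> r j <= k.
  by move=> /rs[+ _]; rewrite !le_min => /andP[/andP[-> _] _].
have rb j : j \in s -> r j <= b.
  by move=> /rs[+ _]; rewrite !le_min => /andP[/andP[_ ->] _].
have BO j : j \in s -> eball (c j) (r j) `<=` Omega by move=> /rs[].
have h0 j : j \in s -> (0 <= h_phi phi (c j) (r j))%E.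
  move=> js; apply: integral_ge0 => x /(BO j js) Ox.
  by rewrite lee_fin (Phi_ge0 hphi Ox)// invr_ge0 ltW.
pose X := [set y | exists2 j, j \in s & eball (c j) (2 * r j) y].
have muX : (mu (Omega `&` X) < d%:E)%E.
  apply: (@le_lt_trans _ _ ((2 ^+ n)%:E * \sum_(j <- s) mu (eball (c j) (r j)))%E).
    apply: le_trans (leb_balls_le s c r).
    by apply: le_lebesgue_outer; exact: subIsetr.
  apply: (@le_lt_trans _ _ ((2 ^+ n)%:E * ((L * dl / b)%:E * M%:E))%E).
    apply: lee_wpmul2l; first by rewrite lee_fin exprn_ge0.
    apply: (@le_trans _ _ (\sum_(j <- s) ((L * dl / b)%:E * h_phi phi (c j) (r j)))%E).
      rewrite big_seq [leRHS]big_seq; apply: lee_sum => j js.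
      apply: (le_trans (leb_ball_le_h_phi mO L1 hphi gp b0 hb (r0 j) (rb j js) (BO j js))).
      apply: lee_wpmul2r; first exact: h0.
      rewrite lee_fin ler_pM2r ?invr_gt0// ler_pM2l//.
      by have [] := rs j js.
    rewrite big_seq -ge0_sume_distrr; last exact: h0.
    rewrite -big_seq; apply: lee_wpmul2l; last exact: hM.
    by rewrite lee_fin divr_ge0 ?mulr_ge0// ltW.
  rewrite -!EFinM lte_fin.
  have dlb : dl <= d * b / (2 ^+ n * L * (M + 1)) by rewrite ge_min lexx orbT.
  apply: (@le_lt_trans _ _ (d * (M / (M + 1)))).
    have -> : d * (M / (M + 1)) =
        2 ^+ n * (L * (d * b / (2 ^+ n * L * (M + 1))) / b * M).
      by field; rewrite !gt_eqF// exprn_gt0.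
    rewrite ler_pM2l ?exprn_gt0//; apply: ler_wpM2r => //.
    by rewrite ler_pM2r ?invr_gt0// ler_pM2l.
  by rewrite gtr_pMr// ltr_pdivrMr// mul1r ltrDl.
have [eta [seta eta01 eta1 eta0 geta]] := cutoff s c r (fun j _ => r0 j).
pose w x := psi x * (1 - eta x).
pose U := \bigcup_(j in [set j | j \in s]) eball (c j) (r j).
have wKU : [set x | w x != 0] `<=` K `&` ~` U.
  move=> x /= wx; split.
    by apply: subset_closure; apply: contra_neq wx => psi0; rewrite /w psi0 mul0r.
  by move=> [j /= js xj]; move: wx; rewrite /w (eta1 j x js xj) subrr mulr0 eqxx.
have cKU : closed (K `&` ~` U).
  apply: closedI; first exact: closed_closure.
  by apply: open_closedC; apply: bigcup_open => j _; exact: open_eball.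
have wK : closure [set x | w x != 0] `<=` K `&` ~` U.
  by rewrite (closure_id (K `&` ~` U)).1//; exact: closure_subset.
have tw : test_fun (Omega `\` E) w.
  split; first by apply: smoothM => //; exact: smooth1B.
    apply: (subclosed_compact _ cK); first exact: closed_closure.
    by move=> x /wK[].
  move=> x /wK [Kx nUx]; split; first exact: KO.
  rewrite EF => -[_ Fx]; apply: nUx.
  by have [|j js xj] := Kcov x; [split|exists j].
have twO : test_fun Omega w by have [? ? h] := tw; split => // x /h[].
have gw x : grad w x = (1 - eta x) *: grad psi x - psi x *: grad eta x.
  rewrite grad_mul//; last exact: smooth1B.
  by rewrite grad_1B// scalerN addrC.
have [Pw [rw [Pw0 _ gwP _]]] := test_fun_bounded twO.
have mgrad (f : V -> R) j : smooth f -> leb_measurable_fun Omega (fun x => grad f x ord0 j).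
  move=> sf; apply: leb_measurable_continuous => //.
  under eq_fun do rewrite mxE; exact/smooth_continuous/smooth_pderiv.
have iw : mu.-integrable Omega (fun x : leb_space R n => (dotp (F x) (grad w x))%:E).
  by apply: (integrable_flux _ gwP) => j; apply: mgrad; have [] := tw.
have ipsi : mu.-integrable Omega (fun x : leb_space R n => (dotp (F x) (grad psi x))%:E).
  by apply: (integrable_flux _ gP) => j; exact: mgrad.
have w0 : (\int[mu]_(x in Omega) (dotp (F x) (grad w x))%:E = 0)%E.
  have := hsol w (grad w) (test_fun_sobolev_phi0 (@subDsetl _ _ _) mOE tw).
  rewrite integral_mkcond => <-; rewrite [LHS]integral_mkcond.
  apply: eq_integral => x _; rewrite !patchE.
  case: ifPn => [|xO]; last by rewrite memNset// => -[Ox _]; move: xO; rewrite mem_set.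
  rewrite in_setE => Ox; case: ifPn => //; rewrite notin_setE => nx.
  rewrite grad_support0 ?dotp0r//; have [_ _ h] := tw.
  by move=> /h.
pose rest x := eta x * dotp (F x) (grad psi x) + psi x * dotp (F x) (grad eta x).
have restE x : rest x = dotp (F x) (grad psi x) - dotp (F x) (grad w x).
  rewrite /rest gw dotpDr dotpNr !dotpZr; ring.
have -> : (\int[mu]_(x in Omega) (dotp (F x) (grad psi x))%:E =
    \int[mu]_(x in Omega) (rest x)%:E)%E.
  under [RHS]eq_integral do rewrite restE EFinB.
  by rewrite (integralB mO ipsi iw) w0 sube0.
have mrest : measurable_fun (Omega : set (leb_space R n)) (fun x : leb_space R n => (rest x)%:E).
  under eq_fun do rewrite restE EFinB.
  by apply: emeasurable_funB; [exact: measurable_int ipsi|exact: measurable_int iw].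
apply: (le_trans (le_abse_integral mu mO mrest)).
have dbl' j : j \in s -> (\int[mu]_(x in eball (c j) (2 * r j) `&` Omega)
    (phi x (r j)^-1)%:E <= C%:E * h_phi phi (c j) (r j))%E.
  by move=> js; apply: dbl => //; [exact: rk|exact: BO].
have [mbd bd] := integral_flux_cutoff_bound a00 a10 a20 C0 r0 BO dbl' hM.
apply: (@le_trans _ _ (a0%:E * mu (Omega `&` X) +
   (a1%:E * \int[mu]_(x in Omega `&` X) (g x)%:E + (a2 * C * M)%:E))%E).
  apply: le_trans bd; apply: ae_ge0_le_integral.
  - exact: mO.
  - by move=> x _; exact: abse_ge0.
  - by apply: measurableT_comp; [exact: abse_measurable|exact: mrest].
  - move=> x Ox; apply: adde_ge0; last apply: adde_ge0.
    + by rewrite patchE; case: ifP => // _; rewrite lee_fin.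
    + rewrite patchE; case: ifP => // _.
      by rewrite lee_fin mulr_ge0// energy_ge0.
    + apply: sume_ge0 => j _; rewrite patchE; case: ifP => // _.
      by rewrite lee_fin mulr_ge0// (Phi_ge0 hphi Ox)// invr_ge0 ltW.
  - exact: mbd.
  - apply: (ae_on mO gp) => // x Ox Gx.
    apply: (flux_cutoff_bound Gx P0 C21 (ltW eps0) K11 K1e K21 K2e r0
      (psiP x) (gP x) (eta01 x)) => //.
    by move=> nXx; apply: eta0 => j js xj; apply: nXx; exists j.
have t3 : a2 * C * M <= e3.
  have -> : a2 * C * M = e3 * (T / (T + 1)).
    by rewrite /a2 /eps /T; field; rewrite gt_eqF// ltr_wpDl.
  by rewrite ler_piMr// ?(ltW e30)// ler_pdivrMr ?ltr_wpDl// mul1r lerDl.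
have frac (a : R) : 0 <= a -> a * (e3 / (a + 1)) <= e3.
  move=> a_ge0; rewrite mulrCA ler_piMr// ?(ltW e30)//.
  by rewrite ler_pdivrMr ?ltr_wpDl// mul1r lerDl.
have t1 : (a0%:E * mu (Omega `&` X) <= e3%:E)%E.
  apply: (@le_trans _ _ (a0%:E * (e3 / (a0 + 1))%:E)%E); last by rewrite lee_fin frac.
  apply: lee_wpmul2l; first by rewrite lee_fin.
  by apply: (le_trans (ltW muX)); rewrite lee_fin ge_min lexx orbT.
have mOX : measurable (Omega `&` X : set (leb_space R n)).
  apply: measurableI; first exact: mO.
  rewrite [Y in measurable Y](_ : _ =
      \bigcup_(j in [set j | j \in s]) eball (c j) (2 * r j)).
    by apply: bigcup_measurable => j _; exact: eball_measurable.
  by apply/seteqP; split=> x [j ? ?]; exists j.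
have t2 : (a1%:E * \int[mu]_(x in Omega `&` X) (g x)%:E <= e3%:E)%E.
  apply: (@le_trans _ _ (a1%:E * (e3 / (a1 + 1))%:E)%E); last by rewrite lee_fin frac.
  apply: lee_wpmul2l; first by rewrite lee_fin.
  apply: ltW; apply: small => //; apply: (lt_le_trans muX).
  by rewrite lee_fin ge_min lexx.
have -> : e%:E = (e3%:E + (e3%:E + e3%:E))%E by rewrite -!EFinD; congr EFin; rewrite /e3; field.
by apply: leeD => //; apply: leeD => //; rewrite lee_fin.
Qed.

Lemma measurable_enorm (D : set V) (z : V -> V) :
  (forall j, leb_measurable_fun D (fun x => z x ord0 j)) ->
  leb_measurable_fun D (fun x => enorm (z x)).
Proof.
move=> mz; have ms : measurable_fun setT (@Num.sqrt R).
  by apply: continuous_measurable_fun; exact: sqrt_continuous.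
have md : measurable_fun (D : set (leb_space R n))
    (fun x : leb_space R n => dotp (z x) (z x)).
  by apply: measurable_sum => j; apply: measurable_funM; exact: mz.
exact: (measurableT_comp ms md).
Qed.

Lemma lux_norm_ge0 (U : set V) (f : V -> R) : (0 <= lux_norm phi U f)%E.
Proof.
by apply: le_ereal_inf_tmp => _ [l [l0 _] <-]; rewrite lee_fin ltW.
Qed.

(** If l exceeds the Luxemburg norm of z, Young's inequality with constant 1 at
    the argument |z| / l bounds the integral of |A(x,Du)| |z| by a multiple of l, so
    the flux acts continuously on gradients. *)
Lemma solves_of_test_fun :
  (forall psi, test_fun Omega psi ->
    (\int[mu]_(x in Omega) (dotp (F x) (grad psi x))%:E = 0)%E) ->
  solves_on phi A Omega Du.
Proof.
move=> htest w Dw [[[_ iDw _] _ _] approx].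
have mDw j : leb_measurable_fun Omega (fun x => Dw x ord0 j).
  by apply/measurable_EFinP; exact: measurable_int (iDw j).
have [K K1 Ke] := young_const p1 L1 (@ltr01 R).
have K0 : 0 <= K by exact: le_trans K1.
have g0 : (0 <= \int[mu]_(x in Omega) (g x)%:E)%E.
  by apply: integral_ge0 => x Ox; rewrite lee_fin energy_ge0.
pose M := fine (\int[mu]_(x in Omega) (g x)%:E).
have gM : (\int[mu]_(x in Omega) (g x)%:E = M%:E)%E.
  by rewrite /M fineK// ge0_fin_numE// integral_energy_lty.
have M0 : 0 <= M by exact: fine_ge0.
pose T := c1 * (1 + K * M).
have T0 : 0 <= T by rewrite mulr_ge0 ?(ltW c10)// addr_ge0// mulr_ge0.
apply: abse_le_eq0 => e e0.
have eT0 : 0 < e / (T + 1) by rewrite divr_gt0// ltr_wpDl.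
have [psi tpsi nlt] := approx _ eT0; have [spsi _ _] := tpsi.
have [P [_ [P0 _ gP _]]] := test_fun_bounded tpsi.
pose z x := Dw x - grad psi x.
have [_ [l [l0 hl] <-] le] : exists2 m, [set l%:E | l in [set l : R | 0 < l /\
    (\int[mu]_(x in Omega) (phi x (`|enorm (z x)| / l)%R)%:E <= 1)%E]] m &
    (m < (e / (T + 1))%:E)%E.
  apply: ereal_inf_lt; apply: le_lt_trans nlt.
  by rewrite -[leLHS]add0e; apply: leeD2r; exact: lux_norm_ge0.
have mgrad j : leb_measurable_fun Omega (fun x => grad psi x ord0 j).
  apply: leb_measurable_continuous => //.
  under eq_fun do rewrite mxE; exact/smooth_continuous/smooth_pderiv.
have mz j : leb_measurable_fun Omega (fun x => z x ord0 j).
  rewrite /leb_measurable_fun; under eq_fun do rewrite !mxE.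
  apply: measurable_funB; first exact: mDw.
  by have := mgrad j; rewrite /leb_measurable_fun; under eq_fun do rewrite mxE.
have l0' : 0 <= l by exact: ltW.
have f0 x : 0 <= `|enorm (z x)| / l by rewrite divr_ge0.
have mf : leb_measurable_fun Omega (fun x => `|enorm (z x)| / l).
  apply: measurable_funM; last exact: measurable_cst.
  by apply: measurableT_comp; [exact: normr_measurable|exact: measurable_enorm].
have mphi : measurable_fun (Omega : set (leb_space R n))
    (fun x : leb_space R n => (phi x (`|enorm (z x)| / l))%:E).
  apply/measurable_EFinP; exact: (measurable_Phi_comp mO hphi gp (fun _ h => h) mO mf f0).
have lc0 : 0 <= l * c1 by rewrite mulr_ge0// ltW.
have lcK0 : 0 <= l * c1 * K by rewrite mulr_ge0.
pose h x := l * c1 * phi x (`|enorm (z x)| / l) + l * c1 * K * g x.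
have m1 : measurable_fun (Omega : set (leb_space R n)) (fun x : leb_space R n =>
    (l * c1)%:E * (phi x (`|enorm (z x)| / l))%:E)%E by exact: measurable_funeM.
have m2 : measurable_fun (Omega : set (leb_space R n)) (fun x : leb_space R n =>
    (l * c1 * K)%:E * (g x)%:E)%E.
  by apply: measurable_funeM; exact: measurable_energy.
have hE x : (h x)%:E = ((l * c1)%:E * (phi x (`|enorm (z x)| / l))%:E +
    (l * c1 * K)%:E * (g x)%:E)%E by rewrite /h EFinD !EFinM.
have q1 x : Omega x -> (0 <= (l * c1)%:E * (phi x (`|enorm (z x)| / l))%:E)%E.
  by move=> Ox; rewrite -EFinM lee_fin mulr_ge0// (Phi_ge0 hphi Ox).
have q2 x : Omega x -> (0 <= (l * c1 * K)%:E * (g x)%:E)%E.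
  by move=> Ox; rewrite -EFinM lee_fin mulr_ge0// energy_ge0.
have inth : (\int[mu]_(x in Omega) (h x)%:E <= (l * T)%:E)%E.
  under eq_integral do rewrite hE.
  rewrite (ge0_integralD _ mO q1 m1 q2 m2).
  rewrite (ge0_integralZl_EFin _ mO _ mphi lc0); last first.
    by move=> x Ox; rewrite lee_fin (Phi_ge0 hphi Ox).
  rewrite (ge0_integralZl_EFin _ mO _ measurable_energy lcK0); last first.
    by move=> x Ox; rewrite lee_fin energy_ge0.
  rewrite gM (_ : l * T = l * c1 * 1 + l * c1 * K * M); last by rewrite /T; ring.
  rewrite EFinD; apply: leeD; last by rewrite -EFinM.
  by rewrite [leRHS]EFinM; apply: lee_wpmul2l; [rewrite lee_fin|exact: hl].
have intz : (\int[mu]_(x in Omega) `|(dotp (F x) (z x))%:E| <= (l * T)%:E)%E.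
  apply: le_trans inth; apply: integrable_of_flux_le.
  - by [].
  - exact: mO.
  - exact: mz.
  - by move=> x Ox; rewrite -lee_fin hE; apply: adde_ge0; [exact: q1|exact: q2].
  - by under eq_fun do rewrite hE; exact: emeasurable_funD.
  - move=> x Ox Gx; apply: (le_trans (norm_dotp_le _ _)).
    have := flux_young Gx K1 Ke (f0 x); rewrite mul1r => fy.
    have -> : h x = l * (c1 * (phi x (`|enorm (z x)| / l) + K * g x)) by rewrite /h; ring.
    have -> : enorm (F x) * enorm (z x) = l * (enorm (F x) * (`|enorm (z x)| / l)).
      by rewrite (ger0_norm (enorm_ge0 _)); field; rewrite gt_eqF.
    by rewrite ler_pM2l.
have mFz : measurable_fun (Omega : set (leb_space R n))
    (fun x : leb_space R n => (dotp (F x) (z x))%:E).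
  by apply/measurable_EFinP; exact: (measurable_dotp_flux (fun _ h => h) mO mz).
have iz : mu.-integrable Omega (fun x : leb_space R n => (dotp (F x) (z x))%:E).
  by apply/integrableP; split; [exact: mFz|exact: le_lt_trans intz (ltry _)].
have ipsi := integrable_flux mgrad gP.
have -> : (\int[mu]_(x in Omega) (dotp (F x) (Dw x))%:E =
    \int[mu]_(x in Omega) (dotp (F x) (z x))%:E)%E.
  rewrite -[RHS]add0e -(htest psi tpsi) -(integralD mO ipsi iz).
  apply: eq_integral => x _.
  by rewrite -EFinD /z dotpDr dotpNr addrC subrK.
apply: (le_trans (le_abse_integral mu mO mFz)); apply: (le_trans intz).
rewrite lee_fin; apply: (@le_trans _ _ (e / (T + 1) * T)).
  by apply: ler_wpM2r => //; apply: ltW; rewrite -lte_fin.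
by rewrite mulrAC ler_pdivrMr ?ltr_wpDl// ler_pM2l// lerDl.
Qed.

End weak_solutions.

(** * Removability *)

Theorem corollary3p1 (R : realType) (n : nat) (Omega : set 'rV[R]_n)
    (phi : 'rV[R]_n -> R -> R) (p q c1 c2 : R)
    (A : 'rV[R]_n -> 'rV[R]_n -> 'rV[R]_n) (E : set 'rV[R]_n)
    (u : 'rV[R]_n -> R) (Du : 'rV[R]_n -> 'rV[R]_n)
    (hn : (2 <= n)%N)
    (hOmega_open : open Omega) (hOmega_bounded : bounded_set Omega)
    (hphi : convex_Phi Omega phi)
    (hA0 : A0 Omega phi) (hA1 : A1 Omega phi)
    (hp : 1 < p) (hpq : p <= q) (hq : q <= n%:R)
    (haInc : aInc Omega phi p) (haDec : aDec Omega phi q)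
    (hc1 : 0 < c1) (hc2 : 0 < c2)
    (hA : structure_conditions Omega phi c1 c2 A)
    (hE : relatively_closed Omega E)
    (hHE : (Hausdorff_phi Omega phi E < +oo)%E)
    (hu : sobolev_phi phi Omega u Du)
    (hsol : solves_on phi A (Omega `\` E) Du) :
  solves_on phi A Omega Du.
Proof.
have [L L1 [G gp]] := exists_good_points hOmega_open hphi haInc haDec hA.
have mO := open_leb_measurable hOmega_open.
have bO := leb_bounded hOmega_bounded.
have n0 : (0 < n)%N by exact: leq_trans hn.
have q0 : 0 <= q by apply: le_trans hpq; exact/ltW/(lt_trans ltr01).
have [C [k [C0 k0 dbl]]] := h_phi_double mO hphi gp n0 q0 hq L1 hA0 hA1.
have [b /andP[b0 _] [phib bphi]] := hA0.
have [[_ iDu _] _ LDu] := hu.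
have mDu j : leb_measurable_fun Omega (fun x => Du x ord0 j).
  by apply/measurable_EFinP; exact: measurable_int (iDu j).
have mA := A_measurable hA.
apply: (solves_of_test_fun mO bO n0 hp L1 q0 hc1 hphi gp b0 phib mA mDu LDu).
move=> psi tpsi.
exact: (test_fun_solution mO bO n0 hp L1 q0 hc1 hphi gp b0 phib mA mDu LDu
  hE hHE bphi C0 k0 dbl hsol tpsi).
Qed.
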